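(* Let $\lambda<1$ and $-\pi/2<\alpha<\pi/2$ with $\alpha\neq0$. Then $J[f]\in\mathcal{S}$ for every $f\in\mathcal{S}^*_\alpha(\lambda)$ if and only if $\cos\alpha\le \frac{1}{2(1-\lambda)}$. Moreover, if $-1/2\le\lambda<1$, then $J[f]\in\mathcal{S}$ for every $f\in\mathcal{S}^*_0(\lambda)$.
   Context: $\mathbb{D}$ is the open unit disk; $\mathcal{A}$ the class of analytic $f$ on $\mathbb{D}$ with $f(0)=0$, $f'(0)=1$; $\mathcal{S}\subset\mathcal{A}$ the univalent functions. For $\alpha\in(-\pi/2,\pi/2)$, $\lambda<1$, $\mathcal{S}^*_\alpha(\lambda)=\{f\in\mathcal{A}: f(z)\neq0 \text{ for } z\ne 0,\ \mathrm{Re}\,(e^{i\alpha}zf'(z)/f(z))>\lambda\cos\alpha \text{ on }\mathbb{D}\}$. The Alexander transform is $J[f](z)=\int_0^z f(w)/w\,dw$. *)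

(* Defs.v *)
From Stdlib Require Import Reals.
From Coquelicot Require Import Coquelicot.
Open Scope R_scope.

Definition inD (z : C) : Prop := Cmod z < 1.

Definition analytic_on_D (f : C -> C) : Prop :=
  forall z : C, inD z -> ex_derive f z.

Definition classA (f : C -> C) : Prop :=
  analytic_on_D f /\ f (RtoC 0) = (RtoC 0) /\ is_derive f (RtoC 0) (RtoC 1).

Definition classS (f : C -> C) : Prop :=
  classA f /\ (forall z w : C, inD z -> inD w -> f z = f w -> z = w).

Definition cexpi (a : R) : C := (cos a, sin a).

(* S^*_alpha(lambda); d is the complex derivative f'(z) (it exists and is
   unique since f is analytic).  At z = 0 the quotient z f'(z)/f(z) is understood as its
   removable-singularity value 1, for which the inequality
   Re(e^{i alpha}) = cos alpha > lambda cos alpha holds automatically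
   (lambda < 1, |alpha| < pi/2); so the condition is imposed for z <> 0. *)
Definition starlike_al (alpha lambda : R) (f : C -> C) : Prop :=
  classA f /\
  (forall z : C, inD z -> z <> (RtoC 0) -> f z <> (RtoC 0)) /\
  (forall (z : C) (d : C), inD z -> z <> (RtoC 0) -> is_derive f z d ->
     Re (cexpi alpha * (z * d / f z))%C > lambda * cos alpha).

(* the integrand w |-> f(w)/w, with its removable-singularity value f'(0) = 1 at 0 *)
Definition quot0 (f : C -> C) (w : C) : C :=
  if Ceq_dec w (RtoC 0) then (RtoC 1) else (f w / w)%C.

(* Alexander transform J[f](z) = \int_0^z f(w)/w dw, the integral being taken
   along the segment [0, z] parametrised by w = t z, t in [0,1]. *)
Definition alexander (f : C -> C) (z : C) : C :=
  @RInt C_R_CompleteNormedModule (fun t : R => (z * quot0 f (RtoC t * z))%C) 0 1.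

(* Main.v *)
Require Import Defs.
From Stdlib Require Import Reals Lra Lia Psatz Classical ClassicalEpsilon.
From Coquelicot Require Import Coquelicot.
Open Scope R_scope.

(** Write [g = J[f]], so [g' = f/z], and [P = z f'/f]; with [mu = (1-lambda) cos(alpha) e^(-i alpha)],
    [P = 1 + 2 mu w/(1-w)] for a Schwarz function [w].

    Univalence comes from chains [g + t k], [t >= 0]. If
    [Re (k / (z (g' + t k'))) > beta/(1+t)] for [|z| <= r (1+t)^(-beta)], then the solution [z(t)] of
    [g(z) + t k(z) = const] stays in that shrinking disc, so two points with the same image under [g]
    can be transported to arbitrarily large [t], where [g + t k] is nearly affine on a tiny disc, hence
    injective. For [|mu| <= 1/2] take [k = f/(1 - 2 mu)] (Ahlfors' criterion in disguise).
    For [alpha = 0], [lambda >= -1/2] take [k = z (g')^(2/3)]: the quotients [z g'/k = (g')^(1/3)] and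
    [z k'/k = (1 + 2 P)/3] have positive real part, the first by Jack's lemma.

    If [|mu| > 1/2] and [alpha <> 0], choose [nu = R e^(-i alpha)] with [1 < R < 2 |mu|] close to [1];
    then [f = z (1-z)^(-nu)] is admissible, and [J[f]] is affine in [(1-z)^(1-nu)], which is not
    injective because [|Im (2 pi i/(1-nu))| < pi]. *)

(** The transport equation is dz/dt = - k/(g' + t k'), along which log |z| has derivative - Re (k/(z
    (g' + t k'))); this is where the decay condition comes from. The equation is never solved.
    Instead one takes the supremum of the times at which g + t k repeats a value in its disc:
    compactness produces a colliding pair at that time, and one exact small step moves it past the
    supremum. The factor 1 - 2 mu is chosen so that z (g' + t k')/k - (1 + t) is divisible by 2 mu;
    then |mu| <= 1/2 places z (g' + t k')/k in a disc with 0 on its boundary, which inversion maps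
    to a half-plane. For alpha = 0 one has mu = 1 - lambda, which exceeds 1/2 as soon as lambda <
    1/2, so another k is required. The exponent 2/3 makes Re ((1 + 2 P)/3) > 0 the same as Re P >
    -1/2, and that is also the half-plane which Jack's lemma asks for the power 1/3. On the other
    side, when R cos(alpha) < 1, the inequality |Im (2 pi i/(1 - nu))| < pi is equivalent to R > 1,
    so the counterexamples reach exactly down to the same threshold. *)

(** * Calculus for functions into C *)

(* [e] embeds the parameter space in [C]: with [e = RtoC] these are continuity and
   differentiability of curves, with [e = idC] of functions of a complex variable. *)
Definition ctn {T : Type} (e f : T -> C) (x : T) : Prop :=
  forall eps, 0 < eps -> exists del, 0 < del /\
    forall y, Cmod (e y - e x)%C < del -> Cmod (f y - f x)%C < eps.

Definition der {T : Type} (e f : T -> C) (x : T) (d : C) : Prop :=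
  forall eps, 0 < eps -> exists del, 0 < del /\
    forall y, Cmod (e y - e x)%C < del ->
      Cmod (f y - f x - d * (e y - e x))%C <= eps * Cmod (e y - e x)%C.

Definition idC (z : C) : C := z.

Lemma Cmod_sub_sym (x y : C) : Cmod (x - y)%C = Cmod (y - x)%C.
Proof. rewrite <- Cmod_opp. f_equal. ring. Qed.

Lemma Cmod_triangle_sub (x y : C) : Cmod x <= Cmod y + Cmod (x - y)%C.
Proof.
  replace x with (y + (x - y))%C at 1 by ring. apply Cmod_triangle.
Qed.

Lemma Cmod_minus_le (x y : C) : Cmod (x - y)%C <= Cmod x + Cmod y.
Proof.
  unfold Cminus. eapply Rle_trans; [apply Cmod_triangle|].
  rewrite Cmod_opp. lra.
Qed.

Lemma Cmod_sq (z : C) : Cmod z * Cmod z = Re z * Re z + Im z * Im z.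
Proof.
  generalize (Cmod2_alt z). simpl. rewrite !Rmult_1_r. auto.
Qed.

Lemma Cmod_Rpos (x : R) : 0 <= x -> Cmod (RtoC x) = x.
Proof. intros H. rewrite Cmod_R. now apply Rabs_pos_eq. Qed.

(** Supplies the tolerance for most later estimates. It is stated with a product, so A = 0 is
    allowed, and the cap at 1 lets a product of two small errors be bounded by a single one. *)
Lemma eps_ratio (eps A : R) : 0 < eps -> 0 <= A ->
  exists eta, 0 < eta /\ eta * A <= eps /\ eta <= 1.
Proof.
  intros He HA. exists (Rmin 1 (eps / (A + 1))).
  assert (0 < eps / (A + 1)) by (apply Rdiv_lt_0_compat; lra).
  assert (eps / (A + 1) * (A + 1) = eps) by (field; lra).
  split; [apply Rmin_glb_lt; lra|]. split; [|apply Rmin_l].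
  pose proof (Rmin_r 1 (eps / (A + 1))).
  assert (0 < Rmin 1 (eps / (A + 1))) by (apply Rmin_glb_lt; lra). nra.
Qed.

Section Calculus.
Context {T : Type} (e : T -> C).

Lemma ctn_const (c : C) x : ctn e (fun _ => c) x.
Proof.
  intros eps He. exists 1. split; [lra|]. intros y _.
  replace (c - c)%C with (RtoC 0) by ring. now rewrite Cmod_0.
Qed.

Lemma ctn_e x : ctn e e x.
Proof. intros eps He. exists eps. auto. Qed.

Lemma ctn_plus f g x : ctn e f x -> ctn e g x -> ctn e (fun y => f y + g y)%C x.
Proof.
  intros Hf Hg eps He.
  destruct (Hf (eps / 2)) as [d1 [Hd1 H1]]; [lra|].
  destruct (Hg (eps / 2)) as [d2 [Hd2 H2]]; [lra|].
  exists (Rmin d1 d2). split; [now apply Rmin_glb_lt|]. intros y Hy.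
  assert (Cmod (e y - e x)%C < d1) by (eapply Rlt_le_trans; [apply Hy|apply Rmin_l]).
  assert (Cmod (e y - e x)%C < d2) by (eapply Rlt_le_trans; [apply Hy|apply Rmin_r]).
  replace (f y + g y - (f x + g x))%C with ((f y - f x) + (g y - g x))%C by ring.
  eapply Rle_lt_trans; [apply Cmod_triangle|].
  specialize (H1 y H). specialize (H2 y H0). lra.
Qed.

Lemma ctn_mult f g x : ctn e f x -> ctn e g x -> ctn e (fun y => f y * g y)%C x.
Proof.
  intros Hf Hg eps He.
  pose proof (Cmod_ge_0 (f x)). pose proof (Cmod_ge_0 (g x)).
  destruct (eps_ratio (eps / 2) (Cmod (f x) + Cmod (g x) + 1)) as [eta [E1 [E2 E3]]]; try lra.
  destruct (Hf eta) as [d1 [Hd1 H1]]; [lra|].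
  destruct (Hg eta) as [d2 [Hd2 H2]]; [lra|].
  exists (Rmin d1 d2). split; [now apply Rmin_glb_lt|]. intros y Hy.
  assert (L1 : Cmod (e y - e x)%C < d1) by (eapply Rlt_le_trans; [apply Hy|apply Rmin_l]).
  assert (L2 : Cmod (e y - e x)%C < d2) by (eapply Rlt_le_trans; [apply Hy|apply Rmin_r]).
  specialize (H1 y L1). specialize (H2 y L2).
  replace (f y * g y - f x * g x)%C
    with ((f y - f x) * g x + (f x * (g y - g x) + (f y - f x) * (g y - g x)))%C by ring.
  eapply Rle_lt_trans; [apply Cmod_triangle|].
  eapply Rle_lt_trans; [apply Rplus_le_compat_l, Cmod_triangle|].
  rewrite !Cmod_mult.
  pose proof (Cmod_ge_0 (f y - f x)%C). pose proof (Cmod_ge_0 (g y - g x)%C).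
  nra.
Qed.

Lemma ctn_comp (h : C -> C) f x :
  ctn e f x -> ctn idC h (f x) -> ctn e (fun y => h (f y)) x.
Proof.
  intros Hf Hh eps He. destruct (Hh eps He) as [d1 [Hd1 H1]].
  destruct (Hf d1 Hd1) as [d2 [Hd2 H2]]. exists d2. split; auto.
  intros y Hy. apply H1. unfold idC. auto.
Qed.

Lemma ctn_ext f g x del : 0 < del ->
  (forall y, Cmod (e y - e x)%C < del -> f y = g y) -> ctn e f x -> ctn e g x.
Proof.
  intros Hd E Hf eps He. destruct (Hf eps He) as [d [Hd1 H1]].
  exists (Rmin d del). split; [now apply Rmin_glb_lt|]. intros y Hy.
  rewrite <- E, <- E. apply H1.
  eapply Rlt_le_trans; [apply Hy|apply Rmin_l].
  replace (e x - e x)%C with (RtoC 0) by ring. now rewrite Cmod_0.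
  eapply Rlt_le_trans; [apply Hy|apply Rmin_r].
Qed.

Lemma der_const (c : C) x : der e (fun _ => c) x (RtoC 0).
Proof.
  intros eps He. exists 1. split; [lra|]. intros y _.
  replace (c - c - 0 * (e y - e x))%C with (RtoC 0) by ring. rewrite Cmod_0.
  apply Rmult_le_pos; [lra|apply Cmod_ge_0].
Qed.

Lemma der_e x : der e e x (RtoC 1).
Proof.
  intros eps He. exists 1. split; [lra|]. intros y _.
  replace (e y - e x - 1 * (e y - e x))%C with (RtoC 0) by ring. rewrite Cmod_0.
  apply Rmult_le_pos; [lra|apply Cmod_ge_0].
Qed.

Lemma der_eq f x d d' : der e f x d -> d = d' -> der e f x d'.
Proof. intros H <-. exact H. Qed.

Lemma der_ext f g x d del : 0 < del ->
  (forall y, Cmod (e y - e x)%C < del -> f y = g y) -> der e f x d -> der e g x d.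
Proof.
  intros Hd E Hf eps He. destruct (Hf eps He) as [d1 [Hd1 H1]].
  exists (Rmin d1 del). split; [now apply Rmin_glb_lt|]. intros y Hy.
  rewrite <- E, <- E. apply H1.
  eapply Rlt_le_trans; [apply Hy|apply Rmin_l].
  replace (e x - e x)%C with (RtoC 0) by ring. now rewrite Cmod_0.
  eapply Rlt_le_trans; [apply Hy|apply Rmin_r].
Qed.

Lemma der_plus f g x d d' : der e f x d -> der e g x d' ->
  der e (fun y => f y + g y)%C x (d + d')%C.
Proof.
  intros Hf Hg eps He.
  destruct (Hf (eps / 2)) as [d1 [Hd1 H1]]; [lra|].
  destruct (Hg (eps / 2)) as [d2 [Hd2 H2]]; [lra|].
  exists (Rmin d1 d2). split; [now apply Rmin_glb_lt|]. intros y Hy.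
  assert (L1 : Cmod (e y - e x)%C < d1) by (eapply Rlt_le_trans; [apply Hy|apply Rmin_l]).
  assert (L2 : Cmod (e y - e x)%C < d2) by (eapply Rlt_le_trans; [apply Hy|apply Rmin_r]).
  specialize (H1 y L1). specialize (H2 y L2).
  replace (f y + g y - (f x + g x) - (d + d') * (e y - e x))%C
    with ((f y - f x - d * (e y - e x)) + (g y - g x - d' * (e y - e x)))%C by ring.
  eapply Rle_trans; [apply Cmod_triangle|]. lra.
Qed.

Lemma der_lip f x d : der e f x d -> exists del, 0 < del /\
  forall y, Cmod (e y - e x)%C < del ->
    Cmod (f y - f x)%C <= (Cmod d + 1) * Cmod (e y - e x)%C.
Proof.
  intros Hf. destruct (Hf 1) as [d1 [Hd1 H1]]; [lra|].
  exists d1. split; auto. intros y Hy. specialize (H1 y Hy).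
  replace (f y - f x)%C with ((f y - f x - d * (e y - e x)) + d * (e y - e x))%C by ring.
  eapply Rle_trans; [apply Cmod_triangle|]. rewrite Cmod_mult. lra.
Qed.

Lemma der_ctn f x d : der e f x d -> ctn e f x.
Proof.
  intros Hf eps He. destruct (der_lip _ _ _ Hf) as [d1 [Hd1 H1]].
  pose proof (Cmod_ge_0 d).
  exists (Rmin d1 (eps / (Cmod d + 1))).
  assert (0 < eps / (Cmod d + 1)) by (apply Rdiv_lt_0_compat; lra).
  split; [now apply Rmin_glb_lt|]. intros y Hy.
  assert (L1 : Cmod (e y - e x)%C < d1) by (eapply Rlt_le_trans; [apply Hy|apply Rmin_l]).
  assert (L2 : Cmod (e y - e x)%C < eps / (Cmod d + 1)) by (eapply Rlt_le_trans; [apply Hy|apply Rmin_r]).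
  eapply Rle_lt_trans; [now apply H1|].
  apply Rmult_lt_reg_r with (/ (Cmod d + 1)); [apply Rinv_0_lt_compat; lra|].
  replace ((Cmod d + 1) * Cmod (e y - e x)%C * / (Cmod d + 1)) with (Cmod (e y - e x)%C)
    by (field; lra). exact L2.
Qed.

Lemma der_mult f g x d d' : der e f x d -> der e g x d' ->
  der e (fun y => f y * g y)%C x (d * g x + f x * d')%C.
Proof.
  intros Hf Hg eps He.
  pose proof (Cmod_ge_0 (f x)) as P1. pose proof (Cmod_ge_0 (g x)) as P2.
  pose proof (Cmod_ge_0 d) as P3.
  destruct (eps_ratio eps (Cmod (f x) + Cmod (g x) + (Cmod d + 1))) as [eta [E1 [E2 E3]]]; try lra.
  destruct (Hf eta E1) as [d1 [Hd1 H1]].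
  destruct (Hg eta E1) as [d2 [Hd2 H2]].
  destruct (der_lip _ _ _ Hf) as [d3 [Hd3 H3]].
  destruct (der_ctn _ _ _ Hg eta E1) as [d4 [Hd4 H4]].
  exists (Rmin (Rmin d1 d2) (Rmin d3 d4)).
  split; [repeat apply Rmin_glb_lt; auto|]. intros y Hy.
  pose proof (Rmin_l (Rmin d1 d2) (Rmin d3 d4)). pose proof (Rmin_r (Rmin d1 d2) (Rmin d3 d4)).
  pose proof (Rmin_l d1 d2). pose proof (Rmin_r d1 d2).
  pose proof (Rmin_l d3 d4). pose proof (Rmin_r d3 d4).
  specialize (H1 y ltac:(lra)). specialize (H2 y ltac:(lra)).
  specialize (H3 y ltac:(lra)). specialize (H4 y ltac:(lra)).
  set (h := (e y - e x)%C) in *.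
  replace (f y * g y - f x * g x - (d * g x + f x * d') * h)%C
    with ((f y - f x - d * h) * g x + (f x * (g y - g x - d' * h) + (f y - f x) * (g y - g x)))%C by ring.
  eapply Rle_trans; [apply Cmod_triangle|].
  eapply Rle_trans; [apply Rplus_le_compat_l, Cmod_triangle|].
  rewrite !Cmod_mult.
  pose proof (Cmod_ge_0 (f y - f x)%C). pose proof (Cmod_ge_0 (g y - g x)%C).
  pose proof (Cmod_ge_0 h).
  assert (Cmod (f y - f x - d * h)%C * Cmod (g x) <= eta * Cmod h * Cmod (g x))
    by (apply Rmult_le_compat_r; auto).
  assert (Cmod (f x) * Cmod (g y - g x - d' * h)%C <= Cmod (f x) * (eta * Cmod h))
    by (apply Rmult_le_compat_l; auto).
  assert (Cmod (f y - f x)%C * Cmod (g y - g x)%C <= ((Cmod d + 1) * Cmod h) * eta)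
    by (apply Rmult_le_compat; lra).
  assert (eta * (Cmod (f x) + Cmod (g x) + (Cmod d + 1)) * Cmod h <= eps * Cmod h)
    by (apply Rmult_le_compat_r; auto).
  lra.
Qed.

Lemma der_comp (h : C -> C) f x d d' :
  der e f x d -> der idC h (f x) d' -> der e (fun y => h (f y)) x (d' * d)%C.
Proof.
  intros Hf Hh eps He.
  pose proof (Cmod_ge_0 d) as P1. pose proof (Cmod_ge_0 d') as P2.
  destruct (eps_ratio eps (Cmod d' + (Cmod d + 1))) as [eta [E1 [E2 E3]]]; try lra.
  destruct (Hh eta E1) as [d1 [Hd1 H1]].
  destruct (Hf eta E1) as [d2 [Hd2 H2]].
  destruct (der_lip _ _ _ Hf) as [d3 [Hd3 H3]].
  destruct (der_ctn _ _ _ Hf d1 Hd1) as [d4 [Hd4 H4]].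
  exists (Rmin d2 (Rmin d3 d4)).
  split; [repeat apply Rmin_glb_lt; auto|]. intros y Hy.
  pose proof (Rmin_l d2 (Rmin d3 d4)). pose proof (Rmin_r d2 (Rmin d3 d4)).
  pose proof (Rmin_l d3 d4). pose proof (Rmin_r d3 d4).
  specialize (H2 y ltac:(lra)). specialize (H3 y ltac:(lra)). specialize (H4 y ltac:(lra)).
  specialize (H1 (f y) H4). unfold idC in H1.
  set (k := (e y - e x)%C) in *.
  replace (h (f y) - h (f x) - d' * d * k)%C
    with ((h (f y) - h (f x) - d' * (f y - f x)) + d' * (f y - f x - d * k))%C by ring.
  eapply Rle_trans; [apply Cmod_triangle|]. rewrite Cmod_mult.
  pose proof (Cmod_ge_0 k).
  assert (Cmod d' * Cmod (f y - f x - d * k)%C <= Cmod d' * (eta * Cmod k))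
    by (apply Rmult_le_compat_l; auto).
  assert (eta * Cmod (f y - f x)%C <= eta * ((Cmod d + 1) * Cmod k))
    by (apply Rmult_le_compat_l; lra).
  assert (eta * (Cmod d' + (Cmod d + 1)) * Cmod k <= eps * Cmod k)
    by (apply Rmult_le_compat_r; auto).
  lra.
Qed.

Lemma der_opp f x d : der e f x d -> der e (fun y => - f y)%C x (- d)%C.
Proof.
  intros Hf eps He. destruct (Hf eps He) as [d1 [Hd1 H1]]. exists d1. split; auto.
  intros y Hy.
  replace (- f y - - f x - - d * (e y - e x))%C with (- (f y - f x - d * (e y - e x)))%C by ring.
  rewrite Cmod_opp. auto.
Qed.

Lemma der_minus f g x d d' : der e f x d -> der e g x d' ->
  der e (fun y => f y - g y)%C x (d - d')%C.
Proof. intros Hf Hg. unfold Cminus. apply der_plus; auto. now apply der_opp. Qed.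

Lemma der_scal (c : C) f x d : der e f x d -> der e (fun y => c * f y)%C x (c * d)%C.
Proof.
  intros Hf. eapply der_eq; [apply der_mult; [apply (der_const c)|apply Hf]|]. cbv beta; ring.
Qed.

Lemma ctn_opp f x : ctn e f x -> ctn e (fun y => - f y)%C x.
Proof.
  intros Hf eps He. destruct (Hf eps He) as [d1 [Hd1 H1]]. exists d1. split; auto.
  intros y Hy. replace (- f y - - f x)%C with (- (f y - f x))%C by ring.
  rewrite Cmod_opp. auto.
Qed.

Lemma ctn_minus f g x : ctn e f x -> ctn e g x -> ctn e (fun y => f y - g y)%C x.
Proof. intros Hf Hg. unfold Cminus. apply ctn_plus; auto. now apply ctn_opp. Qed.

End Calculus.

Lemma der_id (z : C) : der idC (fun w => w) z (RtoC 1).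
Proof. apply (der_e idC). Qed.

Lemma ctn_id (z : C) : ctn idC (fun w => w) z.
Proof. apply (ctn_e idC). Qed.

Lemma der_Cinv (z : C) : z <> RtoC 0 -> der idC Cinv z (- / (z * z))%C.
Proof.
  intros Hz eps He. pose proof (proj1 (Cmod_gt_0 z) Hz) as Pz.
  set (m := Cmod z) in *.
  exists (Rmin (m / 2) (eps * (m * m * m) / 2)).
  assert (0 < m * m * m) by (repeat apply Rmult_lt_0_compat; auto).
  split. { apply Rmin_glb_lt; [lra|]. apply Rdiv_lt_0_compat; [|lra]. apply Rmult_lt_0_compat; auto. }
  intros y Hy. unfold idC in *.
  pose proof (Rmin_l (m / 2) (eps * (m * m * m) / 2)).
  pose proof (Rmin_r (m / 2) (eps * (m * m * m) / 2)).
  assert (Hw : m / 2 < Cmod y).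
  { pose proof (Cmod_triangle_sub z y) as T. rewrite Cmod_sub_sym in T. fold m in T. lra. }
  assert (Hy0 : y <> RtoC 0). { apply Cmod_gt_0. lra. }
  replace (/ y - / z - - / (z * z) * (y - z))%C with ((y - z) * (y - z) * / (y * (z * z)))%C
    by (field; auto).
  rewrite !Cmod_mult, Cmod_inv, !Cmod_mult by (repeat apply Cmult_neq_0; auto). fold m.
  rewrite (Rmult_comm eps), Rmult_assoc. apply Rmult_le_compat_l; [apply Cmod_ge_0|].
  apply Rmult_le_reg_r with (Cmod y * (m * m)); [repeat apply Rmult_lt_0_compat; lra|].
  rewrite Rmult_assoc, Rinv_l, Rmult_1_r.
  2:{ apply Rgt_not_eq. repeat apply Rmult_lt_0_compat; lra. }
  assert (eps * (m / 2 * (m * m)) <= eps * (Cmod y * (m * m))).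
  { apply Rmult_le_compat_l; [lra|]. apply Rmult_le_compat_r; [nra|lra]. }
  lra.
Qed.

Lemma der_div {T : Type} (e f g : T -> C) x d d' : g x <> RtoC 0 ->
  der e f x d -> der e g x d' ->
  der e (fun y => f y / g y)%C x ((d * g x - f x * d') / (g x * g x))%C.
Proof.
  intros H0 Hf Hg. unfold Cdiv at 1. eapply der_eq.
  - apply der_mult; [apply Hf|]. apply der_comp; [apply Hg|]. now apply der_Cinv.
  - cbv beta; field. auto.
Qed.

Lemma ctn_Cinv z : z <> RtoC 0 -> ctn idC Cinv z.
Proof. intros H. eapply der_ctn. now apply der_Cinv. Qed.

Lemma ctn_div {T : Type} (e f g : T -> C) x : g x <> RtoC 0 ->
  ctn e f x -> ctn e g x -> ctn e (fun y => f y / g y)%C x.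
Proof.
  intros H0 Hf Hg. unfold Cdiv. apply ctn_mult; auto.
  apply ctn_comp; auto. now apply ctn_Cinv.
Qed.

Lemma Cmod_prod_norm (z : C) : @norm R_AbsRing C_R_NormedModule z = Cmod z.
Proof. symmetry. apply Cmod_norm. Qed.

Lemma is_derive_der (f : C -> C) z d : is_derive f z d <-> der idC f z d.
Proof.
  split.
  - intros [_ H] eps He. specialize (H z (fun P HP => HP) (mkposreal eps He)).
    destruct H as [[del Hd] H]. exists del. split; auto.
    intros y Hy. specialize (H y). unfold idC in *. simpl in H.
    replace (f y - f z - d * (y - z))%C with
      (minus (minus (f y) (f z)) (scal (minus y z) d)).
    2:{ unfold minus, plus, opp, scal; simpl. unfold mult; simpl. ring. }
    apply H. exact Hy.
  - intros H. split; [apply is_linear_scal_l|].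
    intros x Hx.
    apply (@is_filter_lim_locally_unique C_AbsRing (AbsRing_NormedModule C_AbsRing)) in Hx.
    subst x. intros [eps He]. destruct (H eps He) as [del [Hd H1]].
    exists (mkposreal del Hd). intros y Hy. simpl.
    specialize (H1 y Hy). unfold idC in *.
    match goal with |- norm ?a <= _ => replace a with (f y - f z - d * (y - z))%C end.
    2:{ unfold minus, plus, opp, scal; simpl. unfold mult; simpl. ring. }
    exact H1.
Qed.

Lemma der_unique (f : C -> C) z d d' : der idC f z d -> der idC f z d' -> d = d'.
Proof.
  intros H1 H2. apply is_derive_der in H1. apply is_derive_der in H2.
  apply is_C_derive_unique in H1. apply is_C_derive_unique in H2. congruence.
Qed.

Lemma is_derive_R_der (f : R -> C) x d : der RtoC f x d ->
  @is_derive R_AbsRing C_R_NormedModule f x d.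
Proof.
  intros H. split; [apply is_linear_scal_l|].
  intros y Hy.
  apply (@is_filter_lim_locally_unique R_AbsRing (AbsRing_NormedModule R_AbsRing)) in Hy.
  subst y. intros [eps He]. destruct (H eps He) as [del [Hd H1]].
  exists (mkposreal del Hd). intros y Hy. simpl.
  assert (E : Cmod (RtoC y - RtoC x)%C = Rabs (y - x)) by now rewrite <- RtoC_minus, Cmod_R.
  specialize (H1 y ltac:(rewrite E; exact Hy)). rewrite E in H1. rewrite Cmod_prod_norm.
  match goal with |- Cmod ?a <= _ => replace a with (f y - f x - d * (RtoC y - RtoC x))%C end.
  2:{ rewrite scal_R_Cmult, <- RtoC_minus, (Cmult_comm d). reflexivity. }
  exact H1.
Qed.

Lemma continuous_ctn (f : R -> C) x : ctn RtoC f x ->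
  @continuous R_UniformSpace C_R_CompleteNormedModule f x.
Proof.
  intros H. apply filterlim_locally. intros [eps He].
  destruct (H eps He) as [del [Hd H1]].
  exists (mkposreal del Hd). intros y Hy.
  (* The balls of this uniform structure are products of intervals; a disc lies in the square of the
     same radius. *)
  apply C_NormedModule_mixin_compat1. apply H1.
  rewrite <- RtoC_minus, Cmod_R. exact Hy.
Qed.

(** * Goursat's theorem on cones over curves *)

(** The same integral as in [alexander], so that [alexander f] is [prim (quot0 f)] by conversion. *)
Definition CInt (f : R -> C) (a b : R) : C := @RInt C_R_CompleteNormedModule f a b.

Definition cont_on (f : R -> C) (a b : R) : Prop :=
  forall x, a <= x <= b -> ctn RtoC f x.

Lemma cont_on_sub f a b a' b' : cont_on f a b -> a <= a' -> b' <= b -> cont_on f a' b'.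
Proof. intros H ? ? x Hx. apply H. lra. Qed.

Lemma CInt_ex f a b : a <= b -> cont_on f a b ->
  @ex_RInt C_R_CompleteNormedModule f a b.
Proof.
  intros Hab H. apply ex_RInt_continuous. intros x Hx.
  rewrite Rmin_left, Rmax_right in Hx by auto. apply continuous_ctn. now apply H.
Qed.

Lemma CInt_correct f a b : a <= b -> cont_on f a b ->
  @is_RInt C_R_CompleteNormedModule f a b (CInt f a b).
Proof. intros. apply RInt_correct. now apply CInt_ex. Qed.

Lemma CInt_unique f a b v : @is_RInt C_R_CompleteNormedModule f a b v -> CInt f a b = v.
Proof. intros H. exact (@is_RInt_unique C_R_CompleteNormedModule _ _ _ _ H). Qed.

Lemma CInt_ext f g a b : a <= b -> (forall x, a <= x <= b -> f x = g x) ->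
  CInt f a b = CInt g a b.
Proof.
  intros Hab H. unfold CInt. apply (RInt_ext (V := C_R_CompleteNormedModule)). intros x Hx.
  rewrite Rmin_left, Rmax_right in Hx by auto. apply H. lra.
Qed.

Lemma CInt_plus f g a b : a <= b -> cont_on f a b -> cont_on g a b ->
  CInt (fun x => f x + g x)%C a b = (CInt f a b + CInt g a b)%C.
Proof.
  intros. apply CInt_unique.
  apply (@is_RInt_plus C_R_NormedModule); now apply CInt_correct.
Qed.

(** A complex factor mixes the two coordinates, so the rule is assembled from real scalings of the
    coordinate integrals. *)
Lemma is_RInt_scal_RtoC (f : R -> C) (a b : R) (I c : C) :
  @is_RInt C_R_NormedModule f a b I ->
  @is_RInt C_R_NormedModule (fun x => c * f x)%C a b (c * I)%C.
Proof.
  intros H. destruct c as [c1 c2].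
  pose proof (is_RInt_fct_extend_fst _ _ _ _ H) as H1.
  pose proof (is_RInt_fct_extend_snd _ _ _ _ H) as H2.
  apply (is_RInt_fct_extend_pair (U := R_NormedModule) (V := R_NormedModule)).
  - apply (is_RInt_ext (fun x => minus (scal c1 (fst (f x))) (scal c2 (snd (f x))))); [reflexivity|].
    apply (is_RInt_minus (V := R_NormedModule));
      now apply (is_RInt_scal (V := R_NormedModule)).
  - apply (is_RInt_ext (fun x => plus (scal c1 (snd (f x))) (scal c2 (fst (f x))))); [reflexivity|].
    apply (is_RInt_plus (V := R_NormedModule));
      now apply (is_RInt_scal (V := R_NormedModule)).
Qed.

Lemma CInt_scal f c a b : a <= b -> cont_on f a b ->
  CInt (fun x => c * f x)%C a b = (c * CInt f a b)%C.
Proof.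
  intros. apply CInt_unique. apply is_RInt_scal_RtoC. now apply CInt_correct.
Qed.

Lemma cont_on_scal f c a b : cont_on f a b -> cont_on (fun x => c * f x)%C a b.
Proof. intros H x Hx. apply ctn_mult; [apply ctn_const|auto]. Qed.

Lemma cont_on_plus f g a b : cont_on f a b -> cont_on g a b -> cont_on (fun x => f x + g x)%C a b.
Proof. intros H G x Hx. apply ctn_plus; auto. Qed.

Lemma cont_on_minus f g a b : cont_on f a b -> cont_on g a b -> cont_on (fun x => f x - g x)%C a b.
Proof. intros H G x Hx. apply ctn_minus; auto. Qed.

Lemma cont_on_mult f g a b : cont_on f a b -> cont_on g a b -> cont_on (fun x => f x * g x)%C a b.
Proof. intros H G x Hx. apply ctn_mult; auto. Qed.

Lemma CInt_minus f g a b : a <= b -> cont_on f a b -> cont_on g a b ->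
  CInt (fun x => f x - g x)%C a b = (CInt f a b - CInt g a b)%C.
Proof.
  intros Hab Hf Hg.
  rewrite (CInt_ext _ (fun x => f x + - (1) * g x)%C) by (auto; intros; ring).
  rewrite CInt_plus, CInt_scal; auto; [ring|]. now apply cont_on_scal.
Qed.

Lemma CInt_chasles f a b c : a <= b -> b <= c -> cont_on f a c ->
  CInt f a c = (CInt f a b + CInt f b c)%C.
Proof.
  intros Hab Hbc H. symmetry. unfold CInt.
  apply (RInt_Chasles (V := C_R_CompleteNormedModule));
    apply CInt_ex; auto; eapply cont_on_sub; eauto; lra.
Qed.

Lemma CInt_bound f a b M : a <= b -> cont_on f a b ->
  (forall x, a <= x <= b -> Cmod (f x) <= M) -> Cmod (CInt f a b) <= M * (b - a).
Proof.
  intros Hab H HM. rewrite Rmult_comm. rewrite <- Cmod_prod_norm.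
  apply (norm_RInt_le_const f a b _ M Hab).
  - intros x Hx. rewrite Cmod_prod_norm. auto.
  - now apply CInt_correct.
Qed.

Lemma CInt_FTC (F f : R -> C) a b : a <= b ->
  (forall x, a <= x <= b -> der RtoC F x (f x)) -> cont_on f a b ->
  CInt f a b = (F b - F a)%C.
Proof.
  intros Hab HF Hf. apply CInt_unique.
  apply (is_RInt_derive (V := C_R_CompleteNormedModule) F f).
  - intros x Hx. rewrite Rmin_left, Rmax_right in Hx by auto.
    apply is_derive_R_der. auto.
  - intros x Hx. rewrite Rmin_left, Rmax_right in Hx by auto.
    apply continuous_ctn. auto.
Qed.

Lemma CInt_const c a b : a <= b -> CInt (fun _ => c) a b = (RtoC (b - a) * c)%C.
Proof.
  intros Hab. rewrite (CInt_FTC (fun x => RtoC x * c)%C); auto.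
  - rewrite RtoC_minus. ring.
  - intros x _. eapply der_eq; [apply der_mult; [apply (der_e RtoC)|apply der_const]|]. cbv beta; ring.
  - intros x _. apply ctn_const.
Qed.

(** Curves in the plane have no mean value point, so the inequality is obtained by integrating the
    derivative. *)
Lemma der_lip_on (F f : R -> C) M a b x y :
  (forall x, a <= x <= b -> der RtoC F x (f x)) -> cont_on f a b ->
  (forall x, a <= x <= b -> Cmod (f x) <= M) -> a <= x <= b -> a <= y <= b ->
  Cmod (F y - F x)%C <= M * Rabs (y - x).
Proof.
  intros HF Hf HM.
  assert (K : forall x y, a <= x -> x <= y -> y <= b -> Cmod (F y - F x)%C <= M * (y - x)).
  { intros u v ? ? ?. rewrite <- (CInt_FTC F f u v); auto.
    - apply CInt_bound; auto. eapply cont_on_sub; eauto. intros. apply HM. lra.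
    - intros. apply HF. lra.
    - eapply cont_on_sub; eauto. }
  intros Hx Hy. destruct (Rle_dec x y).
  - rewrite Rabs_pos_eq by lra. apply K; lra.
  - rewrite Cmod_sub_sym, Rabs_minus_sym, Rabs_pos_eq by lra. apply K; lra.
Qed.

(** * Dyadic bisection of the unit square *)

Lemma half_pow_lt (d : R) : 0 < d -> exists n, (/ 2) ^ n < d.
Proof.
  intros Hd. destruct (pow_lt_1_zero (/ 2)) with (y := d) as [N HN]; auto.
  - rewrite Rabs_pos_eq; lra.
  - exists N. specialize (HN N (le_n N)). rewrite Rabs_pos_eq in HN; auto.
    apply pow_le. lra.
Qed.

(** Here [x n] is the left end of a dyadic interval of length 2^(-n), and each interval is contained
    in the one before. The supremum of the left ends lies in all of them. *)
Lemma nested_halves (x : nat -> R) :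
  (forall n, x n <= x (S n) <= x n + (/ 2) ^ n / 2) ->
  exists X, forall n, x n <= X <= x n + (/ 2) ^ n.
Proof.
  intros H.
  assert (K : forall n k, x n <= x (n + k)%nat /\ x (n + k)%nat + (/ 2) ^ (n + k) <= x n + (/ 2) ^ n).
  { intros n k. induction k as [|k [I1 I2]].
    - rewrite Nat.add_0_r. lra.
    - rewrite <- plus_n_Sm. specialize (H (n + k)%nat). simpl pow. lra. }
  assert (P : forall n, 0 < (/ 2) ^ n) by (intros; apply pow_lt; lra).
  assert (B : forall n m, x n <= x m + (/ 2) ^ m).
  { intros n m. destruct (Nat.le_ge_cases n m) as [L|L].
    - replace m with (n + (m - n))%nat by (rewrite Nat.add_comm; apply Nat.sub_add; auto).
      destruct (K n (m - n)%nat). specialize (P (n + (m - n))%nat). lra.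
    - destruct (K m (n - m)%nat) as [_ I2]. rewrite Nat.add_comm, Nat.sub_add in I2 by auto.
      specialize (P n). lra. }
  destruct (completeness (fun t => exists n, t = x n)) as [X [U L]].
  - exists (x 0%nat + 1). intros t [n ->]. specialize (B n 0%nat). simpl in B. lra.
  - exists (x 0%nat), 0%nat. auto.
  - exists X. intros n. split.
    + apply U. exists n. auto.
    + apply L. intros t [m ->]. apply B.
Qed.

(** If [G] failed on the unit square, it would fail on some quarter of every bad square. The
    resulting nested bad squares shrink to a point, and near that point the local hypothesis gives
    [G]. *)
Lemma square_bisect (G : R -> R -> R -> Prop) :
  (forall x y l, 0 < l -> G x y (l / 2) -> G (x + l / 2) y (l / 2) ->
     G x (y + l / 2) (l / 2) -> G (x + l / 2) (y + l / 2) (l / 2) -> G x y l) ->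
  (forall x0 y0, 0 <= x0 <= 1 -> 0 <= y0 <= 1 -> exists del, 0 < del /\
     forall x y l, 0 < l < del -> x <= x0 <= x + l -> y <= y0 <= y + l -> G x y l) ->
  G 0 0 1.
Proof.
  intros Hsub Hloc. apply NNPP. intros N0.
  (* The type of bad squares; packing the failure into the type lets the choice of a bad quarter be
     iterated as a function. *)
  set (S := {p : R * R * R | 0 < snd p /\ ~ G (fst (fst p)) (snd (fst p)) (snd p)}).
  assert (Step : forall p : S, exists q : S,
    let '(x, y, l) := proj1_sig p in let '(x', y', l') := proj1_sig q in
    l' = l / 2 /\ x <= x' <= x + l / 2 /\ y <= y' <= y + l / 2).
  { intros [[[x y] l] [Hl Hn]]. simpl in *.
    assert (exists x' y', x <= x' <= x + l / 2 /\ y <= y' <= y + l / 2 /\ ~ G x' y' (l / 2))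
      as [x' [y' [A [B C]]]].
    { apply NNPP. intros N. apply Hn.
      assert (Q : forall x' y', x <= x' <= x + l / 2 -> y <= y' <= y + l / 2 -> G x' y' (l / 2)).
      { intros x' y' A B. apply NNPP. intros C. apply N. eauto. }
      apply Hsub; auto; apply Q; lra. }
    assert (Pf : 0 < l / 2) by lra.
    exists (exist _ (x', y', l / 2) (conj Pf C)). simpl. auto. }
  set (nxt := fun p => proj1_sig (constructive_indefinite_description _ (Step p))).
  set (p0 := exist (fun p : R * R * R => 0 < snd p /\ ~ G (fst (fst p)) (snd (fst p)) (snd p))
               (0, 0, 1) (conj Rlt_0_1 N0)).
  set (s := fix s n := match n with O => p0 | Datatypes.S n => nxt (s n) end).
  set (xs := fun n => fst (fst (proj1_sig (s n)))).
  set (ys := fun n => snd (fst (proj1_sig (s n)))).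
  set (ls := fun n => snd (proj1_sig (s n))).
  assert (St : forall n, ls (Datatypes.S n) = ls n / 2 /\ xs n <= xs (Datatypes.S n) <= xs n + ls n / 2 /\
     ys n <= ys (Datatypes.S n) <= ys n + ls n / 2).
  { intros n. unfold xs, ys, ls. simpl s.
    unfold nxt. destruct (constructive_indefinite_description _ (Step (s n))) as [q Hq]. simpl.
    destruct (proj1_sig (s n)) as [[x y] l]. destruct (proj1_sig q) as [[x' y'] l']. simpl. auto. }
  assert (Ls : forall n, ls n = (/ 2) ^ n).
  { induction n; [reflexivity|]. destruct (St n) as [-> _]. rewrite IHn. simpl. lra. }
  destruct (nested_halves xs) as [X HX]. { intros n. rewrite <- Ls. apply St. }
  destruct (nested_halves ys) as [Y HY]. { intros n. rewrite <- Ls. apply St. }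
  destruct (Hloc X Y) as [del [Hd Hg]].
  { specialize (HX 0%nat). unfold xs in HX. simpl in HX. lra. }
  { specialize (HY 0%nat). unfold ys in HY. simpl in HY. lra. }
  destruct (half_pow_lt del Hd) as [n Hn].
  destruct (proj2_sig (s n)) as [_ Bad]. apply Bad. apply Hg.
  - fold (ls n). rewrite Ls. split; auto. apply pow_lt. lra.
  - fold (ls n). rewrite Ls. apply HX.
  - fold (ls n). rewrite Ls. apply HY.
Qed.

(* The affine part of [h] has the primitive [w |-> h0 w + D (w - w0)^2 / 2]. *)
Lemma path_integral_affine_approx (h : C -> C) (psi psi' : R -> C) (h0 D w0 : C) eta M a b :
  a <= b -> 0 <= eta ->
  (forall t, a <= t <= b -> der RtoC psi t (psi' t)) -> cont_on psi' a b ->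
  (forall t, a <= t <= b -> ctn idC h (psi t)) ->
  (forall t, a <= t <= b -> Cmod (psi' t) <= M) ->
  (forall t, a <= t <= b -> Cmod (h (psi t) - h0 - D * (psi t - w0))%C <= eta) ->
  let H w := (h0 * w + D * ((w - w0) * (w - w0)) / 2)%C in
  Cmod (CInt (fun t => h (psi t) * psi' t)%C a b - (H (psi b) - H (psi a)))%C <= eta * M * (b - a).
Proof.
  intros Hab He Hpsi Hc Hh HM Hap H.
  assert (Cpsi : cont_on psi a b) by (intros t Ht; eapply der_ctn; apply Hpsi; auto).
  assert (C1 : cont_on (fun t => h (psi t) * psi' t)%C a b).
  { apply cont_on_mult; auto. intros t Ht. apply ctn_comp; auto. }
  assert (C2 : cont_on (fun t => (h0 + D * (psi t - w0)) * psi' t)%C a b).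
  { apply cont_on_mult; auto. apply cont_on_plus; [intros t Ht; apply ctn_const|].
    apply cont_on_scal. apply cont_on_minus; auto. intros t Ht; apply ctn_const. }
  rewrite <- (CInt_FTC (fun t => H (psi t)) (fun t => (h0 + D * (psi t - w0)) * psi' t)%C a b); auto.
  - rewrite <- CInt_minus; auto. apply CInt_bound; auto.
    + apply cont_on_minus; auto.
    + intros t Ht.
      replace (h (psi t) * psi' t - (h0 + D * (psi t - w0)) * psi' t)%C
        with ((h (psi t) - h0 - D * (psi t - w0)) * psi' t)%C by ring.
      rewrite Cmod_mult. apply Rmult_le_compat; auto using Cmod_ge_0.
  - intros t Ht. unfold H.
    assert (Dm : der RtoC (fun t => psi t - w0)%C t (psi' t - 0)%C)
      by (apply der_minus; [auto|apply der_const]).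
    eapply der_eq.
    + apply der_plus; [apply der_scal; auto|].
      unfold Cdiv. apply der_mult; [|apply der_const].
      apply der_scal. apply der_mult; exact Dm.
    + cbv beta. field.
Qed.

Section Goursat.
Variables (h : C -> C) (z0 : C) (a b : R) (gam gam' : R -> C) (M : R).
Hypothesis Ha : 0 <= a.
Hypothesis Hb : 0 <= b.
Hypothesis Hab : a + b <= 1.
Hypothesis Hgam : forall y, 0 <= y <= 1 -> der RtoC gam y (gam' y).
Hypothesis Hgam' : cont_on gam' 0 1.
Hypothesis HM : forall y, 0 <= y <= 1 -> Cmod (gam y) <= M.
Hypothesis HM' : forall y, 0 <= y <= 1 -> Cmod (gam' y) <= M.

(** The unit square is mapped onto the part of the cone with apex [z0] over [gam] between the scales
    [a] and [a + b]. One theorem thus serves triangles (a = 0, b = 1) and the ring between a circle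
    and its contraction (a = s, b = 1 - s). *)
Let phi x y := (z0 + RtoC (a + b * x) * gam y)%C.
Hypothesis Hh : forall x y, 0 <= x <= 1 -> 0 <= y <= 1 -> exists d, der idC h (phi x y) d.

Let phix (x y : R) := (RtoC b * gam y)%C.
Let phiy x y := (RtoC (a + b * x) * gam' y)%C.
Let SX x1 x2 y := CInt (fun x => h (phi x y) * phix x y)%C x1 x2.
Let SY x y1 y2 := CInt (fun y => h (phi x y) * phiy x y)%C y1 y2.
(** The contour integral of [h] over the image of the boundary of a rectangle, pulled back to the
    rectangle. *)
Let Bd x1 x2 y1 y2 := (SX x1 x2 y1 + SY x2 y1 y2 - SX x1 x2 y2 - SY x1 y1 y2)%C.

Lemma goursat_der_x y x : der RtoC (fun x => phi x y) x (phix x y).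
Proof.
  unfold phi, phix.
  apply (der_ext _ (fun x => z0 + (RtoC a + RtoC b * RtoC x) * gam y)%C _ _ _ 1); [lra| |].
  { intros t _. now rewrite RtoC_plus, RtoC_mult. }
  eapply der_eq.
  - apply der_plus; [apply der_const|]. apply der_mult; [|apply der_const].
    apply der_plus; [apply der_const|]. apply der_scal. apply (der_e RtoC).
  - cbv beta. ring.
Qed.

Lemma goursat_der_y x y : 0 <= y <= 1 -> der RtoC (fun y => phi x y) y (phiy x y).
Proof.
  intros Hy. unfold phi, phiy. eapply der_eq.
  - apply der_plus; [apply der_const|]. apply der_scal. auto.
  - cbv beta. ring.
Qed.

Lemma goursat_coef x : 0 <= x <= 1 -> 0 <= a + b * x <= 1.
Proof. intros. nra. Qed.

Lemma goursat_phix_le x y : 0 <= y <= 1 -> Cmod (phix x y) <= M.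
Proof.
  intros Hy. unfold phix. rewrite Cmod_mult, Cmod_Rpos by auto.
  pose proof (Cmod_ge_0 (gam y)). specialize (HM y Hy). nra.
Qed.

Lemma goursat_phiy_le x y : 0 <= x <= 1 -> 0 <= y <= 1 -> Cmod (phiy x y) <= M.
Proof.
  intros Hx Hy. unfold phiy. pose proof (goursat_coef x Hx).
  rewrite Cmod_mult, Cmod_Rpos by lra.
  pose proof (Cmod_ge_0 (gam' y)). specialize (HM' y Hy). nra.
Qed.

Lemma goursat_phix_cont y u v : cont_on (fun x => phix x y) u v.
Proof. intros t _. apply (ctn_const RtoC (RtoC b * gam y)%C). Qed.

Lemma goursat_phi_lip x y x0 y0 l : 0 <= x <= 1 -> 0 <= y <= 1 -> 0 <= x0 <= 1 -> 0 <= y0 <= 1 ->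
  Rabs (x - x0) <= l -> Rabs (y - y0) <= l -> Cmod (phi x y - phi x0 y0)%C <= 2 * M * l.
Proof.
  intros Hx Hy Hx0 Hy0 L1 L2.
  assert (E1 : Cmod (phi x y - phi x0 y)%C <= M * Rabs (x - x0)).
  { apply (der_lip_on (fun x => phi x y) (fun x => phix x y) M 0 1); auto.
    - intros t _. apply goursat_der_x.
    - apply goursat_phix_cont.
    - intros t _. now apply goursat_phix_le. }
  assert (E2 : Cmod (phi x0 y - phi x0 y0)%C <= M * Rabs (y - y0)).
  { apply (der_lip_on (fun y => phi x0 y) (fun y => phiy x0 y) M 0 1); auto.
    - intros t Ht. now apply goursat_der_y.
    - unfold phiy. now apply cont_on_scal.
    - intros t Ht. now apply goursat_phiy_le. }
  replace (phi x y - phi x0 y0)%C with ((phi x y - phi x0 y) + (phi x0 y - phi x0 y0))%C by ring.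
  eapply Rle_trans; [apply Cmod_triangle|].
  assert (0 <= M). { eapply Rle_trans; [apply Cmod_ge_0|apply (HM 0); lra]. }
  nra.
Qed.

Lemma goursat_h_ctn x y : 0 <= x <= 1 -> 0 <= y <= 1 -> ctn idC h (phi x y).
Proof. intros Hx Hy. destruct (Hh x y Hx Hy) as [d Hd]. eapply der_ctn; eauto. Qed.

Lemma goursat_cont_x y : 0 <= y <= 1 -> cont_on (fun x => h (phi x y) * phix x y)%C 0 1.
Proof.
  intros Hy. apply cont_on_mult; [|apply goursat_phix_cont].
  intros t Ht. apply ctn_comp; [eapply der_ctn; apply goursat_der_x|now apply goursat_h_ctn].
Qed.

Lemma goursat_cont_y x : 0 <= x <= 1 -> cont_on (fun y => h (phi x y) * phiy x y)%C 0 1.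
Proof.
  intros Hx. apply cont_on_mult; [|now apply cont_on_scal].
  intros t Ht. apply ctn_comp; [eapply der_ctn; now apply goursat_der_y|now apply goursat_h_ctn].
Qed.

Lemma goursat_Bd_add x y l : 0 < l -> 0 <= x -> x + l <= 1 -> 0 <= y -> y + l <= 1 ->
  Bd x (x + l) y (y + l) =
  (Bd x (x + l / 2) y (y + l / 2) + Bd (x + l / 2) (x + l / 2 + l / 2) y (y + l / 2) +
   Bd x (x + l / 2) (y + l / 2) (y + l / 2 + l / 2) +
   Bd (x + l / 2) (x + l / 2 + l / 2) (y + l / 2) (y + l / 2 + l / 2))%C.
Proof.
  intros Hl X1 X2 Y1 Y2.
  replace (x + l / 2 + l / 2) with (x + l) by field.
  replace (y + l / 2 + l / 2) with (y + l) by field.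
  unfold Bd, SX, SY.
  rewrite (CInt_chasles (fun x => h (phi x y) * phix x y)%C x (x + l / 2) (x + l)),
    (CInt_chasles (fun t => h (phi t (y + l)) * phix t (y + l))%C x (x + l / 2) (x + l)),
    (CInt_chasles (fun y => h (phi x y) * phiy x y)%C y (y + l / 2) (y + l)),
    (CInt_chasles (fun y => h (phi (x + l) y) * phiy (x + l) y)%C y (y + l / 2) (y + l)); try lra.
  ring.
  eapply cont_on_sub; [apply goursat_cont_y| |]; lra.
  eapply cont_on_sub; [apply goursat_cont_y| |]; lra.
  eapply cont_on_sub; [apply goursat_cont_x| |]; lra.
  eapply cont_on_sub; [apply goursat_cont_x| |]; lra.
Qed.

(** The affine part of [h] at the point has a primitive, whose increments cancel around the contour.
    Only the remainder is left: it is at most eta 2 M l on each of four sides whose image has length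
    at most M l, whence the constant 8 M^2. *)
Lemma goursat_local eps x0 y0 : 0 < eps -> 0 <= x0 <= 1 -> 0 <= y0 <= 1 ->
  exists del, 0 < del /\ forall x y l, 0 < l < del -> x <= x0 <= x + l -> y <= y0 <= y + l ->
    0 <= x -> x + l <= 1 -> 0 <= y -> y + l <= 1 ->
    Cmod (Bd x (x + l) y (y + l)) <= eps * (l * l).
Proof.
  intros He Hx0 Hy0. destruct (Hh x0 y0 Hx0 Hy0) as [D HD].
  assert (M0 : 0 <= M). { eapply Rle_trans; [apply Cmod_ge_0|apply (HM 0); lra]. }
  destruct (eps_ratio eps (8 * M * M)) as [eta [E1 [E2 E3]]]; [auto|nra|].
  destruct (HD eta E1) as [d [Hd Hap]]. unfold idC in Hap.
  (* The image of a square of side l stays within 2 M l of the base point, so this keeps it where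
     the approximation of [h] is valid. *)
  exists (d / (2 * M + 1)). split; [apply Rdiv_lt_0_compat; lra|].
  intros x y l Hl Hx Hy X1 X2 Y1 Y2.
  set (w0 := phi x0 y0) in *. set (h0 := h w0) in *.
  assert (Q : 2 * M * l < d).
  { assert (l * (2 * M + 1) < d).
    { apply Rmult_lt_reg_r with (/ (2 * M + 1)); [apply Rinv_0_lt_compat; lra|].
      rewrite Rmult_assoc, Rinv_r by lra. unfold Rdiv in Hl. lra. }
    lra. }
  assert (Ap : forall u v, x <= u <= x + l -> y <= v <= y + l ->
    Cmod (h (phi u v) - h0 - D * (phi u v - w0))%C <= eta * (2 * M * l)).
  { intros u v Hu Hv.
    assert (Cmod (phi u v - w0)%C <= 2 * M * l).
    { apply goursat_phi_lip; try lra; apply Rabs_le; lra. }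
    eapply Rle_trans; [apply Hap; lra|]. apply Rmult_le_compat_l; lra. }
  assert (P0 : 0 <= eta * (2 * M * l)) by (apply Rmult_le_pos; nra).
  assert (SXe : forall v, y <= v <= y + l ->
    let H w := (h0 * w + D * ((w - w0) * (w - w0)) / 2)%C in
    Cmod (SX x (x + l) v - (H (phi (x + l) v) - H (phi x v)))%C <= eta * (2 * M * l) * M * l).
  { intros v Hv H.
    pose proof (path_integral_affine_approx h (fun t => phi t v) (fun t => phix t v)
      h0 D w0 (eta * (2 * M * l)) M x (x + l)) as K. cbv zeta in K.
    replace (x + l - x) with l in K by ring. apply K; clear K; auto; try lra.
    - intros; apply goursat_der_x.
    - apply goursat_phix_cont.
    - intros; apply goursat_h_ctn; lra.
    - intros; apply goursat_phix_le; lra. }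
  assert (SYe : forall u, x <= u <= x + l ->
    let H w := (h0 * w + D * ((w - w0) * (w - w0)) / 2)%C in
    Cmod (SY u y (y + l) - (H (phi u (y + l)) - H (phi u y)))%C <= eta * (2 * M * l) * M * l).
  { intros u Hu H.
    pose proof (path_integral_affine_approx h (fun t => phi u t) (fun t => phiy u t)
      h0 D w0 (eta * (2 * M * l)) M y (y + l)) as K. cbv zeta in K.
    replace (y + l - y) with l in K by ring. apply K; clear K; auto; try lra.
    - intros; apply goursat_der_y; lra.
    - eapply cont_on_sub; [apply cont_on_scal, Hgam'| |]; lra.
    - intros; apply goursat_h_ctn; lra.
    - intros; apply goursat_phiy_le; lra. }
  cbv zeta in SXe, SYe.
  set (H := fun w => (h0 * w + D * ((w - w0) * (w - w0)) / 2)%C) in *.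
  pose proof (SXe y ltac:(lra)) as A1. pose proof (SXe (y + l) ltac:(lra)) as A2.
  pose proof (SYe x ltac:(lra)) as A3. pose proof (SYe (x + l) ltac:(lra)) as A4.
  fold (H (phi (x + l) y)) (H (phi x y)) in A1.
  fold (H (phi (x + l) (y + l))) (H (phi x (y + l))) in A2.
  fold (H (phi x (y + l))) (H (phi x y)) in A3.
  fold (H (phi (x + l) (y + l))) (H (phi (x + l) y)) in A4.
  unfold Bd.
  replace (SX x (x + l) y + SY (x + l) y (y + l) - SX x (x + l) (y + l) - SY x y (y + l))%C
   with ((SX x (x + l) y - (H (phi (x + l) y) - H (phi x y))) +
         (SY (x + l) y (y + l) - (H (phi (x + l) (y + l)) - H (phi (x + l) y))) -
         (SX x (x + l) (y + l) - (H (phi (x + l) (y + l)) - H (phi x (y + l)))) -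
         (SY x y (y + l) - (H (phi x (y + l)) - H (phi x y))))%C by ring.
  eapply Rle_trans; [apply Cmod_minus_le|].
  eapply Rle_trans; [apply Rplus_le_compat_r, Cmod_minus_le|].
  eapply Rle_trans; [apply Rplus_le_compat_r, Rplus_le_compat_r, Cmod_triangle|].
  assert (eta * (8 * M * M) * (l * l) <= eps * (l * l)) by (apply Rmult_le_compat_r; nra).
  lra.
Qed.

(** The bound eps l^2 is proportional to the area, hence additive under quartering, and bisection
    spreads it from small squares to the whole one for every eps. *)
Lemma goursat_cone : Bd 0 1 0 1 = RtoC 0.
Proof.
  apply Cmod_eq_0. apply Rle_antisym; [|apply Cmod_ge_0].
  apply le_epsilon. intros eps He.
  assert (K : let G x y l := 0 <= x -> x + l <= 1 -> 0 <= y -> y + l <= 1 ->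
    Cmod (Bd x (x + l) y (y + l)) <= eps * (l * l) in G 0 0 1).
  { apply square_bisect.
    - intros x y l Hl G1 G2 G3 G4 X1 X2 Y1 Y2. rewrite goursat_Bd_add by auto.
      specialize (G1 ltac:(lra) ltac:(lra) ltac:(lra) ltac:(lra)).
      specialize (G2 ltac:(lra) ltac:(lra) ltac:(lra) ltac:(lra)).
      specialize (G3 ltac:(lra) ltac:(lra) ltac:(lra) ltac:(lra)).
      specialize (G4 ltac:(lra) ltac:(lra) ltac:(lra) ltac:(lra)).
      eapply Rle_trans; [apply Cmod_triangle|].
      eapply Rle_trans; [apply Rplus_le_compat_r, Cmod_triangle|].
      eapply Rle_trans; [apply Rplus_le_compat_r, Rplus_le_compat_r, Cmod_triangle|].
      lra.
    - intros x0 y0 Hx0 Hy0. destruct (goursat_local eps x0 y0 He Hx0 Hy0) as [d [Hd K]].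
      exists d. split; auto. }
  specialize (K ltac:(lra) ltac:(lra) ltac:(lra) ltac:(lra)).
  rewrite !Rplus_0_l in K. lra.
Qed.

End Goursat.


(** * Primitives, the exponential and Cauchy's formula *)

Definition hol (h : C -> C) : Prop := forall z, inD z -> exists d, der idC h z d.

Lemma hol_analytic h : hol h <-> analytic_on_D h.
Proof.
  split.
  - intros H z Hz. destruct (H z Hz) as [d Hd]. exists d. now apply is_derive_der.
  - intros H z Hz. destruct (H z Hz) as [d Hd]. exists d. now apply is_derive_der.
Qed.

Lemma hol_ctn h z : hol h -> inD z -> ctn idC h z.
Proof. intros H Hz. destruct (H z Hz) as [d Hd]. eapply der_ctn; eauto. Qed.

Lemma hol_der h z : hol h -> inD z -> der idC h z (C_derive h z).
Proof.
  intros H Hz. apply is_derive_der. apply C_derive_correct; auto.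
  now apply hol_analytic.
Qed.

Lemma C_derive_eq h z d : der idC h z d -> C_derive h z = d.
Proof. intros H. apply is_C_derive_unique. now apply is_derive_der. Qed.

Lemma Cmod_convex (x y : C) t B : 0 <= t <= 1 -> Cmod x < B -> Cmod y < B ->
  Cmod (RtoC (1 - t) * x + RtoC t * y)%C < B.
Proof.
  intros Ht Hx Hy. eapply Rle_lt_trans; [apply Cmod_triangle|].
  rewrite !Cmod_mult, !Cmod_Rpos by lra.
  destruct (Rle_dec t (1/2)); nra.
Qed.

Definition prim (h : C -> C) (z : C) : C := CInt (fun t : R => (z * h (RtoC t * z))%C) 0 1.

Lemma der_segment (z d : C) x : der RtoC (fun y => z + RtoC y * d)%C x d.
Proof.
  eapply der_eq.
  - apply der_plus; [apply der_const|]. apply der_mult; [apply (der_e RtoC)|apply der_const].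
  - cbv beta. ring.
Qed.

Lemma segment_inD z w t : inD z -> inD w -> 0 <= t <= 1 -> inD (z + RtoC t * (w - z))%C.
Proof.
  intros Hz Hw Ht. unfold inD.
  replace (z + RtoC t * (w - z))%C with (RtoC (1 - t) * z + RtoC t * w)%C
    by (rewrite RtoC_minus; ring).
  now apply Cmod_convex.
Qed.

Lemma cont_on_const c a b : cont_on (fun _ => c) a b.
Proof. intros t _. apply ctn_const. Qed.

(** Goursat on the triangle 0, z, w, viewed as the cone with apex 0 over the segment from z to w.
    The side x = 0 of the square collapses to the apex and contributes nothing. *)
Lemma prim_diff h z w : hol h -> inD z -> inD w ->
  (prim h w - prim h z)%C = CInt (fun y => h (z + RtoC y * (w - z)) * (w - z))%C 0 1.
Proof.
  intros Hh Hz Hw. set (d := (w - z)%C).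
  pose proof (Cmod_ge_0 d).
  pose proof (goursat_cone h (RtoC 0) 0 1 (fun y => z + RtoC y * d)%C (fun _ => d) (1 + Cmod d)) as G.
  cbv zeta beta in G.
  match type of G with ?A -> ?B -> ?D -> ?E -> ?F -> ?G1 -> ?G2 -> ?G3 -> ?G4 =>
    assert (K : G4) end.
  { apply G; try lra.
    - intros; apply der_segment.
    - apply cont_on_const.
    - intros y Hy. apply Rlt_le. eapply Rlt_le_trans; [apply segment_inD; auto|]. lra.
    - intros; lra.
    - intros x y Hx Hy. apply Hh.
      replace (0 + RtoC (0 + 1 * x) * (z + RtoC y * d))%C with (0 + RtoC x * ((z + RtoC y * d) - 0))%C
        by (rewrite Rplus_0_l, Rmult_1_l; ring).
      apply segment_inD; auto. unfold inD. rewrite Cmod_0; lra. apply segment_inD; auto. }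
  clear G.
  rewrite (CInt_ext (fun x => h (0 + RtoC (0 + 1 * x) * (z + 0 * d)) * (RtoC 1 * (z + 0 * d)))%C
     (fun t => z * h (RtoC t * z))%C) in K.
  2: lra.
  2:{ intros t Ht. rewrite Rplus_0_l, Rmult_1_l.
      replace (0 + RtoC t * (z + 0 * d))%C with (RtoC t * z)%C by ring. ring. }
  rewrite (CInt_ext (fun x => h (0 + RtoC (0 + 1 * x) * (z + 1 * d)) * (RtoC 1 * (z + 1 * d)))%C
     (fun t => w * h (RtoC t * w))%C) in K.
  2: lra.
  2:{ intros t Ht. rewrite Rplus_0_l, Rmult_1_l.
      replace (0 + RtoC t * (z + 1 * d))%C with (RtoC t * w)%C by (unfold d; ring). unfold d; ring. }
  rewrite (CInt_ext (fun y => h (0 + RtoC (0 + 1 * 1) * (z + RtoC y * d)) * (RtoC (0 + 1 * 1) * d))%C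
     (fun y => h (z + RtoC y * d) * d)%C) in K.
  2: lra.
  2:{ intros t Ht. rewrite Rplus_0_l, Rmult_1_l.
      replace (0 + 1 * (z + RtoC t * d))%C with (z + RtoC t * d)%C by ring. ring. }
  rewrite (CInt_ext (fun y => h (0 + RtoC (0 + 1 * 0) * (z + RtoC y * d)) * (RtoC (0 + 1 * 0) * d))%C
     (fun _ => RtoC 0)%C) in K.
  2: lra.
  2:{ intros t Ht. rewrite Rplus_0_l, Rmult_1_l. ring. }
  rewrite CInt_const in K by lra.
  unfold prim. fold d.
  match type of K with (?a + ?b - ?c - ?e)%C = _ => replace b with ((a + b - c - e) - a + c + e)%C by ring end.
  rewrite K. ring.
Qed.

Lemma prim_der h z : hol h -> inD z -> der idC (prim h) z (h z).
Proof.
  intros Hh Hz eps He. destruct (hol_ctn h z Hh Hz eps He) as [d1 [Hd1 H1]].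
  unfold idC in *. unfold inD in Hz.
  exists (Rmin d1 (1 - Cmod z)). split; [apply Rmin_glb_lt; lra|]. intros w Hw.
  pose proof (Rmin_l d1 (1 - Cmod z)). pose proof (Rmin_r d1 (1 - Cmod z)).
  assert (Hw1 : inD w). { unfold inD. pose proof (Cmod_triangle_sub w z). lra. }
  rewrite prim_diff by auto.
  assert (Cc : cont_on (fun y => h (z + RtoC y * (w - z)) * (w - z))%C 0 1).
  { apply cont_on_mult; [|apply cont_on_const]. intros y Hy. apply ctn_comp.
    eapply der_ctn; apply der_segment. apply hol_ctn; auto. apply segment_inD; auto. }
  replace (h z * (w - z))%C with (CInt (fun _ => h z * (w - z))%C 0 1)
    by (rewrite CInt_const by lra; rewrite Rminus_0_r; ring).
  rewrite <- CInt_minus; auto using cont_on_const; [|lra].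
  replace (eps * Cmod (w - z)%C) with (eps * Cmod (w - z)%C * (1 - 0)) by ring.
  apply CInt_bound; [lra| |].
  - apply cont_on_minus; auto using cont_on_const.
  - intros y Hy.
    replace (h (z + RtoC y * (w - z)) * (w - z) - h z * (w - z))%C
      with ((h (z + RtoC y * (w - z)) - h z) * (w - z))%C by ring.
    rewrite Cmod_mult. apply Rmult_le_compat_r; [apply Cmod_ge_0|]. apply Rlt_le, H1.
    replace (z + RtoC y * (w - z) - z)%C with (RtoC y * (w - z))%C by ring.
    rewrite Cmod_mult, Cmod_Rpos by lra. pose proof (Cmod_ge_0 (w - z)%C). nra.
Qed.

Lemma prim_0 h : prim h (RtoC 0) = RtoC 0.
Proof.
  unfold prim. rewrite (CInt_ext _ (fun _ => RtoC 0)); [|lra|intros; ring].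
  rewrite CInt_const by lra. ring.
Qed.

(** * The complex exponential *)

Definition cexp (z : C) : C := (exp (Re z) * cos (Im z), exp (Re z) * sin (Im z)).

Lemma cexp_plus z w : cexp (z + w)%C = (cexp z * cexp w)%C.
Proof.
  unfold cexp, Cmult, Cplus, Re, Im; simpl. rewrite exp_plus, cos_plus, sin_plus.
  f_equal; ring.
Qed.

Lemma cexp_0 : cexp (RtoC 0) = RtoC 1.
Proof. unfold cexp, RtoC, Re, Im; simpl. rewrite exp_0, cos_0, sin_0. f_equal; ring. Qed.

Lemma cexp_neq0 z : cexp z <> RtoC 0.
Proof.
  intros H. pose proof (cexp_plus z (- z)%C) as E.
  replace (z + - z)%C with (RtoC 0) in E by ring. rewrite cexp_0, H, Cmult_0_l in E.
  now apply C1_nz.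
Qed.

Lemma cexp_opp z : cexp (- z)%C = (/ cexp z)%C.
Proof.
  pose proof (cexp_plus z (- z)%C) as E.
  replace (z + - z)%C with (RtoC 0) in E by ring. rewrite cexp_0 in E.
  replace (cexp (- z)) with (/ cexp z * (cexp z * cexp (- z)))%C
    by (field; apply cexp_neq0). rewrite <- E. ring.
Qed.

Lemma Cmod_cexp z : Cmod (cexp z) = exp (Re z).
Proof.
  pose proof (exp_pos (Re z)). unfold cexp, Cmod; simpl.
  rewrite !Rmult_1_r.
  replace (_ + _) with (exp (Re z) * exp (Re z)).
  - apply sqrt_square. lra.
  - pose proof (sin2_cos2 (Im z)) as S. unfold Rsqr in S.
    replace (exp (Re z) * exp (Re z)) with (exp (Re z) * exp (Re z) * 1) by ring.
    rewrite <- S. ring.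
Qed.

Lemma der_RtoC_real (u : R -> R) x l : derivable_pt_lim u x l ->
  der RtoC (fun y => RtoC (u y)) x (RtoC l).
Proof.
  intros H eps He. destruct (H eps He) as [[del Hd] H1]. exists del. split; auto.
  intros y. rewrite <- !RtoC_minus, <- RtoC_mult, <- RtoC_minus, !Cmod_R. intros Hy.
  destruct (Req_dec y x) as [->|N].
  - rewrite !Rminus_diag, Rmult_0_r, Rminus_0_r, Rabs_R0. lra.
  - assert (N' : y - x <> 0) by lra.
    specialize (H1 (y - x) N' Hy). replace (x + (y - x)) with y in H1 by ring.
    replace (u y - u x - l * (y - x)) with (((u y - u x) / (y - x) - l) * (y - x)) by (field; auto).
    rewrite Rabs_mult. apply Rmult_le_compat_r; [apply Rabs_pos|lra].
Qed.

Lemma der_cexp_0 : der idC cexp (RtoC 0) (RtoC 1).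
Proof.
  intros eps He. unfold idC.
  pose proof (der_RtoC_real exp 0 _ (derivable_pt_lim_exp 0)) as D1. rewrite exp_0 in D1.
  assert (D2 : der RtoC (fun y => RtoC (cos y) + Ci * RtoC (sin y))%C 0 (- 0 + Ci * 1)%C).
  { pose proof (der_RtoC_real cos 0 _ (derivable_pt_lim_cos 0)) as E1.
    pose proof (der_RtoC_real sin 0 _ (derivable_pt_lim_sin 0)) as E2.
    rewrite sin_0 in E1. rewrite cos_0 in E2. rewrite RtoC_opp in E1.
    apply der_plus; auto. now apply der_scal. }
  destruct (D1 (Rmin 1 (eps / 6))) as [d1 [Hd1 H1]]; [apply Rmin_glb_lt; lra|].
  destruct (D2 (eps / 6)) as [d2 [Hd2 H2]]; [lra|].
  destruct (der_ctn _ _ _ _ D1 (Rmin 1 (eps / 3))) as [d3 [Hd3 H3]]; [apply Rmin_glb_lt; lra|].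
  exists (Rmin d1 (Rmin d2 d3)). split; [repeat apply Rmin_glb_lt; auto|].
  intros w Hw.
  pose proof (Rmin_l d1 (Rmin d2 d3)). pose proof (Rmin_r d1 (Rmin d2 d3)).
  pose proof (Rmin_l d2 d3). pose proof (Rmin_r d2 d3).
  assert (E0 : forall w : C, (w - 0)%C = w) by (intros; ring).
  rewrite E0 in *. clear E0.
  destruct w as [x y].
  assert (X : Cmod (RtoC x - RtoC 0)%C <= Cmod (x, y)).
  { rewrite <- RtoC_minus, Cmod_R, Rminus_0_r. eapply Rle_trans; [apply Rmax_l|apply (Rmax_Cmod (x, y))]. }
  assert (Y : Cmod (RtoC y - RtoC 0)%C <= Cmod (x, y)).
  { rewrite <- RtoC_minus, Cmod_R, Rminus_0_r. eapply Rle_trans; [apply Rmax_r|apply (Rmax_Cmod (x, y))]. }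
  specialize (H1 x ltac:(lra)). specialize (H2 y ltac:(lra)). specialize (H3 x ltac:(lra)).
  set (m := Cmod (x, y)) in *.
  rewrite exp_0 in H1, H3. rewrite cos_0, sin_0 in H2.
  pose proof (Rmin_l 1 (eps / 6)). pose proof (Rmin_r 1 (eps / 6)).
  pose proof (Rmin_l 1 (eps / 3)). pose proof (Rmin_r 1 (eps / 3)).
  rewrite cexp_0.
  (* The remainder is split as (e^x - 1 - x) + e^x (e^(iy) - 1 - iy) + (e^x - 1) iy; with |e^x| <= 2
     the three terms cost eps/6, eps/3 and eps/3. *)
  replace (cexp (x, y) - 1 - 1 * (x, y))%C with
    ((RtoC (exp x) - 1 - 1 * (RtoC x - 0)) +
     (RtoC (exp x) * (RtoC (cos y) + Ci * RtoC (sin y) - (1 + Ci * 0) - (- 0 + Ci * 1) * (RtoC y - 0)) +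
      (RtoC (exp x) - 1) * (Ci * (RtoC y - 0))))%C.
  2:{ unfold cexp, Ci, RtoC, Cmult, Cplus, Cminus, Copp, Re, Im; simpl. apply injective_projections; simpl; ring. }
  eapply Rle_trans; [apply Cmod_triangle|].
  eapply Rle_trans; [apply Rplus_le_compat_l, Cmod_triangle|].
  rewrite !Cmod_mult, Cmod_Ci.
  assert (Ex : Cmod (RtoC (exp x)) <= 2).
  { pose proof (Cmod_triangle_sub (RtoC (exp x)) 1) as HE. rewrite Cmod_1 in HE. lra. }
  pose proof (Cmod_ge_0 (RtoC (exp x))). pose proof (Cmod_ge_0 (RtoC y - RtoC 0)%C).
  pose proof (Cmod_ge_0 (RtoC x - RtoC 0)%C).
  pose proof (Cmod_ge_0 (RtoC (exp x) - 1)%C).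
  set (A := Cmod (RtoC (cos y) + Ci * RtoC (sin y) - (1 + Ci * 0) - (- 0 + Ci * 1) * (RtoC y - 0))%C) in *.
  assert (0 <= A) by apply Cmod_ge_0.
  assert (Cmod (RtoC (exp x)) * A <= 2 * (eps / 6 * m)).
  { apply Rmult_le_compat; auto. eapply Rle_trans; [apply H2|]. apply Rmult_le_compat_l; lra. }
  assert (Cmod (RtoC (exp x) - 1)%C * (1 * Cmod (RtoC y - RtoC 0)%C) <= eps / 3 * m).
  { rewrite Rmult_1_l. apply Rmult_le_compat; auto. lra. }
  assert (Cmod (RtoC (exp x) - 1 - 1 * (RtoC x - 0))%C <= eps / 6 * m).
  { eapply Rle_trans; [apply H1|]. apply Rmult_le_compat; auto. apply Rmin_glb; lra. }
  assert (0 <= m) by apply Cmod_ge_0.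
  assert (0 <= eps * m) by (apply Rmult_le_pos; lra). lra.
Qed.

Lemma der_cexp z : der idC cexp z (cexp z).
Proof.
  apply (der_ext _ (fun w => cexp z * cexp (w - z))%C _ _ _ 1); [lra| |].
  { intros w _. rewrite <- cexp_plus. f_equal. ring. }
  eapply der_eq.
  - apply der_scal. apply (der_comp idC cexp (fun w => w - z)%C).
    + apply der_minus; [apply der_id|apply der_const].
    + replace (z - z)%C with (RtoC 0) by ring. apply der_cexp_0.
  - ring.
Qed.

Lemma der_cexp_comp {T : Type} (e f : T -> C) x d : der e f x d ->
  der e (fun y => cexp (f y)) x (cexp (f x) * d)%C.
Proof. intros H. apply der_comp; auto. apply der_cexp. Qed.

(** * Integrals over circles and Cauchy's formula *)

Definition tpi : C := (0, 2 * PI).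
Definition circ (r : R) (y : R) : C := (RtoC r * cexp (RtoC y * tpi))%C.

Lemma tpi_neq0 : tpi <> RtoC 0.
Proof. intros E. apply (f_equal Im) in E. unfold tpi, Im, RtoC in E; simpl in E. pose proof PI_RGT_0. lra. Qed.

Lemma Cmod_circ r y : 0 <= r -> Cmod (circ r y) = r.
Proof.
  intros Hr. unfold circ. rewrite Cmod_mult, Cmod_cexp, Cmod_Rpos by auto.
  unfold tpi, Re, RtoC, Cmult; simpl. replace (y * 0 - 0 * (2 * PI)) with 0 by ring.
  rewrite exp_0. ring.
Qed.

Lemma cexp_tpi : cexp tpi = RtoC 1.
Proof.
  unfold cexp, tpi, Re, Im, RtoC; simpl. rewrite exp_0, cos_2PI, sin_2PI. f_equal; ring.
Qed.

Lemma circ_periodic r : circ r 1 = circ r 0.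
Proof.
  unfold circ. rewrite Cmult_1_l, Cmult_0_l, cexp_tpi, cexp_0. reflexivity.
Qed.

Lemma der_circ r y : der RtoC (circ r) y (tpi * circ r y)%C.
Proof.
  unfold circ. eapply der_eq.
  - apply der_scal. apply der_cexp_comp. apply der_mult; [apply (der_e RtoC)|apply der_const].
  - cbv beta. ring.
Qed.

Lemma ctn_circ r y : ctn RtoC (circ r) y.
Proof. eapply der_ctn; apply der_circ. Qed.

Lemma circ_minus_ge r z y : 0 <= r -> r - Cmod z <= Cmod (circ r y - z)%C.
Proof.
  intros Hr. pose proof (Cmod_triangle_sub (circ r y) z). rewrite Cmod_circ in H by auto. lra.
Qed.

Lemma circ_minus_neq0 r z y : Cmod z < r -> (circ r y - z)%C <> RtoC 0.
Proof.
  intros H. pose proof (Cmod_ge_0 z). apply Cmod_gt_0.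
  pose proof (circ_minus_ge r z y). lra.
Qed.

Lemma der_Cpow {T : Type} (e u : T -> C) x c n : der e u x (c * u x)%C ->
  der e (fun y => u y ^ n)%C x (INR n * c * u x ^ n)%C.
Proof.
  intros H. induction n as [|n IH].
  - simpl. eapply der_eq; [apply der_const|]. ring.
  - apply (der_ext _ (fun y => u y * u y ^ n)%C _ _ _ 1); [lra|intros; now rewrite Cpow_S|].
    eapply der_eq; [apply der_mult; [apply H|apply IH]|].
    cbv beta. rewrite S_INR, RtoC_plus, Cpow_S. ring.
Qed.

Lemma small_power_zero (A K q : R) : 0 <= q < 1 -> (forall n, A <= K * q ^ n) -> A <= 0.
Proof.
  intros Hq H. apply le_epsilon. intros eps He.
  assert (HK : 0 < Rabs K + 1) by (pose proof (Rabs_pos K); lra).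
  destruct (pow_lt_1_zero q) with (y := eps / (Rabs K + 1)) as [N HN].
  - rewrite Rabs_pos_eq; lra.
  - now apply Rdiv_lt_0_compat.
  - specialize (HN N (le_n N)). specialize (H N).
    assert (0 <= q ^ N) by (apply pow_le; lra). rewrite Rabs_pos_eq in HN by auto.
    assert (K * q ^ N <= Rabs K * q ^ N) by (apply Rmult_le_compat_r; [auto|apply Rle_abs]).
    assert ((Rabs K + 1) * q ^ N <= eps).
    { replace eps with ((Rabs K + 1) * (eps / (Rabs K + 1))) by (field; lra).
      apply Rmult_le_compat_l; lra. }
    lra.
Qed.

(** Parametrising the circle by one turn over [0, 1] turns dw/(2 pi i (w - z)) into this kernel.
    With u = z/circ the kernel is k = 1/(1 - u), and u^n k = u^n + u^(n+1) k. The integrals of u^n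
    vanish for n >= 1 by periodicity, so the integral of u k equals that of u^(n+1) k for all n and
    is therefore 0. *)
Lemma circle_kernel_mean r z : Cmod z < r ->
  CInt (fun y => circ r y / (circ r y - z))%C 0 1 = RtoC 1.
Proof.
  intros Hz. pose proof (Cmod_ge_0 z).
  assert (Nc : forall y, circ r y <> RtoC 0).
  { intros y. apply Cmod_gt_0. rewrite Cmod_circ; lra. }
  assert (Nz : forall y, (circ r y - z)%C <> RtoC 0) by (intros; now apply circ_minus_neq0).
  set (u := fun y => (z / circ r y)%C).
  set (k := fun y => (circ r y / (circ r y - z))%C).
  assert (Du : forall y, der RtoC u y (- tpi * u y)%C).
  { intros y. unfold u. eapply der_eq; [apply der_div; [apply Nc|apply der_const|apply der_circ]|].
    cbv beta; field. apply Nc. }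
  assert (Ck : cont_on k 0 1).
  { intros y _. apply ctn_div; [apply Nz|apply ctn_circ|].
    apply ctn_minus; [apply ctn_circ|apply ctn_const]. }
  assert (Cu : forall n, cont_on (fun y => u y ^ n)%C 0 1).
  { intros n y _. eapply der_ctn. apply der_Cpow. apply Du. }
  set (J := fun n => CInt (fun y => u y ^ n * k y)%C 0 1).
  assert (St : forall n, J n = (CInt (fun y => u y ^ n)%C 0 1 + J (S n))%C).
  { intros n. unfold J. rewrite <- CInt_plus; auto; [|lra|now apply cont_on_mult].
    apply CInt_ext; [lra|]. intros y _. rewrite Cpow_S. unfold u, k. field. auto. }
  assert (Z : forall n, CInt (fun y => u y ^ (S n))%C 0 1 = RtoC 0).
  { intros n. assert (NI : RtoC (INR (S n)) <> RtoC 0).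
    { intros E. apply (not_0_INR (S n)); [discriminate|]. now apply RtoC_inj. }
    rewrite (CInt_FTC (fun y => / (INR (S n) * - tpi) * u y ^ (S n))%C); auto; [|lra| ].
    - unfold u. rewrite circ_periodic. ring.
    - intros y _. eapply der_eq; [apply der_scal, der_Cpow, Du|].
      field. split; auto. apply tpi_neq0. }
  assert (J1 : forall n, J 1%nat = J (S n)).
  { induction n; auto. rewrite IHn, (St (S n)), Z. ring. }
  assert (J10 : J 1%nat = RtoC 0).
  { apply Cmod_eq_0. apply Rle_antisym; [|apply Cmod_ge_0].
    apply (small_power_zero _ (r / (r - Cmod z)) (Cmod z / r)).
    - assert (0 < / r) by (apply Rinv_0_lt_compat; lra). split; [apply Rmult_le_pos; lra|].
      apply Rmult_lt_reg_r with r; [lra|]. unfold Rdiv. rewrite Rmult_assoc, Rinv_l; lra.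
    - intros n.
      assert (Q : 0 <= Cmod z / r < 1).
      { assert (0 < / r) by (apply Rinv_0_lt_compat; lra). split; [apply Rmult_le_pos; lra|].
        apply Rmult_lt_reg_r with r; [lra|]. unfold Rdiv. rewrite Rmult_assoc, Rinv_l; lra. }
      rewrite (J1 n).
      replace (r / (r - Cmod z) * (Cmod z / r) ^ n) with (r / (r - Cmod z) * (Cmod z / r) ^ n * (1 - 0)) by ring.
      apply CInt_bound; [lra|apply cont_on_mult; auto|].
      intros y _. rewrite Cmod_mult, Cmod_pow, Rmult_comm. unfold u, k.
      rewrite !Cmod_div, Cmod_circ by (auto; lra).
      apply Rmult_le_compat.
      + apply Rmult_le_pos; [lra|]. apply Rlt_le, Rinv_0_lt_compat. apply Cmod_gt_0; auto.
      + apply pow_le; lra.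
      + apply Rmult_le_compat_l; [lra|]. apply Rinv_le_contravar; [lra|]. apply circ_minus_ge; lra.
      + simpl. assert (0 <= (Cmod z / r) ^ n) by (apply pow_le; lra). nra. }
  change (CInt k 0 1 = RtoC 1).
  replace (CInt k 0 1) with (J 0%nat).
  2:{ apply CInt_ext; [lra|]. intros y _. simpl. ring. }
  rewrite St, J10.
  rewrite (CInt_ext _ (fun _ => RtoC 1)); [|lra|reflexivity].
  rewrite CInt_const by lra. rewrite Rminus_0_r. ring.
Qed.

Lemma circ_inD r y : 0 <= r < 1 -> inD (circ r y).
Proof. intros. unfold inD. rewrite Cmod_circ; lra. Qed.

(** Goursat for h(w)/(w - z) on the ring between the circle and its contraction by s towards z; s >
    0 keeps the pole outside. The two radial sides coincide because the circle closes up, so they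
    cancel. *)
Lemma cauchy_shrink h r z s : hol h -> Cmod z < r < 1 -> 0 < s <= 1 ->
  CInt (fun y => h (circ r y) * (circ r y / (circ r y - z)))%C 0 1 =
  CInt (fun y => h (z + RtoC s * (circ r y - z)) * (circ r y / (circ r y - z)))%C 0 1.
Proof.
  intros Hh Hr Hs. pose proof (Cmod_ge_0 z) as Pz. pose proof PI_RGT_0 as Ppi.
  assert (Nz : forall y, (circ r y - z)%C <> RtoC 0) by (intros; now apply circ_minus_neq0).
  assert (Ty : Cmod tpi = 2 * PI).
  { unfold tpi, Cmod; simpl. rewrite Rmult_0_l, Rplus_0_l, Rmult_1_r. apply sqrt_square. lra. }
  pose proof (goursat_cone (fun w => h w / (w - z))%C z s (1 - s) (fun y => circ r y - z)%C
    (fun y => tpi * circ r y)%C (2 + 2 * PI)) as G.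
  cbv zeta beta in G.
  match type of G with ?A -> ?B -> ?D -> ?E -> ?F -> ?G1 -> ?G2 -> ?G3 -> ?G4 =>
    assert (K : G4) end.
  { apply G; try lra.
    - intros. eapply der_eq; [apply der_minus; [apply der_circ|apply der_const]|]. ring.
    - intros y _. apply ctn_mult; [apply ctn_const|apply ctn_circ].
    - intros y _. eapply Rle_trans; [apply Cmod_minus_le|]. rewrite Cmod_circ by lra. lra.
    - intros y _. rewrite Cmod_mult, Cmod_circ, Ty by lra. nra.
    - intros x y Hx Hy. set (c := s + (1 - s) * x). assert (0 < c <= 1) by (unfold c; nra).
      set (p := (z + RtoC c * (circ r y - z))%C).
      assert (Hp : inD p). { apply segment_inD; try lra. unfold inD; lra. apply circ_inD; lra. }
      assert (Np : (p - z)%C <> RtoC 0).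
      { unfold p. replace (z + RtoC c * (circ r y - z) - z)%C with (RtoC c * (circ r y - z))%C by ring.
        apply Cmult_neq_0; auto. intros E. apply RtoC_inj in E. lra. }
      destruct (Hh p Hp) as [d Hd].
      eexists. apply der_div; [exact Np|exact Hd|].
      apply der_minus; [apply der_id|apply der_const]. }
  clear G. rewrite !circ_periodic in K.
  match type of K with (?a + ?b - ?c - ?e)%C = _ =>
    assert (E : b = e) by (transitivity (e + (a + b - c - e))%C; [ring|rewrite K; ring]) end.
  clear K.
  assert (Nt := tpi_neq0).
  assert (Cker : cont_on (fun y => circ r y / (circ r y - z))%C 0 1).
  { intros y _. apply ctn_div; [apply Nz|apply ctn_circ|].
    apply ctn_minus; [apply ctn_circ|apply ctn_const]. }
  rewrite (CInt_ext _ (fun y => tpi * (h (circ r y) * (circ r y / (circ r y - z))))%C) in E.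
  2: lra.
  2:{ intros y _. replace (s + (1 - s) * 1) with 1 by ring.
      replace (z + 1 * (circ r y - z))%C with (circ r y) by ring. field. auto. }
  rewrite (CInt_ext (fun y => h (z + RtoC (s + (1 - s) * 0) * (circ r y - z)) /
        (z + RtoC (s + (1 - s) * 0) * (circ r y - z) - z) * (RtoC (s + (1 - s) * 0) * (tpi * circ r y)))%C
     (fun y => tpi * (h (z + RtoC s * (circ r y - z)) * (circ r y / (circ r y - z))))%C) in E.
  2: lra.
  2:{ intros y _. replace (s + (1 - s) * 0) with s by ring.
      assert (RtoC s <> RtoC 0) by (intros Q; apply RtoC_inj in Q; lra).
      field. split; auto.
      replace (z + RtoC s * (circ r y - z) - z)%C with (RtoC s * (circ r y - z))%C by ring.
      now apply Cmult_neq_0. }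
  rewrite !CInt_scal in E; try lra.
  - match goal with |- ?a = ?b => transitivity (/ tpi * (tpi * a))%C; [field; auto|];
      rewrite E; field; auto end.
  - apply cont_on_mult; auto. intros y _. apply ctn_comp.
    + apply ctn_plus; [apply ctn_const|]. apply ctn_mult; [apply ctn_const|].
      apply ctn_minus; [apply ctn_circ|apply ctn_const].
    + apply hol_ctn; auto. apply segment_inD; try lra. unfold inD; lra. apply circ_inD; lra.
  - apply cont_on_mult; auto. intros y _. apply ctn_comp; [apply ctn_circ|].
    apply hol_ctn; auto. apply circ_inD; lra.
Qed.

Theorem cauchy_formula h r z : hol h -> Cmod z < r < 1 ->
  CInt (fun y => h (circ r y) * (circ r y / (circ r y - z)))%C 0 1 = h z.
Proof.
  intros Hh Hr. pose proof (Cmod_ge_0 z) as Pz.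
  assert (Nz : forall y, (circ r y - z)%C <> RtoC 0) by (intros; now apply circ_minus_neq0).
  apply Ceq_minus. apply Cmod_eq_0. apply Rle_antisym; [|apply Cmod_ge_0].
  apply le_epsilon. intros eps He.
  (* The kernel has modulus at most 1/(r - |z|), and this factor compensates it. *)
  set (eta := eps * (r - Cmod z)). assert (He' : 0 < eta) by (apply Rmult_lt_0_compat; lra).
  destruct (hol_ctn h z Hh) with (eps := eta) as [d [Hd H1]]; [unfold inD; lra|auto|].
  unfold idC in H1.
  (* Points of the circle lie at distance less than 2 from z, so the contracted curve stays within
     d/2 of z. *)
  set (s := Rmin 1 (d / 4)). assert (Hs : 0 < s <= 1).
  { split; [apply Rmin_glb_lt; lra|apply Rmin_l]. }
  assert (Hs' : s <= d / 4) by apply Rmin_r.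
  rewrite (cauchy_shrink h r z s) by auto.
  assert (Cker : cont_on (fun y => circ r y / (circ r y - z))%C 0 1).
  { intros y _. apply ctn_div; [apply Nz|apply ctn_circ|].
    apply ctn_minus; [apply ctn_circ|apply ctn_const]. }
  assert (Ch : cont_on (fun y => h (z + RtoC s * (circ r y - z)))%C 0 1).
  { intros y _. apply ctn_comp.
    + apply ctn_plus; [apply ctn_const|]. apply ctn_mult; [apply ctn_const|].
      apply ctn_minus; [apply ctn_circ|apply ctn_const].
    + apply hol_ctn; auto. apply segment_inD; try lra. unfold inD; lra. apply circ_inD; lra. }
  replace (h z) with (h z * CInt (fun y => circ r y / (circ r y - z)) 0 1)%C
    by (rewrite circle_kernel_mean by lra; ring).
  rewrite <- CInt_scal by (auto; lra).
  rewrite <- CInt_minus; [|lra|now apply cont_on_mult|now apply cont_on_scal].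
  rewrite Rplus_0_l. replace eps with (eps * (1 - 0)) by ring.
  apply CInt_bound; [lra| |].
  - apply cont_on_minus; [now apply cont_on_mult|now apply cont_on_scal].
  - intros y _.
    replace (h (z + RtoC s * (circ r y - z)) * (circ r y / (circ r y - z)) - h z * (circ r y / (circ r y - z)))%C
      with ((h (z + RtoC s * (circ r y - z)) - h z) * (circ r y / (circ r y - z)))%C by ring.
    rewrite Cmod_mult, Cmod_div, Cmod_circ by (auto; lra).
    assert (B : Cmod (h (z + RtoC s * (circ r y - z)) - h z)%C < eta).
    { apply H1. replace (z + RtoC s * (circ r y - z) - z)%C with (RtoC s * (circ r y - z))%C by ring.
      rewrite Cmod_mult, Cmod_Rpos by lra.
      pose proof (Cmod_minus_le (circ r y) z). rewrite Cmod_circ in H by lra.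
      pose proof (Cmod_ge_0 (circ r y - z)%C). nra. }
    pose proof (circ_minus_ge r z y ltac:(lra)).
    pose proof (Cmod_ge_0 (h (z + RtoC s * (circ r y - z)) - h z)%C).
    replace eps with (eta * / (r - Cmod z)) by (unfold eta; field; lra).
    apply Rmult_le_compat; try lra.
    + apply Rmult_le_pos; [lra|]. apply Rlt_le, Rinv_0_lt_compat. lra.
    + apply Rle_trans with (1 * / Cmod (circ r y - z)%C).
      * apply Rmult_le_compat_r; [|lra]. apply Rlt_le, Rinv_0_lt_compat. lra.
      * rewrite Rmult_1_l. apply Rinv_le_contravar; lra.
Qed.

(** * Consequences of Cauchy's formula *)

(** Differentiation under the integral sign. A quadratic remainder uniform in the integration
    variable can be integrated directly, without a limit theorem, and for Cauchy kernels it is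
    explicit. *)
Lemma CInt_param_der (K : C -> R -> C) (K1 : R -> C) z B del : 0 < del -> 0 <= B ->
  (forall w, Cmod (w - z)%C < del -> cont_on (K w) 0 1) -> cont_on K1 0 1 ->
  (forall w y, Cmod (w - z)%C < del -> 0 <= y <= 1 ->
     Cmod (K w y - K z y - (w - z) * K1 y)%C <= B * (Cmod (w - z)%C * Cmod (w - z)%C)) ->
  der idC (fun w => CInt (K w) 0 1) z (CInt K1 0 1).
Proof.
  intros Hd HB HK HK1 HE eps He. unfold idC.
  destruct (eps_ratio eps B He HB) as [eta [E1 [E2 E3]]].
  exists (Rmin del eta). split; [now apply Rmin_glb_lt|]. intros w Hw.
  pose proof (Rmin_l del eta). pose proof (Rmin_r del eta).
  assert (Kz : cont_on (K z) 0 1).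
  { apply HK. replace (z - z)%C with (RtoC 0) by ring. now rewrite Cmod_0. }
  assert (Kw : cont_on (K w) 0 1) by (apply HK; lra).
  rewrite (Cmult_comm (CInt K1 0 1)).
  rewrite <- CInt_scal, <- CInt_minus, <- CInt_minus; auto; try lra.
  2: now apply cont_on_minus.
  2: now apply cont_on_scal.
  replace (eps * Cmod (w - z)%C) with (eps * Cmod (w - z)%C * (1 - 0)) by ring.
  apply CInt_bound; [lra| |].
  - apply cont_on_minus; [now apply cont_on_minus|now apply cont_on_scal].
  - intros y Hy. eapply Rle_trans; [apply HE; auto; lra|].
    pose proof (Cmod_ge_0 (w - z)%C).
    rewrite <- Rmult_assoc. apply Rmult_le_compat_r; auto. nra.
Qed.

Lemma cont_on_bounded f : cont_on f 0 1 -> exists B, 0 < B /\ forall y, 0 <= y <= 1 -> Cmod (f y) <= B.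
Proof.
  intros H.
  destruct (@bounded_continuity R_AbsRing C_R_NormedModule f 0 1) as [M HM].
  - intros x Hx. apply continuous_ctn. apply H; auto.
  - exists (Rabs M + 1). split; [pose proof (Rabs_pos M); lra|].
    intros y Hy. specialize (HM y Hy). rewrite Cmod_prod_norm in HM.
    pose proof (Rle_abs M). lra.
Qed.

Lemma Cmod_pos_neq0 (z : C) : 0 < Cmod z -> z <> RtoC 0.
Proof. apply Cmod_gt_0. Qed.

Section CauchyKernel.
Variables (f : R -> C) (r : R) (z : C).
Hypothesis Hf : cont_on f 0 1.
Hypothesis Hz : Cmod z < r.
Hypothesis Hr : r < 1.

Lemma kernel_near w y : Cmod (w - z)%C < (r - Cmod z) / 2 ->
  (r - Cmod z) / 2 <= Cmod (circ r y - w)%C /\ (circ r y - w)%C <> RtoC 0.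
Proof.
  intros Hw. pose proof (Cmod_ge_0 z).
  pose proof (circ_minus_ge r w y ltac:(lra)). pose proof (Cmod_triangle_sub w z).
  split; [lra|]. apply Cmod_pos_neq0. lra.
Qed.

Lemma kernel_cont w : Cmod (w - z)%C < (r - Cmod z) / 2 ->
  cont_on (fun y => f y / (circ r y - w))%C 0 1.
Proof.
  intros Hw y Hy. apply ctn_div; [now apply kernel_near|now apply Hf|].
  apply ctn_minus; [apply ctn_circ|apply ctn_const].
Qed.

Lemma kernel_cont2 w : Cmod (w - z)%C < (r - Cmod z) / 2 ->
  cont_on (fun y => f y / ((circ r y - w) * (circ r y - w)))%C 0 1.
Proof.
  intros Hw y Hy. assert (ctn RtoC (fun y => circ r y - w)%C y)
    by (apply ctn_minus; [apply ctn_circ|apply ctn_const]).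
  apply ctn_div; [|now apply Hf|now apply ctn_mult].
  apply Cmult_neq_0; now apply kernel_near.
Qed.

Lemma kernel_cont3 w : Cmod (w - z)%C < (r - Cmod z) / 2 ->
  cont_on (fun y => 2 * f y / ((circ r y - w) * (circ r y - w) * (circ r y - w)))%C 0 1.
Proof.
  intros Hw y Hy. assert (ctn RtoC (fun y => circ r y - w)%C y)
    by (apply ctn_minus; [apply ctn_circ|apply ctn_const]).
  apply ctn_div; [| |repeat apply ctn_mult; auto].
  - repeat apply Cmult_neq_0; now apply kernel_near.
  - apply ctn_mult; [apply ctn_const|now apply Hf].
Qed.

Lemma kernel_self : Cmod (z - z)%C < (r - Cmod z) / 2.
Proof. replace (z - z)%C with (RtoC 0) by ring. rewrite Cmod_0. lra. Qed.

Lemma kernel_der1 : der idC (fun w => CInt (fun y => f y / (circ r y - w)) 0 1)%C z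
  (CInt (fun y => f y / ((circ r y - z) * (circ r y - z))) 0 1)%C.
Proof.
  destruct (cont_on_bounded f Hf) as [B [HB Bf]]. pose proof (Cmod_ge_0 z).
  set (m := (r - Cmod z) / 2). assert (Hm : 0 < m) by (unfold m; lra).
  assert (HQ : 0 < B / (m * m * m)).
  { apply Rdiv_lt_0_compat; auto. repeat (apply Rmult_lt_0_compat; [|lra]); lra. }
  apply (CInt_param_der (fun w y => f y / (circ r y - w))%C _ z (B / (m * m * m)) m Hm).
  - lra.
  - apply kernel_cont.
  - apply kernel_cont2, kernel_self.
  - intros w y Hw Hy.
    destruct (kernel_near w y Hw) as [A1 A2]. destruct (kernel_near z y kernel_self) as [A3 A4].
    fold m in A1, A3.
    replace (f y / (circ r y - w) - f y / (circ r y - z) - (w - z) * (f y / ((circ r y - z) * (circ r y - z))))%C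
      with (f y * / ((circ r y - w) * (circ r y - z) * (circ r y - z)) * ((w - z) * (w - z)))%C by (field; auto).
    rewrite !Cmod_mult, Cmod_inv, !Cmod_mult by (repeat apply Cmult_neq_0; auto).
    apply Rmult_le_compat_r; [apply Rmult_le_pos; apply Cmod_ge_0|].
    apply Rmult_le_compat; auto using Cmod_ge_0.
    + apply Rlt_le, Rinv_0_lt_compat. repeat (apply Rmult_lt_0_compat; [|lra]); lra.
    + apply Rinv_le_contravar; [repeat (apply Rmult_lt_0_compat; [|lra]); lra|].
      apply Rmult_le_compat; try lra; [nra|]. apply Rmult_le_compat; lra.
Qed.

Lemma kernel_der2 : der idC (fun w => CInt (fun y => f y / ((circ r y - w) * (circ r y - w))) 0 1)%C z
  (CInt (fun y => 2 * f y / ((circ r y - z) * (circ r y - z) * (circ r y - z))) 0 1)%C.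
Proof.
  destruct (cont_on_bounded f Hf) as [B [HB Bf]]. pose proof (Cmod_ge_0 z).
  set (m := (r - Cmod z) / 2). assert (Hm : 0 < m) by (unfold m; lra).
  assert (P5 : 0 < m * m * m * m * m) by (repeat (apply Rmult_lt_0_compat; [|lra]); lra).
  (* The 8 bounds the numerator 3 (circ - z) - 2 (w - z) of the remainder, as |circ - z| < 2 and |w
     - z| < 1; the fifth power of m bounds its denominator from below. *)
  assert (HQ : 0 < B * 8 / (m * m * m * m * m)).
  { apply Rdiv_lt_0_compat; auto. lra. }
  apply (CInt_param_der (fun w y => f y / ((circ r y - w) * (circ r y - w)))%C _ z
    (B * 8 / (m * m * m * m * m)) m Hm).
  - lra.
  - apply kernel_cont2.
  - apply kernel_cont3, kernel_self.
  - intros w y Hw Hy.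
    destruct (kernel_near w y Hw) as [A1 A2]. destruct (kernel_near z y kernel_self) as [A3 A4].
    fold m in A1, A3.
    replace (f y / ((circ r y - w) * (circ r y - w)) - f y / ((circ r y - z) * (circ r y - z)) -
       (w - z) * (2 * f y / ((circ r y - z) * (circ r y - z) * (circ r y - z))))%C
      with (f y * (3 * (circ r y - z) - 2 * (w - z)) * / ((circ r y - w) * (circ r y - w) * (circ r y - z) *
       (circ r y - z) * (circ r y - z)) * ((w - z) * (w - z)))%C by (field; auto).
    rewrite !Cmod_mult, Cmod_inv, !Cmod_mult by (repeat apply Cmult_neq_0; auto).
    apply Rmult_le_compat_r; [apply Rmult_le_pos; apply Cmod_ge_0|].
    apply Rmult_le_compat.
    + apply Rmult_le_pos; apply Cmod_ge_0.
    + apply Rlt_le, Rinv_0_lt_compat. repeat (apply Rmult_lt_0_compat; [|lra]); lra.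
    + apply Rmult_le_compat; auto using Cmod_ge_0.
      eapply Rle_trans; [apply Cmod_minus_le|]. rewrite !Cmod_mult, !Cmod_Rpos by lra.
      pose proof (Cmod_minus_le (circ r y) z) as Q. rewrite Cmod_circ in Q by lra. unfold m in Hw. lra.
    + apply Rinv_le_contravar; auto.
      repeat (apply Rmult_le_compat; [..|lra]); try lra; repeat (apply Rmult_le_pos; [|lra]); lra.
Qed.
End CauchyKernel.

Lemma hol_circ_cont h r : hol h -> 0 <= r < 1 -> cont_on (fun y => h (circ r y)) 0 1.
Proof.
  intros Hh Hr y _. apply ctn_comp; [apply ctn_circ|]. apply hol_ctn; auto. now apply circ_inD.
Qed.

Lemma cauchy_formula' h r z : hol h -> Cmod z < r < 1 ->
  CInt (fun y => (h (circ r y) * circ r y) / (circ r y - z))%C 0 1 = h z.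
Proof.
  intros Hh Hr. rewrite <- (cauchy_formula h r z Hh Hr). apply CInt_ext; [lra|].
  intros y _. field. apply circ_minus_neq0; lra.
Qed.

(** Near z the derivative is itself a Cauchy integral, with squared kernel, and can be
    differentiated again. In particular the derivative is continuous, which [hol] does not
    assume. *)
Theorem hol_C_derive h : hol h -> hol (C_derive h).
Proof.
  intros Hh z Hz. unfold inD in Hz. pose proof (Cmod_ge_0 z).
  set (r := (1 + Cmod z) / 2). assert (Hr : Cmod z < r < 1) by (unfold r; lra).
  assert (Cf : cont_on (fun y => h (circ r y) * circ r y)%C 0 1).
  { apply cont_on_mult; [apply hol_circ_cont; auto; lra|]. intros y _; apply ctn_circ. }
  assert (E : forall w, Cmod w < r -> C_derive h w =
    CInt (fun y => (h (circ r y) * circ r y) / ((circ r y - w) * (circ r y - w)))%C 0 1).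
  { intros w Hw. apply C_derive_eq.
    eapply (der_ext _ (fun w => CInt (fun y => (h (circ r y) * circ r y) / (circ r y - w))%C 0 1) _ _ _ (r - Cmod w)); [lra| |].
    - intros v Hv. unfold idC in Hv. apply cauchy_formula'; auto.
      pose proof (Cmod_triangle_sub v w). lra.
    - apply kernel_der1; auto; lra. }
  eexists. eapply (der_ext _ (fun w => CInt (fun y => (h (circ r y) * circ r y) / ((circ r y - w) * (circ r y - w)))%C 0 1) _ _ _ (r - Cmod z)); [lra| |].
  - intros v Hv. unfold idC in Hv. rewrite E; auto. pose proof (Cmod_triangle_sub v z). lra.
  - apply kernel_der2; auto; lra.
Qed.

(** [quot0] with an arbitrary value d at 0, so that the same result also covers the quotient in
    Schwarz's lemma. *)
Definition quotz (h : C -> C) (d z : C) : C := if Ceq_dec z (RtoC 0) then d else (h z / z)%C.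

Lemma quotz_mul h d z : h (RtoC 0) = RtoC 0 -> (z * quotz h d z)%C = h z.
Proof.
  intros H0. unfold quotz. destruct (Ceq_dec z (RtoC 0)) as [->|N].
  - rewrite H0. ring.
  - field. auto.
Qed.

(** Subtracting Cauchy's formulas at w and 0 and using circ/(circ - w) - 1 = w/(circ - w) gives h(w)
    = w G(w) with G a Cauchy integral. G is holomorphic also at 0, and G(0) = d by uniqueness of the
    derivative of h. *)
Theorem hol_quotz h d : hol h -> h (RtoC 0) = RtoC 0 -> der idC h (RtoC 0) d -> hol (quotz h d).
Proof.
  intros Hh H0 Hd z Hz. unfold inD in Hz. pose proof (Cmod_ge_0 z).
  set (r := (1 + Cmod z) / 2). assert (Hr : Cmod z < r < 1) by (unfold r; lra).
  assert (Cf : cont_on (fun y => h (circ r y)) 0 1) by (apply hol_circ_cont; auto; lra).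
  set (G := fun w => CInt (fun y => h (circ r y) / (circ r y - w))%C 0 1).
  assert (DG : forall w, Cmod w < r -> exists d, der idC G w d).
  { intros w Hw. eexists. apply kernel_der1; auto; lra. }
  assert (E : forall w, Cmod w < r -> h w = (w * G w)%C).
  { intros w Hw. pose proof (Cmod_ge_0 w).
    assert (R0 : Cmod (RtoC 0) < r < 1) by (rewrite Cmod_0; lra).
    transitivity (h w - h (RtoC 0))%C; [rewrite H0; ring|].
    rewrite <- (cauchy_formula' h r w), <- (cauchy_formula' h r (RtoC 0)) by (auto; lra).
    unfold G.
    assert (K1 : forall v, Cmod v < r -> cont_on (fun y => h (circ r y) * circ r y / (circ r y - v))%C 0 1).
    { intros v Hv. apply (kernel_cont _ r v); auto; try lra.
      - apply cont_on_mult; auto. intros y _. apply ctn_circ.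
      - apply kernel_self; auto. }
    rewrite <- CInt_minus, <- CInt_scal; auto; try lra.
    2: { apply (kernel_cont _ r w); auto; try lra. apply kernel_self; auto. }
    2: { apply K1. apply R0. }
    apply CInt_ext; [lra|]. intros y _.
    assert (circ r y <> RtoC 0) by (apply Cmod_pos_neq0; rewrite Cmod_circ; lra).
    field. split; [now apply circ_minus_neq0|].
    replace (circ r y - 0)%C with (circ r y) by ring. auto. }
  assert (EQ : forall w, Cmod w < r -> G w = quotz h d w).
  { intros w Hw. unfold quotz. destruct (Ceq_dec w (RtoC 0)) as [->|N].
    - apply (der_unique h (RtoC 0)); auto. destruct (DG (RtoC 0) Hw) as [dG HdG].
      apply (der_ext _ (fun w => w * G w)%C _ _ _ r).
      + lra.
      + intros v Hv. unfold idC in Hv. symmetry. apply E.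
        replace (v - 0)%C with v in Hv by ring. auto.
      + eapply der_eq; [apply der_mult; [apply der_id|apply HdG]|]. cbv beta. ring.
    - rewrite E by auto. field. auto. }
  destruct (DG z ltac:(lra)) as [dz Hdz]. exists dz.
  apply (der_ext _ G _ _ _ (r - Cmod z)); [lra| |auto].
  intros v Hv. unfold idC in Hv. apply EQ. pose proof (Cmod_triangle_sub v z). lra.
Qed.

Lemma hol_pow h n : hol h -> hol (fun z => h z ^ n)%C.
Proof.
  intros Hh z Hz. induction n as [|n [d Hd]].
  - exists (RtoC 0). apply (der_const idC (RtoC 1)).
  - destruct (Hh z Hz) as [d' Hd']. eexists.
    apply (der_ext _ (fun y => h y * h y ^ n)%C _ _ _ 1); [lra|intros; now rewrite Cpow_S|].
    apply der_mult; eauto.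
Qed.

Lemma le_of_pow_le (a b K : R) : 0 <= a -> 0 <= b -> (forall n, a ^ n <= K * b ^ n) -> a <= b.
Proof.
  intros Ha Hb H. apply Rnot_lt_le. intros L.
  assert (Q : 1 <= 0); [|lra].
  apply (small_power_zero _ K (b / a)).
  - split; [apply Rmult_le_pos; [lra|]; apply Rlt_le, Rinv_0_lt_compat; lra|].
    apply Rmult_lt_reg_r with a; [lra|]. unfold Rdiv. rewrite Rmult_assoc, Rinv_l; lra.
  - intros n. specialize (H n). assert (0 < a ^ n) by (apply pow_lt; lra).
    unfold Rdiv. rewrite Rpow_mult_distr, pow_inv.
    apply Rmult_le_reg_r with (a ^ n); auto.
    replace (K * (b ^ n * / a ^ n) * a ^ n) with (K * b ^ n) by (field; lra). lra.
Qed.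

(* Cauchy's formula for [h^n], and [n -> oo]. *)
Lemma maximum_principle h r M z : hol h -> Cmod z < r < 1 ->
  (forall w, Cmod w = r -> Cmod (h w) <= M) -> Cmod (h z) <= M.
Proof.
  intros Hh Hr HM. pose proof (Cmod_ge_0 z).
  assert (M0 : 0 <= M).
  { eapply Rle_trans; [apply Cmod_ge_0|]. apply (HM (circ r 0)). rewrite Cmod_circ; lra. }
  apply (le_of_pow_le _ _ (r / (r - Cmod z))); auto using Cmod_ge_0.
  intros n. rewrite <- Cmod_pow, <- (cauchy_formula (fun z => h z ^ n)%C r z (hol_pow h n Hh) Hr).
  replace (r / (r - Cmod z) * M ^ n) with (M ^ n * (r / (r - Cmod z)) * (1 - 0)) by ring.
  apply CInt_bound; [lra| |].
  - apply cont_on_mult; [apply (hol_circ_cont (fun z => h z ^ n)%C); [now apply hol_pow|lra]|].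
    intros y _. apply ctn_div; [apply circ_minus_neq0; lra|apply ctn_circ|].
    apply ctn_minus; [apply ctn_circ|apply ctn_const].
  - intros y _. rewrite Cmod_mult, Cmod_pow, Cmod_div, Cmod_circ by (try apply circ_minus_neq0; lra).
    pose proof (circ_minus_ge r z y ltac:(lra)).
    apply Rmult_le_compat.
    + apply pow_le, Cmod_ge_0.
    + apply Rmult_le_pos; [lra|]. apply Rlt_le, Rinv_0_lt_compat. lra.
    + apply pow_incr. split; [apply Cmod_ge_0|]. apply HM. rewrite Cmod_circ; lra.
    + apply Rmult_le_compat_l; [lra|]. apply Rinv_le_contravar; lra.
Qed.

Theorem schwarz_lemma h z : hol h -> h (RtoC 0) = RtoC 0 -> (forall w, inD w -> Cmod (h w) <= 1) ->
  inD z -> Cmod (h z) <= Cmod z.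
Proof.
  intros Hh H0 H1 Hz. unfold inD in Hz. pose proof (Cmod_ge_0 z).
  assert (D0 : inD (RtoC 0)) by (unfold inD; rewrite Cmod_0; lra).
  set (q := quotz h (C_derive h (RtoC 0))).
  assert (Hq : hol q) by (apply hol_quotz; auto; now apply hol_der).
  assert (B : forall r, Cmod z < r < 1 -> Cmod (q z) <= / r).
  { intros r Hr. apply (maximum_principle q r); auto. intros w Hw.
    assert (N : w <> RtoC 0) by (apply Cmod_pos_neq0; lra).
    unfold q, quotz. destruct (Ceq_dec w (RtoC 0)); [contradiction|].
    rewrite Cmod_div, Hw by auto. rewrite <- (Rmult_1_l (/ r)).
    apply Rmult_le_compat_r; [apply Rlt_le, Rinv_0_lt_compat; lra|]. apply H1. unfold inD; lra. }
  rewrite <- (quotz_mul h (C_derive h (RtoC 0)) z H0). fold q. rewrite Cmod_mult.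
  rewrite <- (Rmult_1_r (Cmod z)) at 2. apply Rmult_le_compat_l; auto.
  apply Rnot_lt_le. intros L.
  (* A radius below 1 that exceeds both |z| and 1/|q z|; it contradicts |q z| <= 1/r. *)
  set (r := Rmax ((1 + Cmod z) / 2) ((1 + / Cmod (q z)) / 2)).
  assert (I1 : / Cmod (q z) < 1) by (rewrite <- Rinv_1; apply Rinv_lt_contravar; lra).
  assert (Hr : Cmod z < r < 1).
  { split. eapply Rlt_le_trans; [|apply Rmax_l]. lra. apply Rmax_lub_lt; lra. }
  assert (I2 : / Cmod (q z) < r) by (eapply Rlt_le_trans; [|apply Rmax_r]; lra).
  specialize (B r Hr).
  assert (0 < / Cmod (q z)) by (apply Rinv_0_lt_compat; lra).
  apply Rinv_lt_contravar in I2; [|apply Rmult_lt_0_compat; lra].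
  rewrite Rinv_inv in I2. lra.
Qed.

Lemma hol_increment h x y : hol h -> inD x -> inD y ->
  (h y - h x)%C = CInt (fun t => C_derive h (x + RtoC t * (y - x)) * (y - x))%C 0 1.
Proof.
  intros Hh Hx Hy.
  rewrite (CInt_FTC (fun t => h (x + RtoC t * (y - x)))%C); [|lra| |].
  - f_equal; [|f_equal]; f_equal; ring.
  - intros t Ht. apply (der_comp RtoC h); [apply der_segment|].
    apply hol_der; auto. now apply segment_inD.
  - intros t Ht. apply ctn_mult; [|apply ctn_const]. apply ctn_comp.
    + eapply der_ctn, der_segment.
    + apply hol_ctn; [now apply hol_C_derive|now apply segment_inD].
Qed.

Lemma segment_ball (z x y : C) t B : 0 <= t <= 1 -> Cmod (x - z)%C < B -> Cmod (y - z)%C < B ->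
  Cmod (x + RtoC t * (y - x) - z)%C < B.
Proof.
  intros. replace (x + RtoC t * (y - x) - z)%C with (RtoC (1 - t) * (x - z) + RtoC t * (y - z))%C
    by (rewrite RtoC_minus; ring).
  now apply Cmod_convex.
Qed.

(** Both points vary, as they must when two colliding points approach z together. This strict form
    of differentiability follows from continuity of the derivative along the segment between
    them. *)
Lemma hol_strict_der h z eps : hol h -> inD z -> 0 < eps -> exists del, 0 < del /\
  forall x y, Cmod (x - z)%C < del -> Cmod (y - z)%C < del ->
    Cmod (h y - h x - C_derive h z * (y - x))%C <= eps * Cmod (y - x)%C.
Proof.
  intros Hh Hz He.
  destruct (hol_ctn _ z (hol_C_derive h Hh) Hz eps He) as [d [Hd H1]]. unfold idC in H1. unfold inD in Hz.
  exists (Rmin d (1 - Cmod z)). split; [apply Rmin_glb_lt; lra|]. intros x y Hx Hy.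
  pose proof (Rmin_l d (1 - Cmod z)). pose proof (Rmin_r d (1 - Cmod z)).
  assert (Ix : inD x) by (unfold inD; pose proof (Cmod_triangle_sub x z); lra).
  assert (Iy : inD y) by (unfold inD; pose proof (Cmod_triangle_sub y z); lra).
  rewrite hol_increment by auto.
  assert (Cc : cont_on (fun t => C_derive h (x + RtoC t * (y - x)) * (y - x))%C 0 1).
  { intros t Ht. apply ctn_mult; [|apply ctn_const]. apply ctn_comp.
    + eapply der_ctn, der_segment.
    + apply hol_ctn; [now apply hol_C_derive|now apply segment_inD]. }
  replace (C_derive h z * (y - x))%C with (CInt (fun _ => C_derive h z * (y - x))%C 0 1)
    by (rewrite CInt_const by lra; rewrite Rminus_0_r; ring).
  rewrite <- CInt_minus; auto using cont_on_const; [|lra].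
  replace (eps * Cmod (y - x)%C) with (eps * Cmod (y - x)%C * (1 - 0)) by ring.
  apply CInt_bound; [lra| |].
  - apply cont_on_minus; auto using cont_on_const.
  - intros t Ht.
    replace (C_derive h (x + RtoC t * (y - x)) * (y - x) - C_derive h z * (y - x))%C
      with ((C_derive h (x + RtoC t * (y - x)) - C_derive h z) * (y - x))%C by ring.
    rewrite Cmod_mult. apply Rmult_le_compat_r; [apply Cmod_ge_0|]. apply Rlt_le, H1.
    apply segment_ball; lra.
Qed.

Lemma hol_der_zero_const h z : (forall w, inD w -> der idC h w (RtoC 0)) -> inD z -> h z = h (RtoC 0).
Proof.
  intros H Hz. assert (D0 : inD (RtoC 0)) by (unfold inD; rewrite Cmod_0; lra).
  assert (Hh : hol h) by (intros w Hw; eauto).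
  apply Ceq_minus. rewrite hol_increment by auto.
  rewrite (CInt_ext _ (fun _ => RtoC 0)); [rewrite CInt_const by lra; ring|lra|].
  intros t Ht. rewrite (C_derive_eq _ _ (RtoC 0)); [ring|]. apply H. now apply segment_inD.
Qed.

(** * Compactness and the local step along the chain g + t k *)

Definition tends (u : nat -> C) (l : C) : Prop :=
  forall eps, 0 < eps -> exists N, forall n, (N <= n)%nat -> Cmod (u n - l)%C < eps.

Lemma tends_subseq u l s : (forall n, (n <= s n)%nat) -> tends u l -> tends (fun n => u (s n)) l.
Proof.
  intros Hs H eps He. destruct (H eps He) as [N HN]. exists N. intros n Hn.
  apply HN. specialize (Hs n). lia.
Qed.

Lemma tends_ctn f u l : tends u l -> ctn idC f l -> tends (fun n => f (u n)) (f l).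
Proof.
  intros H Hf eps He. destruct (Hf eps He) as [d [Hd H1]]. destruct (H d Hd) as [N HN].
  exists N. intros n Hn. apply H1. unfold idC. auto.
Qed.

Lemma tends_unique u l l' : tends u l -> tends u l' -> l = l'.
Proof.
  intros H H'. apply Ceq_minus, Cmod_eq_0. apply Rle_antisym; [|apply Cmod_ge_0].
  apply le_epsilon. intros eps He.
  destruct (H (eps / 2)) as [N HN]; [lra|]. destruct (H' (eps / 2)) as [N' HN']; [lra|].
  specialize (HN (N + N')%nat ltac:(lia)). specialize (HN' (N + N')%nat ltac:(lia)).
  replace (l - l')%C with ((u (N + N')%nat - l') - (u (N + N')%nat - l))%C by ring.
  eapply Rle_trans; [apply Cmod_minus_le|]. lra.
Qed.

Lemma tends_plus u v l l' : tends u l -> tends v l' -> tends (fun n => u n + v n)%C (l + l')%C.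
Proof.
  intros H H' eps He. destruct (H (eps / 2)) as [N HN]; [lra|].
  destruct (H' (eps / 2)) as [N' HN']; [lra|]. exists (N + N')%nat. intros n Hn.
  specialize (HN n ltac:(lia)). specialize (HN' n ltac:(lia)).
  replace (u n + v n - (l + l'))%C with ((u n - l) + (v n - l'))%C by ring.
  eapply Rle_lt_trans; [apply Cmod_triangle|]. lra.
Qed.

Lemma tends_bound u l M : tends u l -> (forall n, Cmod (u n) <= M) -> Cmod l <= M.
Proof.
  intros H HM. apply le_epsilon. intros eps He. destruct (H eps He) as [N HN].
  specialize (HN N (le_n N)). specialize (HM N).
  pose proof (Cmod_triangle_sub l (u N)). rewrite Cmod_sub_sym in H0. lra.
Qed.

Lemma tends_mult u v l l' : tends u l -> tends v l' -> tends (fun n => u n * v n)%C (l * l')%C.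
Proof.
  intros H H' eps He. pose proof (Cmod_ge_0 l). pose proof (Cmod_ge_0 l').
  destruct (eps_ratio (eps / 2) (Cmod l + Cmod l' + 1)) as [eta [E1 [E2 E3]]]; try lra.
  destruct (H eta E1) as [N HN]. destruct (H' eta E1) as [N' HN']. exists (N + N')%nat. intros n Hn.
  specialize (HN n ltac:(lia)). specialize (HN' n ltac:(lia)).
  replace (u n * v n - l * l')%C
    with ((u n - l) * l' + (l * (v n - l') + (u n - l) * (v n - l')))%C by ring.
  eapply Rle_lt_trans; [apply Cmod_triangle|].
  eapply Rle_lt_trans; [apply Rplus_le_compat_l, Cmod_triangle|].
  rewrite !Cmod_mult.
  pose proof (Cmod_ge_0 (u n - l)%C). pose proof (Cmod_ge_0 (v n - l')%C). nra.
Qed.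

Lemma seq_choice {A : Type} (P : nat -> A -> Prop) : (forall n, exists a, P n a) ->
  exists f : nat -> A, forall n, P n (f n).
Proof.
  intros H. exists (fun n => proj1_sig (constructive_indefinite_description _ (H n))).
  intros n. destruct (constructive_indefinite_description _ (H n)). auto.
Qed.

Lemma inv_INR_small eps : 0 < eps -> exists N, forall n, (N <= n)%nat -> / (INR n + 1) < eps.
Proof.
  intros He. destruct (INR_unbounded (/ eps)) as [N HN]. exists N. intros n Hn.
  apply le_INR in Hn. rewrite <- (Rinv_inv eps).
  assert (0 < / eps) by now apply Rinv_0_lt_compat.
  apply Rinv_lt_contravar; [|lra]. apply Rmult_lt_0_compat; lra.
Qed.

(** The index map only satisfies n <= s n; a cluster point yields this directly, and it suffices to
    carry limits along. *)
Lemma R_subseq (u : nat -> R) M : (forall n, Rabs (u n) <= M) ->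
  exists (s : nat -> nat) (l : R), (forall n, (n <= s n)%nat) /\
    forall eps, 0 < eps -> exists N, forall n, (N <= n)%nat -> Rabs (u (s n) - l) < eps.
Proof.
  intros HM.
  destruct (Bolzano_Weierstrass u (fun x => - M <= x <= M)) as [l Hl].
  - apply compact_P3.
  - intros n. specialize (HM n). apply Rabs_le_between in HM. auto.
  - assert (K : forall n, exists p, (n <= p)%nat /\ Rabs (u p - l) < / (INR n + 1)).
    { intros n. assert (P : 0 < / (INR n + 1)) by (apply Rinv_0_lt_compat; pose proof (pos_INR n); lra).
      destruct (Hl (disc l (mkposreal _ P)) n) as [p [Hp1 Hp2]].
      - exists (mkposreal _ P). intros x Hx. exact Hx.
      - exists p. split; auto. }
    apply seq_choice in K. destruct K as [s Hs].
    exists s, l. split; [intros; apply Hs|]. intros eps He.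
    destruct (inv_INR_small eps He) as [N HN]. exists N. intros n Hn.
    destruct (Hs n) as [_ H]. eapply Rlt_trans; [apply H|auto].
Qed.

Lemma C_subseq (u : nat -> C) M : (forall n, Cmod (u n) <= M) ->
  exists (s : nat -> nat) (l : C), (forall n, (n <= s n)%nat) /\ tends (fun n => u (s n)) l.
Proof.
  intros HM.
  assert (B : forall z, Rabs (Re z) <= Cmod z /\ Rabs (Im z) <= Cmod z).
  { intros z. pose proof (Rmax_Cmod z). split; eapply Rle_trans; eauto; [apply Rmax_l|apply Rmax_r]. }
  destruct (R_subseq (fun n => Re (u n)) M) as [s1 [x [S1 L1]]].
  { intros n. destruct (B (u n)). specialize (HM n). lra. }
  destruct (R_subseq (fun n => Im (u (s1 n))) M) as [s2 [y [S2 L2]]].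
  { intros n. destruct (B (u (s1 n))). specialize (HM (s1 n)). lra. }
  exists (fun n => s1 (s2 n)), (x, y). split.
  { intros n. specialize (S2 n). specialize (S1 (s2 n)). lia. }
  intros eps He. destruct (L1 (eps / 2)) as [N1 H1]; [lra|]. destruct (L2 (eps / 2)) as [N2 H2]; [lra|].
  exists (N1 + N2)%nat. intros n Hn.
  specialize (H1 (s2 n) ltac:(specialize (S2 n); lia)). specialize (H2 n ltac:(lia)).
  set (w := u (s1 (s2 n))) in *.
  replace (w - (x, y))%C with (RtoC (Re w - x) + Ci * RtoC (Im w - y))%C.
  2:{ destruct w as [a b]. unfold Re, Im, RtoC, Ci, Cplus, Cmult, Cminus, Copp; simpl. apply injective_projections; simpl; ring. }
  eapply Rle_lt_trans; [apply Cmod_triangle|]. rewrite Cmod_mult, Cmod_Ci, !Cmod_R. lra.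
Qed.

Lemma min_attained (S : C -> Prop) (f : C -> R) M :
  (exists z, S z) -> (forall z, S z -> Cmod z <= M) ->
  (forall u l, (forall n, S (u n)) -> tends u l -> S l) ->
  (forall z, S z -> 0 <= f z) -> (forall z, S z -> ctn idC (fun w => RtoC (f w)) z) ->
  exists z, S z /\ forall w, S w -> f z <= f w.
Proof.
  intros [z0 Hz0] HM Hcl Hpos Hc.
  destruct (completeness (fun x => exists z, S z /\ x = - f z)) as [m [U L]].
  - exists 0. intros x [z [Hz ->]]. specialize (Hpos z Hz). lra.
  - exists (- f z0). eauto.
  - assert (K : forall n : nat, exists z, S z /\ f z < - m + / (INR n + 1)).
    { intros n. assert (P : 0 < / (INR n + 1)) by (apply Rinv_0_lt_compat; pose proof (pos_INR n); lra).
      apply NNPP. intros N. assert (m <= m - / (INR n + 1)); [|lra].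
      apply L. intros x [z [Hz ->]]. apply Rnot_lt_le. intros Q. apply N. exists z. split; auto. lra. }
    apply seq_choice in K. destruct K as [u Hu].
    destruct (C_subseq u M) as [s [l [Hs Hl]]]. { intros n. apply HM, Hu. }
    assert (Sl : S l). { apply (Hcl (fun n => u (s n))); auto. intros n. apply Hu. }
    exists l. split; auto. intros w Hw.
    assert (f l <= - m).
    { apply le_epsilon. intros eps He.
      destruct (tends_ctn _ _ _ Hl (Hc l Sl) (eps / 2)) as [N1 H1]; [lra|].
      destruct (inv_INR_small (eps / 2)) as [N2 H2]; [lra|].
      set (n := (N1 + N2)%nat). specialize (H1 n ltac:(lia)).
      specialize (H2 (s n)). specialize (Hs n).
      specialize (H2 ltac:(lia)). destruct (Hu (s n)) as [_ Q].
      rewrite <- RtoC_minus, Cmod_R in H1. apply Rabs_def2 in H1. lra. }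
    assert (- f w <= m) by (apply U; eauto). lra.
Qed.

Lemma ctn_RCmod {T : Type} (e f : T -> C) x : ctn e f x -> ctn e (fun y => RtoC (Cmod (f y))) x.
Proof.
  intros H eps He. destruct (H eps He) as [d [Hd H1]]. exists d. split; auto. intros y Hy.
  specialize (H1 y Hy). rewrite <- RtoC_minus, Cmod_R.
  pose proof (Cmod_triangle_sub (f y) (f x)). pose proof (Cmod_triangle_sub (f x) (f y)).
  rewrite (Cmod_sub_sym (f x)) in H2. apply Rabs_def1; lra.
Qed.

Lemma ctn_RRe {T : Type} (e f : T -> C) x : ctn e f x -> ctn e (fun y => RtoC (Re (f y))) x.
Proof.
  intros H eps He. destruct (H eps He) as [d [Hd H1]]. exists d. split; auto. intros y Hy.
  specialize (H1 y Hy). rewrite <- RtoC_minus, Cmod_R.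
  replace (Re (f y) - Re (f x)) with (Re (f y - f x)%C).
  2:{ unfold Cminus. rewrite re_plus, re_opp. ring. }
  eapply Rle_lt_trans; [apply re_le_Cmod|]. auto.
Qed.

Lemma closed_disc_seq (c : C) rho u l : (forall n : nat, Cmod (u n - c)%C <= rho) -> tends u l ->
  Cmod (l - c)%C <= rho.
Proof.
  intros H Hl. apply (tends_bound (fun n => u n - c)%C); auto.
  intros eps He. destruct (Hl eps He) as [N HN]. exists N. intros n Hn.
  replace (u n - c - (l - c))%C with (u n - l)%C by ring. auto.
Qed.

Lemma disc_min (f : C -> R) (c : C) rho : 0 <= rho ->
  (forall z, Cmod (z - c)%C <= rho -> 0 <= f z) ->
  (forall z, Cmod (z - c)%C <= rho -> ctn idC (fun w => RtoC (f w)) z) ->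
  exists z, Cmod (z - c)%C <= rho /\ forall w, Cmod (w - c)%C <= rho -> f z <= f w.
Proof.
  intros Hr Hp Hc. apply (min_attained (fun z => Cmod (z - c)%C <= rho) f (rho + Cmod c)); auto.
  - exists c. replace (c - c)%C with (RtoC 0) by ring. now rewrite Cmod_0.
  - intros z Hz. pose proof (Cmod_triangle_sub z c). lra.
  - intros u l Hu Hl. eapply closed_disc_seq; eauto.
Qed.

(* Moving from [z] in the direction [- Phi(z)/Phi'(z)] decreases [|Phi|]. *)
Lemma critical_min_zero (Phi : C -> C) z d del : der idC Phi z d -> d <> RtoC 0 -> 0 < del ->
  (forall w, Cmod (w - z)%C < del -> Cmod (Phi z) <= Cmod (Phi w)) -> Phi z = RtoC 0.
Proof.
  intros HD Nd Hdel Hmin. apply NNPP. intros N.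
  pose proof (proj1 (Cmod_gt_0 _) N) as P. pose proof (proj1 (Cmod_gt_0 _) Nd) as Pd.
  destruct (HD (Cmod d / 2)) as [d1 [Hd1 H1]]; [lra|]. unfold idC in H1.
  set (v := (Phi z / d)%C).
  assert (Pv : 0 < Cmod v).
  { unfold v. rewrite Cmod_div by auto. now apply Rdiv_lt_0_compat. }
  set (t := Rmin (1/2) (Rmin d1 del / (2 * Cmod v))).
  assert (Q : 0 < Rmin d1 del) by now apply Rmin_glb_lt.
  assert (Ht : 0 < t). { apply Rmin_glb_lt; [lra|]. apply Rdiv_lt_0_compat; lra. }
  assert (Ht1 : t <= 1 / 2) by apply Rmin_l.
  assert (Ht2 : t * Cmod v < Rmin d1 del).
  { assert (t <= Rmin d1 del / (2 * Cmod v)) by apply Rmin_r.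
    apply Rle_lt_trans with (Rmin d1 del / (2 * Cmod v) * Cmod v).
    - apply Rmult_le_compat_r; lra.
    - replace (Rmin d1 del / (2 * Cmod v) * Cmod v) with (Rmin d1 del / 2) by (field; lra). lra. }
  pose proof (Rmin_l d1 del). pose proof (Rmin_r d1 del).
  set (w := (z - RtoC t * v)%C).
  assert (Ew : (w - z)%C = (- (RtoC t * v))%C) by (unfold w; ring).
  assert (Mw : Cmod (w - z)%C = t * Cmod v). { rewrite Ew, Cmod_opp, Cmod_mult, Cmod_Rpos; lra. }
  specialize (Hmin w ltac:(lra)). specialize (H1 w ltac:(lra)). rewrite Mw in H1.
  assert (E : Cmod (Phi w) <= (1 - t) * Cmod (Phi z) + Cmod d / 2 * (t * Cmod v)).
  { replace (Phi w) with (RtoC (1 - t) * Phi z + (Phi w - Phi z - d * (w - z)))%C.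
    - eapply Rle_trans; [apply Cmod_triangle|]. rewrite Cmod_mult, Cmod_Rpos; lra.
    - rewrite Ew, RtoC_minus. unfold v. field. auto. }
  assert (Cmod d * Cmod v = Cmod (Phi z)).
  { unfold v. rewrite Cmod_div by auto. field. lra. }
  assert (t * Cmod (Phi z) > 0) by (apply Rmult_lt_0_compat; lra). nra.
Qed.

Section Chain.
Variables (g k : C -> C).
Hypothesis Hg : hol g.
Hypothesis Hk : hol k.
Notation g' := (C_derive g).
Notation k' := (C_derive k).

(** An Euler step for dz/dtau = - k/(g' + tau k'), corrected to be exact: within eps d of the Euler
    point c there is a true solution w. It is a minimum point of |Phi| on the disc of radius eps d
    about c, where Phi is close to A (w - c); [critical_min_zero] turns an interior minimum into a
    zero. *)
Lemma chain_step z tau eps : inD z -> 0 <= tau ->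
  (g' z + RtoC tau * k' z)%C <> RtoC 0 -> 0 < eps -> exists del, 0 < del /\
  forall d, 0 < d < del -> exists w,
    Cmod (w - (z - RtoC d * (k z / (g' z + RtoC tau * k' z))))%C <= eps * d /\
    (g w + RtoC (tau + d) * k w)%C = (g z + RtoC tau * k z)%C.
Proof.
  intros Hz Htau HA He. set (A := (g' z + RtoC tau * k' z)%C) in *.
  set (D := (k z / A)%C).
  pose proof (proj1 (Cmod_gt_0 _) HA) as PA. pose proof (Cmod_ge_0 D) as PD.
  pose proof (Cmod_ge_0 (k' z)) as Pk. unfold inD in Hz.
  set (L := Cmod D + eps).
  assert (PL : 0 < L) by (unfold L; lra).
  (* [L d] bounds |w - z| on the disc. The tolerance e1 is for the Taylor remainders of g and k, e2
     for the cross term d k'(z) (w - z); e3 and e4 below keep the derivative of Phi within (3/4) |A|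
     of A. *)
  destruct (eps_ratio (eps * Cmod A / 6) (L * (2 + tau))) as [e1 [E1 [E2 _]]].
  { assert (0 < eps * Cmod A) by now apply Rmult_lt_0_compat. lra. } { nra. }
  destruct (eps_ratio (eps * Cmod A / 6) (L * Cmod (k' z))) as [e2 [F1 [F2 F3]]].
  { assert (0 < eps * Cmod A) by now apply Rmult_lt_0_compat. lra. } { nra. }
  destruct (hol_der g z Hg Hz e1 E1) as [dg [Hdg Gg]].
  destruct (hol_der k z Hk Hz e1 E1) as [dk [Hdk Gk]].
  destruct (hol_ctn _ z (hol_C_derive g Hg) Hz (Cmod A / 4)) as [cg [Hcg Ggc]]; [lra|].
  destruct (eps_ratio (Cmod A / 4) (1 + tau)) as [e3 [I1 [I2 _]]]; [lra|lra|].
  destruct (hol_ctn _ z (hol_C_derive k Hk) Hz e3 I1) as [ck [Hck Gkc]].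
  destruct (eps_ratio (Cmod A / 4) (Cmod (k' z) + 1)) as [e4 [J1 [J2 J3]]]; [lra|lra|].
  unfold idC in *.
  set (m := Rmin (Rmin (Rmin dg dk) (Rmin cg ck)) (1 - Cmod z)).
  assert (Pm : 0 < m) by (unfold m; repeat apply Rmin_glb_lt; lra).
  assert (Mm : m <= dg /\ m <= dk /\ m <= cg /\ m <= ck /\ m <= 1 - Cmod z).
  { unfold m. repeat split; eauto using Rle_trans, Rmin_l, Rmin_r. }
  exists (Rmin (Rmin e2 e4) (m / (2 * L))).
  split. { repeat apply Rmin_glb_lt; auto. apply Rdiv_lt_0_compat; lra. }
  intros d [Hd0 Hd].
  assert (Hd1 : d < e2) by (eapply Rlt_le_trans; [apply Hd|]; eapply Rle_trans; [apply Rmin_l|apply Rmin_l]).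
  assert (Hd2 : d < e4) by (eapply Rlt_le_trans; [apply Hd|]; eapply Rle_trans; [apply Rmin_l|apply Rmin_r]).
  assert (Hd3 : L * d < m / 2 + m / 4).
  { assert (d < m / (2 * L)) by (eapply Rlt_le_trans; [apply Hd|apply Rmin_r]).
    assert (L * d < L * (m / (2 * L))) by (apply Rmult_lt_compat_l; auto).
    replace (L * (m / (2 * L))) with (m / 2) in H0 by (field; lra). lra. }
  set (c := (z - RtoC d * D)%C).
  set (Phi := fun w => (g w + RtoC (tau + d) * k w - (g z + RtoC tau * k z))%C).
  assert (Ball : forall w, Cmod (w - c)%C <= eps * d -> Cmod (w - z)%C <= L * d).
  { intros w Hw. replace (w - z)%C with ((w - c) - RtoC d * D)%C by (unfold c; ring).
    eapply Rle_trans; [apply Cmod_minus_le|]. rewrite Cmod_mult, Cmod_Rpos by lra. unfold L. lra. }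
  assert (Est : forall w, Cmod (w - c)%C <= eps * d ->
     Cmod (Phi w - A * (w - c))%C <= eps * d * Cmod A / 3).
  { intros w Hw. pose proof (Ball w Hw) as Bw. pose proof (Cmod_ge_0 (w - z)%C).
    specialize (Gg w ltac:(lra)). specialize (Gk w ltac:(lra)).
    replace (Phi w - A * (w - c))%C with
      ((g w - g z - g' z * (w - z)) + (RtoC (tau + d) * (k w - k z - k' z * (w - z)) +
       RtoC d * (k' z * (w - z))))%C.
    2:{ unfold Phi, c, D. transitivity (g w + RtoC (tau + d) * k w - (g z + RtoC tau * k z) -
          (A * (w - z) + RtoC d * k z))%C; [|field; auto].
        unfold A. rewrite RtoC_plus. ring. }
    eapply Rle_trans; [apply Cmod_triangle|].
    eapply Rle_trans; [apply Rplus_le_compat_l, Cmod_triangle|].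
    rewrite !Cmod_mult, !Cmod_Rpos by lra.
    assert (X1 : Cmod (g w - g z - g' z * (w - z))%C <= e1 * (L * d)).
    { eapply Rle_trans; [apply Gg|]. apply Rmult_le_compat_l; lra. }
    assert (X2 : (tau + d) * Cmod (k w - k z - k' z * (w - z))%C <= (tau + 1) * (e1 * (L * d))).
    { apply Rmult_le_compat; try lra. apply Cmod_ge_0.
      eapply Rle_trans; [apply Gk|]. apply Rmult_le_compat_l; lra. }
    assert (X3 : d * (Cmod (k' z) * Cmod (w - z)%C) <= e2 * (Cmod (k' z) * (L * d))).
    { apply Rmult_le_compat; try lra. apply Rmult_le_pos; lra. apply Rmult_le_compat_l; lra. }
    assert (X4 : e1 * (L * (2 + tau)) * d <= eps * Cmod A / 6 * d) by (apply Rmult_le_compat_r; lra).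
    assert (X5 : e2 * (L * Cmod (k' z)) * d <= eps * Cmod A / 6 * d) by (apply Rmult_le_compat_r; lra).
    lra. }
  assert (Pe : 0 < eps * d) by now apply Rmult_lt_0_compat.
  assert (InB : forall w, Cmod (w - c)%C <= eps * d -> inD w).
  { intros w Hw. pose proof (Ball w Hw). pose proof (Cmod_triangle_sub w z). unfold inD. lra. }
  assert (DPhi : forall w, inD w -> der idC Phi w (g' w + RtoC (tau + d) * k' w - 0)%C).
  { intros w Hw. apply der_minus; [|apply der_const]. apply der_plus; [now apply hol_der|].
    apply der_scal. now apply hol_der. }
  destruct (disc_min (fun w => Cmod (Phi w)) c (eps * d)) as [w [Hw Hmin]].
  - lra.
  - intros; apply Cmod_ge_0.
  - intros w Hw. apply ctn_RCmod. eapply der_ctn. apply DPhi. now apply InB.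
  - exists w. split; [exact Hw|]. apply Ceq_minus. change (Phi w = RtoC 0).
    assert (Hc : Cmod (c - c)%C <= eps * d).
    { replace (c - c)%C with (RtoC 0) by ring. rewrite Cmod_0. lra. }
    (* By [Est], |Phi| is at most one third of eps d |A| at the centre and at least two thirds of it
       on the boundary. *)
    assert (Hint : Cmod (w - c)%C < eps * d).
    { apply Rnot_le_lt. intros Q.
      pose proof (Hmin c Hc) as M1. pose proof (Est c Hc) as M2. pose proof (Est w Hw) as M3.
      replace (Phi c - A * (c - c))%C with (Phi c) in M2 by ring.
      pose proof (Cmod_triangle_sub (A * (w - c))%C (Phi w)) as M4.
      rewrite (Cmod_sub_sym (A * (w - c))%C), Cmod_mult in M4.
      assert (Cmod A * (eps * d) <= Cmod A * Cmod (w - c)%C) by (apply Rmult_le_compat_l; lra).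
      assert (0 < Cmod A * (eps * d)) by now apply Rmult_lt_0_compat. lra. }
    apply (critical_min_zero Phi w _ (eps * d - Cmod (w - c)%C) (DPhi w (InB w Hw))).
    + pose proof (Ball w Hw) as Bw.
      specialize (Ggc w ltac:(lra)). specialize (Gkc w ltac:(lra)).
      apply Cmod_pos_neq0.
      pose proof (Cmod_triangle_sub A (g' w + RtoC (tau + d) * k' w - 0)%C) as T.
      assert (Cmod (A - (g' w + RtoC (tau + d) * k' w - 0))%C <= Cmod A * (3/4)); [|lra].
      replace (A - (g' w + RtoC (tau + d) * k' w - 0))%C with
        ((- (g' w - g' z)) + ((- (RtoC (tau + d) * (k' w - k' z))) - RtoC d * k' z))%C
        by (unfold A; rewrite RtoC_plus; ring).
      eapply Rle_trans; [apply Cmod_triangle|].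
      eapply Rle_trans; [apply Rplus_le_compat_l, Cmod_minus_le|].
      rewrite !Cmod_opp, !Cmod_mult, !Cmod_Rpos by lra.
      assert ((tau + d) * Cmod (k' w - k' z)%C <= (1 + tau) * e3).
      { apply Rmult_le_compat; try lra. apply Cmod_ge_0. }
      assert (d * Cmod (k' z) <= e4 * (Cmod (k' z) + 1)).
      { apply Rmult_le_compat; lra. }
      lra.
    + lra.
    + intros v Hv. apply Hmin.
      replace (v - c)%C with ((v - w) + (w - c))%C by ring.
      eapply Rle_trans; [apply Cmod_triangle|]. lra.
Qed.
End Chain.

(** * Injectivity by transport along the chain g + t k *)

(** With this default value, a positive lower bound on the real part of a quotient already excludes
    a zero denominator; [chain_A] exploits this. *)
Lemma Cdiv_0_r z : (z / 0)%C = RtoC 0.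
Proof.
  unfold Cdiv, Cinv, RtoC, Cmult; simpl. unfold Rdiv. apply injective_projections; simpl; ring.
Qed.

Lemma exp_le x y : x <= y -> exp x <= exp y.
Proof. intros [H| ->]; [apply Rlt_le, exp_increasing|]; lra. Qed.

(** A discrete Gronwall inequality: a step that contracts by 1 - d b/(1 + t) remains under the curve
    (1 + t)^(-b). Both ingredients are 1 + x <= e^x. *)
Lemma Rpower_decay t d b : 0 <= t -> 0 <= d -> 0 < b ->
  Rpower (1 + t) (- b) * (1 - d * (b / (1 + t))) <= Rpower (1 + (t + d)) (- b).
Proof.
  intros Ht Hd Hb. unfold Rpower.
  assert (Q : 0 <= d / (1 + t)).
  { apply Rmult_le_pos; auto. apply Rlt_le, Rinv_0_lt_compat. lra. }
  assert (L : ln (1 + (t + d)) <= ln (1 + t) + d / (1 + t)).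
  { replace (1 + (t + d)) with ((1 + t) * (1 + d / (1 + t))) by (field; lra).
    rewrite ln_mult by lra. apply Rplus_le_compat_l. rewrite <- (ln_exp (d / (1 + t))) at 2.
    apply ln_le; [lra|]. apply exp_ineq1_le. }
  apply Rle_trans with (exp (- b * ln (1 + t) + - (d * (b / (1 + t))))).
  - rewrite exp_plus. apply Rmult_le_compat_l; [apply Rlt_le, exp_pos|].
    pose proof (exp_ineq1_le (- (d * (b / (1 + t))))). lra.
  - apply exp_le. replace (d * (b / (1 + t))) with (b * (d / (1 + t))) by (field; lra). nra.
Qed.

Lemma Rpower_small b del : 0 < b -> 0 < del -> exists T, 0 <= T /\
  forall t, T <= t -> Rpower (1 + t) (- b) < del.
Proof.
  intros Hb Hd. exists (exp (- ln del / b)). split; [apply Rlt_le, exp_pos|].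
  intros t Ht. unfold Rpower. rewrite <- (exp_ln del) by auto. apply exp_increasing.
  assert (- ln del / b < ln (1 + t)).
  { rewrite <- (ln_exp (- ln del / b)). apply ln_increasing; [apply exp_pos|].
    lra. }
  apply Rmult_lt_compat_l with (r := b) in H; auto.
  replace (b * (- ln del / b)) with (- ln del) in H by (field; lra). lra.
Qed.

Lemma Rpower_neg_le1 t b : 0 <= t -> 0 < b -> 0 < Rpower (1 + t) (- b) <= 1.
Proof.
  intros Ht Hb. unfold Rpower. split; [apply exp_pos|].
  apply Rle_trans with (exp 0); [apply exp_le|rewrite exp_0; lra].
  pose proof (ln_le 1 (1 + t) ltac:(lra) ltac:(lra)) as L. rewrite ln_1 in L. nra.
Qed.

(** With a = d Re X and c = d^2 |X|^2, the difference of the squares of the two sides is c + (a -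
    c)^2; the bound on a makes the right side nonnegative. *)
Lemma Cmod_1_minus_le (X : C) d : 0 <= d -> d * Re X <= 1 / 2 ->
  Cmod (1 - RtoC d * X)%C <= 1 - d * Re X + d * d * (Cmod X * Cmod X).
Proof.
  intros Hd Ha.
  set (a := d * Re X) in *. set (c := d * d * (Cmod X * Cmod X)).
  assert (Hc : 0 <= c) by (unfold c; pose proof (Cmod_ge_0 X); apply Rmult_le_pos; nra).
  apply Rsqr_incr_0_var; [|lra]. unfold Rsqr. rewrite Cmod_sq.
  assert (E : Re (1 - RtoC d * X)%C * Re (1 - RtoC d * X)%C + Im (1 - RtoC d * X)%C * Im (1 - RtoC d * X)%C
    = 1 - 2 * a + c).
  { unfold c, a. rewrite Cmod_sq. destruct X as [p q].
    unfold Re, Im, Cminus, Cplus, Copp, Cmult, RtoC; simpl. ring. }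
  rewrite E. nra.
Qed.

Section ChainInjective.
Variables (g k : C -> C) (r b : R).
Hypothesis Hg : hol g.
Hypothesis Hk : hol k.
Hypothesis g0 : g (RtoC 0) = RtoC 0.
Hypothesis k0 : k (RtoC 0) = RtoC 0.
Hypothesis Hr : 0 < r < 1.
Hypothesis Hb : 0 < b.
Notation g' := (C_derive g).
Notation k' := (C_derive k).
Hypothesis k'0 : k' (RtoC 0) <> RtoC 0.
Hypothesis A0 : forall t, 0 <= t -> (g' (RtoC 0) + RtoC t * k' (RtoC 0))%C <> RtoC 0.
(** The solution of rho' = - b rho/(1 + t), to which [Hdecay] compares |z|. The quotient in [Hdecay]
    degenerates at z = 0, so [A0] treats that point. *)
Let rho t := r * Rpower (1 + t) (- b).
Hypothesis Hdecay : forall z t, 0 <= t -> z <> RtoC 0 -> Cmod z <= rho t ->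
  b / (1 + t) < Re (k z / (z * (g' z + RtoC t * k' z)))%C.

Lemma chain_rho t : 0 <= t -> 0 < rho t <= r.
Proof. intros Ht. pose proof (Rpower_neg_le1 t b Ht Hb). unfold rho. nra. Qed.

Lemma chain_inD z t : 0 <= t -> Cmod z <= rho t -> inD z.
Proof. intros Ht Hz. pose proof (chain_rho t Ht). unfold inD. lra. Qed.

Lemma chain_A z t : 0 <= t -> Cmod z <= rho t -> (g' z + RtoC t * k' z)%C <> RtoC 0.
Proof.
  intros Ht Hz. destruct (Ceq_dec z (RtoC 0)) as [->|N]; [now apply A0|].
  intros E. pose proof (Hdecay z t Ht N Hz) as H. rewrite E, Cmult_0_r, Cdiv_0_r in H.
  rewrite re_RtoC in H. assert (0 < b / (1 + t)) by (apply Rdiv_lt_0_compat; lra). lra.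
Qed.

Lemma chain_forward z t eta : 0 <= t -> Cmod z <= rho t -> 0 < eta -> exists del, 0 < del /\
  forall d, 0 < d < del -> exists w, Cmod w <= rho (t + d) /\ Cmod (w - z)%C < eta /\
    (g w + RtoC (t + d) * k w)%C = (g z + RtoC t * k z)%C.
Proof.
  intros Ht Hz He. destruct (Ceq_dec z (RtoC 0)) as [->|N].
  - exists 1. split; [lra|]. intros d Hd. exists (RtoC 0).
    replace (RtoC 0 - 0)%C with (RtoC 0) by ring. rewrite Cmod_0.
    pose proof (chain_rho (t + d) ltac:(lra)). repeat split; try lra. rewrite k0. ring.
  - pose proof (chain_A z t Ht Hz) as HA. pose proof (Hdecay z t Ht N Hz) as HX.
    set (A := (g' z + RtoC t * k' z)%C) in *. set (X := (k z / (z * A))%C) in *.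
    pose proof (proj1 (Cmod_gt_0 _) N) as Pz.
    set (bt := b / (1 + t)) in *. assert (Pb : 0 < bt) by (apply Rdiv_lt_0_compat; lra).
    (* The exact step is close to z (1 - d X). Half of the gap between Re X and b/(1 + t) pays for
       its error, the other half for the second-order term of |1 - d X|. *)
    set (eps := Cmod z * ((Re X - bt) / 2)).
    assert (Pe : 0 < eps) by (apply Rmult_lt_0_compat; lra).
    destruct (chain_step g k Hg Hk z t eps) as [d0 [Hd0 St]]; auto.
    { eapply chain_inD; eauto. }
    fold A in St.
    pose proof (Cmod_ge_0 X) as PX.
    destruct (eps_ratio ((Re X - bt) / 2) (Cmod X * Cmod X)) as [d1 [D1 [D1' _]]]; [lra|nra|].
    destruct (eps_ratio (1 / 2) (Re X)) as [d2 [D2 [D2' _]]]; [lra|lra|].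
    destruct (eps_ratio (eta / 2) (Cmod z * Cmod X + eps)) as [d3 [D3 [D3' _]]]; [lra|nra|].
    exists (Rmin (Rmin d0 d1) (Rmin d2 d3)). split; [repeat apply Rmin_glb_lt; auto|].
    intros d [Hd Hd'].
    pose proof (Rmin_l (Rmin d0 d1) (Rmin d2 d3)). pose proof (Rmin_r (Rmin d0 d1) (Rmin d2 d3)).
    pose proof (Rmin_l d0 d1). pose proof (Rmin_r d0 d1). pose proof (Rmin_l d2 d3). pose proof (Rmin_r d2 d3).
    destruct (St d ltac:(lra)) as [w [Hw Ew]]. exists w.
    assert (EX : (k z / A)%C = (z * X)%C) by (unfold X; field; auto).
    rewrite EX in Hw.
    assert (a1 : d * Re X <= 1 / 2) by (apply Rle_trans with (d2 * Re X); [apply Rmult_le_compat_r; lra|lra]).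
    assert (a2 : d * (Cmod X * Cmod X) <= (Re X - bt) / 2).
    { apply Rle_trans with (d1 * (Cmod X * Cmod X)); [apply Rmult_le_compat_r; nra|lra]. }
    assert (a3 : d * (Cmod z * Cmod X + eps) <= eta / 2).
    { apply Rle_trans with (d3 * (Cmod z * Cmod X + eps)); [apply Rmult_le_compat_r; nra|lra]. }
    split; [|split; auto].
    + assert (B : Cmod w <= Cmod z * (1 - d * bt)).
      { pose proof (Cmod_triangle_sub w (z - RtoC d * (z * X))%C) as T.
        replace (Cmod (z - RtoC d * (z * X))%C) with (Cmod z * Cmod (1 - RtoC d * X)%C) in T
          by (rewrite <- Cmod_mult; f_equal; ring).
        pose proof (Cmod_1_minus_le X d ltac:(lra) a1) as Q.
        assert (Cmod z * Cmod (1 - RtoC d * X)%C <= Cmod z * (1 - d * Re X + d * ((Re X - bt) / 2))).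
        { apply Rmult_le_compat_l; [lra|]. eapply Rle_trans; [apply Q|].
          rewrite Rmult_assoc. apply Rplus_le_compat_l. apply Rmult_le_compat_l; lra. }
        unfold eps in Hw. nra. }
      eapply Rle_trans; [apply B|]. unfold rho.
      assert (P1 : 0 <= 1 - d * bt) by nra.
      apply Rle_trans with (r * Rpower (1 + t) (- b) * (1 - d * bt)).
      { apply Rmult_le_compat_r; auto. }
      rewrite Rmult_assoc. apply Rmult_le_compat_l; [lra|]. apply Rpower_decay; lra.
    + replace (w - z)%C with ((w - (z - RtoC d * (z * X))) - RtoC d * (z * X))%C by ring.
      eapply Rle_lt_trans; [apply Cmod_minus_le|]. rewrite !Cmod_mult, Cmod_Rpos by lra. nra.
Qed.

Let collide t x y := Cmod x <= rho t /\ Cmod y <= rho t /\ x <> y /\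
  (g x + RtoC t * k x)%C = (g y + RtoC t * k y)%C.

(* With [g + t k] close to an affine map around [z], colliding points there force
   [g' z + t k' z] to be small. *)
Lemma chain_collide_small z eps : inD z -> 0 < eps -> exists del, 0 < del /\
  forall t0 t x y, 0 <= t -> Cmod (x - z)%C < del -> Cmod (y - z)%C < del -> collide t x y ->
    Cmod (g' z + RtoC t0 * k' z)%C <= eps * (1 + t) + Rabs (t - t0) * Cmod (k' z).
Proof.
  intros Hz He.
  destruct (hol_strict_der g z eps Hg Hz He) as [d1 [Hd1 H1]].
  destruct (hol_strict_der k z eps Hk Hz He) as [d2 [Hd2 H2]].
  exists (Rmin d1 d2). split; [now apply Rmin_glb_lt|].
  intros t0 t x y Ht Hx Hy [_ [_ [N E]]].
  pose proof (Rmin_l d1 d2). pose proof (Rmin_r d1 d2).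
  specialize (H1 x y ltac:(lra) ltac:(lra)). specialize (H2 x y ltac:(lra) ltac:(lra)).
  assert (P : 0 < Cmod (y - x)%C).
  { apply Cmod_gt_0. apply Cminus_eq_contra. auto. }
  apply Rmult_le_reg_r with (Cmod (y - x)%C); auto. rewrite <- Cmod_mult.
  replace ((g' z + RtoC t0 * k' z) * (y - x))%C with
    (((g y + RtoC t * k y) - (g x + RtoC t * k x)) - ((g y - g x - g' z * (y - x)) +
      (RtoC t * (k y - k x - k' z * (y - x)) + RtoC (t - t0) * (k' z * (y - x)))))%C
    by (rewrite RtoC_minus; ring).
  rewrite E.
  match goal with |- Cmod (?a - ?a - ?c)%C <= _ => replace (a - a - c)%C with (- c)%C by ring end.
  rewrite Cmod_opp.
  eapply Rle_trans; [apply Cmod_triangle|].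
  eapply Rle_trans; [apply Rplus_le_compat_l, Cmod_triangle|].
  rewrite !Cmod_mult, !Cmod_R, (Rabs_pos_eq t) by auto.
  assert (t * Cmod (k y - k x - k' z * (y - x))%C <= t * (eps * Cmod (y - x)%C))
    by (apply Rmult_le_compat_l; auto). lra.
Qed.

(** For large t the disc is so small around 0 that a collision would force |g'(0) + t k'(0)| <=
    |k'(0)| (1 + t)/8, which fails once t |k'(0)| dominates |g'(0)|. *)
Lemma chain_bounded : exists T, forall t x y, 0 <= t -> collide t x y -> t <= T.
Proof.
  pose proof (proj1 (Cmod_gt_0 _) k'0) as P.
  assert (D0 : inD (RtoC 0)) by (unfold inD; rewrite Cmod_0; lra).
  destruct (chain_collide_small (RtoC 0) (Cmod (k' (RtoC 0)) / 8) D0 ltac:(lra)) as [d [Hd H]].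
  destruct (Rpower_small b d Hb Hd) as [T [HT0 HT]].
  exists (Rmax T (2 * (Cmod (g' (RtoC 0)) / Cmod (k' (RtoC 0))) + 1)).
  intros t x y Ht Cxy. apply Rnot_lt_le. intros L.
  assert (L1 : T < t) by (eapply Rle_lt_trans; [apply Rmax_l|apply L]).
  assert (L2 : 2 * (Cmod (g' (RtoC 0)) / Cmod (k' (RtoC 0))) + 1 < t) by (eapply Rle_lt_trans; [apply Rmax_r|apply L]).
  specialize (HT t ltac:(lra)). pose proof (Rpower_neg_le1 t b Ht Hb).
  assert (Z : forall v : C, (v - 0)%C = v) by (intros; ring).
  assert (S : rho t < d) by (unfold rho; nra).
  specialize (H t t x y Ht). rewrite !Z, Rminus_diag, Rabs_R0 in H.
  specialize (H ltac:(destruct Cxy; lra) ltac:(destruct Cxy as [_ [? _]]; lra) Cxy).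
  set (K := k' (RtoC 0)) in *. set (G := g' (RtoC 0)) in *.
  pose proof (Cmod_triangle_sub (RtoC t * K)%C (G + RtoC t * K)%C) as Q.
  replace (RtoC t * K - (G + RtoC t * K))%C with (- G)%C in Q by ring.
  rewrite Cmod_opp, Cmod_mult, Cmod_Rpos in Q by auto.
  assert (2 * Cmod G + Cmod K < t * Cmod K).
  { apply Rmult_lt_compat_r with (r := Cmod K) in L2; auto.
    replace ((2 * (Cmod G / Cmod K) + 1) * Cmod K) with (2 * Cmod G + Cmod K) in L2 by (field; lra). lra. }
  pose proof (Cmod_ge_0 G). nra.
Qed.

(** Ensures that limits of points in the discs at times increasing to ts lie in the disc at ts. *)
Lemma rho_lip t d : 0 <= t -> 0 <= d -> rho t <= rho (t + d) + d * b.
Proof.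
  intros Ht Hd. pose proof (Rpower_decay t d b Ht Hd Hb).
  pose proof (Rpower_neg_le1 t b Ht Hb).
  assert (b / (1 + t) <= b).
  { apply Rle_trans with (b / 1); [|lra]. apply Rmult_le_compat_l; [lra|]. apply Rinv_le_contravar; lra. }
  assert (0 < b / (1 + t)) by (apply Rdiv_lt_0_compat; lra).
  unfold rho.
  assert (Rpower (1 + t) (- b) * (d * (b / (1 + t))) <= 1 * (d * b)).
  { apply Rmult_le_compat; try lra. apply Rmult_le_pos; lra. apply Rmult_le_compat_l; lra. }
  assert (D : Rpower (1 + t) (- b) <= Rpower (1 + (t + d)) (- b) + d * b) by lra.
  assert (0 <= d * b) by (apply Rmult_le_pos; lra).
  apply Rmult_le_compat_l with (r := r) in D; [|lra]. nra.
Qed.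

(** Let ts be the supremum of the collision times. Colliding pairs with times tending to ts
    accumulate at some u, v in the disc at ts with equal values. They are distinct, since g + ts k
    is injective near u; so both can be pushed forward, giving a collision after ts. *)
Lemma chain_no_collision x y : ~ collide 0 x y.
Proof.
  intros Hxy. destruct chain_bounded as [T HT].
  destruct (completeness (fun t => 0 <= t /\ exists x y, collide t x y)) as [ts [U L]].
  { exists T. intros t [Ht [u [v Huv]]]. eapply HT; eauto. }
  { exists 0. split; [lra|eauto]. }
  assert (Hts : 0 <= ts) by (apply U; split; [lra|eauto]).
  assert (K : forall n : nat, exists q : R * C * C, let '(t, u, v) := q in
     0 <= t /\ ts - / (INR n + 1) < t <= ts /\ collide t u v).
  { intros n. assert (P : 0 < / (INR n + 1)) by (apply Rinv_0_lt_compat; pose proof (pos_INR n); lra).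
    apply NNPP. intros N. assert (ts <= ts - / (INR n + 1)); [|lra].
    apply L. intros t [Ht [u [v Huv]]]. apply Rnot_lt_le. intros Q. apply N.
    exists (t, u, v). repeat split; auto; try apply Huv. apply U. split; eauto. }
  apply seq_choice in K. destruct K as [q Hq].
  set (tn := fun n => fst (fst (q n))). set (un := fun n => snd (fst (q n))). set (vn := fun n => snd (q n)).
  assert (Hq' : forall n, 0 <= tn n /\ ts - / (INR n + 1) < tn n <= ts /\ collide (tn n) (un n) (vn n)).
  { intros n. specialize (Hq n). unfold tn, un, vn. destruct (q n) as [[t u] v]. exact Hq. }
  clear Hq.
  assert (Bu : forall n, Cmod (un n) <= r /\ Cmod (vn n) <= r).
  { intros n. destruct (Hq' n) as [Q1 [_ [Q2 [Q3 _]]]]. pose proof (chain_rho _ Q1). lra. }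
  destruct (C_subseq un r) as [s1 [u [S1 Lu]]]; [intros; apply Bu|].
  destruct (C_subseq (fun n => vn (s1 n)) r) as [s2 [v [S2 Lv]]]; [intros; apply Bu|].
  set (s := fun n => s1 (s2 n)).
  assert (Ss : forall n, (n <= s n)%nat). { intros n. specialize (S2 n). specialize (S1 (s2 n)). unfold s. lia. }
  assert (Lu' : tends (fun n => un (s n)) u) by exact (tends_subseq _ _ _ S2 Lu).
  assert (Lv' : tends (fun n => vn (s n)) v) by exact Lv.
  assert (Lt : tends (fun n => RtoC (tn (s n))) (RtoC ts)).
  { intros eps He. destruct (inv_INR_small eps He) as [N HN]. exists N. intros n Hn.
    specialize (HN (s n) ltac:(specialize (Ss n); lia)). destruct (Hq' (s n)) as [_ [Q _]].
    rewrite <- RtoC_minus, Cmod_R. apply Rabs_def1; lra. }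
  assert (Rb : forall w wn, tends (fun n => wn (s n)) w -> (forall n, Cmod (wn n) <= rho (tn n)) -> Cmod w <= rho ts).
  { intros w wn Lw Hw. apply le_epsilon. intros eps He.
    destruct (Lw (eps / 2)) as [N1 H1]; [lra|].
    destruct (eps_ratio (eps / 2) b) as [e1 [E1 [E2 _]]]; [lra|lra|].
    destruct (inv_INR_small e1 E1) as [N2 H2].
    set (n := (N1 + N2)%nat). specialize (H1 n ltac:(lia)).
    specialize (H2 (s n) ltac:(specialize (Ss n); lia)). destruct (Hq' (s n)) as [Q0 [Q _]].
    specialize (Hw (s n)).
    pose proof (rho_lip (tn (s n)) (ts - tn (s n)) Q0 ltac:(lra)) as RL.
    replace (tn (s n) + (ts - tn (s n))) with ts in RL by ring.
    pose proof (Cmod_triangle_sub w (wn (s n))) as T3. rewrite Cmod_sub_sym in T3.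
    assert ((ts - tn (s n)) * b <= e1 * b) by (apply Rmult_le_compat_r; lra). lra. }
  assert (Ru : Cmod u <= rho ts) by (apply (Rb u un); auto; intros n; apply Hq').
  assert (Rv : Cmod v <= rho ts) by (apply (Rb v vn); auto; intros n; apply Hq').
  pose proof (chain_inD u ts Hts Ru) as Du. pose proof (chain_inD v ts Hts Rv) as Dv.
  assert (E : (g u + RtoC ts * k u)%C = (g v + RtoC ts * k v)%C).
  { apply (tends_unique (fun n => g (un (s n)) + RtoC (tn (s n)) * k (un (s n)))%C).
    - apply tends_plus; [apply tends_ctn; auto; now apply hol_ctn|].
      apply tends_mult; auto. apply tends_ctn; auto; now apply hol_ctn.
    - intros eps He.
      assert (W : tends (fun n => g (vn (s n)) + RtoC (tn (s n)) * k (vn (s n)))%C (g v + RtoC ts * k v)%C).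
      { apply tends_plus; [apply tends_ctn; auto; now apply hol_ctn|].
        apply tends_mult; auto. apply tends_ctn; auto; now apply hol_ctn. }
      destruct (W eps He) as [N HN]. exists N. intros n Hn. specialize (HN n Hn).
      destruct (Hq' (s n)) as [_ [_ [_ [_ [_ Q]]]]]. rewrite Q. exact HN. }
  (* If the limits agreed, [chain_collide_small] would bound |A| by about |A|/2. *)
  assert (Nuv : u <> v).
  { intros Euv. subst v. pose proof (chain_A u ts Hts Ru) as HA.
    pose proof (proj1 (Cmod_gt_0 _) HA) as PA. set (A := Cmod (g' u + RtoC ts * k' u)%C) in *.
    destruct (eps_ratio (A / 4) (1 + ts)) as [e1 [E1 [E2 _]]]; [lra|lra|].
    destruct (chain_collide_small u e1 Du E1) as [d [Hd H]].
    destruct (eps_ratio (A / 4) (Cmod (k' u))) as [e2 [F1 [F2 _]]]; [lra|apply Cmod_ge_0|].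
    destruct (Lu' d Hd) as [N1 H1]. destruct (Lv' d Hd) as [N2 H2].
    destruct (inv_INR_small e2 F1) as [N3 H3].
    set (n := (N1 + N2 + N3)%nat). specialize (H1 n ltac:(lia)). specialize (H2 n ltac:(lia)).
    specialize (H3 (s n) ltac:(specialize (Ss n); lia)).
    destruct (Hq' (s n)) as [Q0 [Q1 Q2]].
    specialize (H ts (tn (s n)) (un (s n)) (vn (s n)) Q0 H1 H2 Q2). fold A in H.
    pose proof (Cmod_ge_0 (k' u)).
    assert (Rabs (tn (s n) - ts) * Cmod (k' u) <= e2 * Cmod (k' u)).
    { apply Rmult_le_compat_r; auto. apply Rabs_le; lra. }
    assert (e1 * (1 + tn (s n)) <= e1 * (1 + ts)) by (apply Rmult_le_compat_l; lra).
    lra. }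
  assert (Pd : 0 < Cmod (u - v)%C) by (apply Cmod_gt_0; now apply Cminus_eq_contra).
  (* Moving each point by less than a third of |u - v| keeps the two apart. *)
  destruct (chain_forward u ts (Cmod (u - v)%C / 3)) as [d1 [Hd1 F1]]; auto; [lra|].
  destruct (chain_forward v ts (Cmod (u - v)%C / 3)) as [d2 [Hd2 F2]]; auto; [lra|].
  set (d := Rmin d1 d2 / 2). assert (0 < Rmin d1 d2) by now apply Rmin_glb_lt.
  pose proof (Rmin_l d1 d2). pose proof (Rmin_r d1 d2).
  destruct (F1 d) as [u' [U1 [U2 U3]]]; [unfold d; lra|].
  destruct (F2 d) as [v' [V1 [V2 V3]]]; [unfold d; lra|].
  assert (ts + d <= ts); [|unfold d in *; lra].
  apply U. split; [unfold d; lra|]. exists u', v'. repeat split; auto; [|congruence].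
  intros <-.
  pose proof (Cmod_minus_le (u' - v)%C (u' - u)%C) as T3.
  replace (u' - v - (u' - u))%C with (u - v)%C in T3 by ring. lra.
Qed.

Theorem chain_injective x y : Cmod x <= r -> Cmod y <= r -> g x = g y -> x = y.
Proof.
  intros Hx Hy E. apply NNPP. intros N. apply (chain_no_collision x y).
  assert (R0 : rho 0 = r). { unfold rho, Rpower. rewrite Rplus_0_r, ln_1, Rmult_0_r, exp_0. ring. }
  unfold collide. rewrite R0. repeat split; auto. rewrite E. ring.
Qed.
End ChainInjective.

(** * Spirallike functions *)

Lemma inD_0 : inD (RtoC 0).
Proof. unfold inD. rewrite Cmod_0. lra. Qed.

Lemma alexander_prim f : alexander f = prim (quot0 f).
Proof. reflexivity. Qed.

Lemma classA_hol f : classA f -> hol f /\ f (RtoC 0) = RtoC 0 /\ der idC f (RtoC 0) (RtoC 1).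
Proof.
  intros [H1 [H2 H3]]. split; [now apply hol_analytic|]. split; auto. now apply is_derive_der.
Qed.

Lemma hol_quot0 f : classA f -> hol (quot0 f).
Proof. intros H. destruct (classA_hol f H) as [H1 [H2 H3]]. now apply (hol_quotz f (RtoC 1)). Qed.

Lemma quot0_0 f : quot0 f (RtoC 0) = RtoC 1.
Proof. unfold quot0. destruct (Ceq_dec (RtoC 0) (RtoC 0)); auto. now destruct n. Qed.

Lemma quot0_mul f z : f (RtoC 0) = RtoC 0 -> (z * quot0 f z)%C = f z.
Proof. apply quotz_mul. Qed.

Lemma alexander_der f z : classA f -> inD z -> der idC (alexander f) z (quot0 f z).
Proof. intros Hf Hz. rewrite alexander_prim. apply prim_der; auto. now apply hol_quot0. Qed.

Lemma alexander_hol f : classA f -> hol (alexander f).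
Proof. intros Hf z Hz. eexists. now apply alexander_der. Qed.

Lemma alexander_0 f : alexander f (RtoC 0) = RtoC 0.
Proof. rewrite alexander_prim. apply prim_0. Qed.

Lemma alexander_classA f : classA f -> classA (alexander f).
Proof.
  intros Hf. split; [|split].
  - apply hol_analytic. now apply alexander_hol.
  - apply alexander_0.
  - apply is_derive_der. rewrite <- (quot0_0 f). apply alexander_der; auto. apply inD_0.
Qed.

(** The decay estimate is uniform only on closed subdiscs, whence r < 1; the bound r > 1/2 makes the
    exponent 1 - 1/(2 r) of the spirallike case positive. *)
Lemma alexander_classS f : classA f ->
  (forall r, 1 / 2 < r < 1 -> forall x y, Cmod x <= r -> Cmod y <= r ->
     alexander f x = alexander f y -> x = y) -> classS (alexander f).
Proof.
  intros Hf H. split; [now apply alexander_classA|]. intros z w Hz Hw E. unfold inD in *.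
  assert (M1 : Rmax (1 / 2) (Rmax (Cmod z) (Cmod w)) < 1) by (repeat apply Rmax_lub_lt; lra).
  pose proof (Rmax_l (1 / 2) (Rmax (Cmod z) (Cmod w))).
  pose proof (Rmax_r (1 / 2) (Rmax (Cmod z) (Cmod w))).
  pose proof (Rmax_l (Cmod z) (Cmod w)). pose proof (Rmax_r (Cmod z) (Cmod w)).
  set (m := Rmax (1 / 2) (Rmax (Cmod z) (Cmod w))) in *.
  apply (H ((m + 1) / 2)); auto; lra.
Qed.

(* [z f'(z) / f(z)], with its value [1] at the removable singularity. *)
Definition logd (f : C -> C) (z : C) : C := (1 + z * C_derive (quot0 f) z / quot0 f z)%C.

Section Spirallike.
Variables (alpha lambda : R) (f : C -> C).
Hypothesis Hlam : lambda < 1.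
Hypothesis Hcos : 0 < cos alpha.
Hypothesis Hf : starlike_al alpha lambda f.

Lemma spiral_quot0_neq0 z : inD z -> quot0 f z <> RtoC 0.
Proof.
  intros Hz. destruct Hf as [HA [Hn _]]. unfold quot0. destruct (Ceq_dec z (RtoC 0)) as [E|N].
  - apply C1_nz.
  - intros E. apply (Hn z Hz N). transitivity (z * (f z / z))%C; [field; auto|]. rewrite E. ring.
Qed.

Lemma spiral_hol_logd : hol (logd f).
Proof.
  destruct Hf as [HA _]. pose proof (hol_quot0 f HA) as Hq. intros z Hz. unfold logd.
  eexists. apply der_plus; [apply der_const|].
  apply der_div; [now apply spiral_quot0_neq0| |now apply hol_der].
  apply der_mult; [apply der_id|]. apply hol_der; auto. now apply hol_C_derive.
Qed.

Lemma logd_0 : logd f (RtoC 0) = RtoC 1.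
Proof. unfold logd. rewrite quot0_0. field. Qed.

Lemma spiral_der z : inD z -> C_derive f z = (quot0 f z * logd f z)%C.
Proof.
  intros Hz. destruct Hf as [HA _]. pose proof (hol_quot0 f HA) as Hq.
  destruct (classA_hol f HA) as [_ [f0 _]].
  apply C_derive_eq. apply (der_ext _ (fun z => z * quot0 f z)%C _ _ _ 1); [lra| |].
  { intros w _. now apply quot0_mul. }
  eapply der_eq; [apply der_mult; [apply der_id|apply hol_der; eauto]|].
  unfold logd. cbv beta. field. now apply spiral_quot0_neq0.
Qed.

Lemma spiral_Re z : inD z -> lambda * cos alpha < Re (cexpi alpha * logd f z)%C.
Proof.
  intros Hz. destruct (Ceq_dec z (RtoC 0)) as [->|N].
  - rewrite logd_0, Cmult_1_r. unfold cexpi, Re; simpl. nra.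
  - pose proof Hf as [HA [Hn Hr]]. destruct (classA_hol f HA) as [Hh [f0 _]].
    assert (D : is_derive f z (C_derive f z)) by (apply is_derive_der; now apply hol_der).
    specialize (Hr z _ Hz N D). rewrite spiral_der in Hr by auto.
    replace (z * (quot0 f z * logd f z) / f z)%C with (logd f z) in Hr; [lra|].
    rewrite <- (quot0_mul f z f0). field. split; auto. now apply spiral_quot0_neq0.
Qed.

Let m := (1 - lambda) * cos alpha.
Let mu : C := (RtoC m * cexpi (- alpha))%C.

Lemma spiral_m_pos : 0 < m.
Proof. unfold m. apply Rmult_lt_0_compat; lra. Qed.

Lemma spiral_mu_neq0 : mu <> RtoC 0.
Proof.
  pose proof spiral_m_pos. intros E. apply (f_equal Re) in E.
  unfold mu, cexpi, Re, Cmult, RtoC in E; simpl in E. rewrite cos_neg, sin_neg in E.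
  assert (0 < m * cos alpha) by (apply Rmult_lt_0_compat; auto). lra.
Qed.

(** The normalisation p(0) = 1, Re p > 0: since e^(i alpha) mu = m is real, e^(i alpha) P = e^(i
    alpha) + m (p - 1), and m Re p = Re (e^(i alpha) P) - lambda cos(alpha). *)
Definition caratheodory (z : C) : C := (1 + (logd f z - 1) / mu)%C.

Lemma caratheodory_Re z : inD z -> 0 < Re (caratheodory z).
Proof.
  intros Hz. pose proof (spiral_Re z Hz) as H. pose proof spiral_m_pos as Pm.
  assert (E : (cexpi alpha * logd f z)%C = (cexpi alpha + RtoC m * (caratheodory z - 1))%C).
  { replace (logd f z) with (1 + mu * (caratheodory z - 1))%C
      by (unfold caratheodory; field; apply spiral_mu_neq0).
    replace (cexpi alpha * (1 + mu * (caratheodory z - 1)))%C with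
      (cexpi alpha + (cexpi alpha * mu) * (caratheodory z - 1))%C by ring.
    replace (cexpi alpha * mu)%C with (RtoC m); auto.
    unfold mu. pose proof (sin2_cos2 alpha) as S. unfold Rsqr in S.
    unfold cexpi, Cmult, RtoC; simpl. rewrite cos_neg, sin_neg.
    apply injective_projections; simpl; [|ring].
    transitivity (m * 1); [ring|]. rewrite <- S. ring. }
  rewrite E, re_plus in H. unfold Cminus in H. rewrite re_scal_l, re_plus, re_opp, re_RtoC in H.
  change (Re (cexpi alpha)) with (cos alpha) in H.
  assert (0 < m * Re (caratheodory z)) by (unfold m in *; lra).
  apply Rmult_lt_reg_l with m; lra.
Qed.

Definition schwarz_fun (z : C) : C := ((caratheodory z - 1) / (caratheodory z + 1))%C.

Lemma caratheodory_p1 z : inD z -> (caratheodory z + 1)%C <> RtoC 0.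
Proof.
  intros Hz E. pose proof (caratheodory_Re z Hz). apply (f_equal Re) in E.
  rewrite re_plus, !re_RtoC in E. lra.
Qed.

Lemma schwarz_fun_le z : inD z -> Cmod (schwarz_fun z) <= Cmod z.
Proof.
  assert (Hc : hol caratheodory).
  { intros w Hw. unfold caratheodory. eexists. apply der_plus; [apply der_const|].
    apply der_div; [apply spiral_mu_neq0| |apply der_const].
    apply der_minus; [apply hol_der; auto; apply spiral_hol_logd|apply der_const]. }
  apply schwarz_lemma.
  - intros w Hw. unfold schwarz_fun. eexists.
    apply der_div; [now apply caratheodory_p1| |].
    + apply der_minus; [apply hol_der; auto|apply der_const].
    + apply der_plus; [apply hol_der; auto|apply der_const].
  - unfold schwarz_fun, caratheodory. rewrite logd_0.
    pose proof spiral_mu_neq0. field. split; auto.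
    replace (mu + mu)%C with (2 * mu)%C by ring.
    apply Cmult_neq_0; auto. intros E. apply RtoC_inj in E. lra.
  - intros w Hw. unfold schwarz_fun. rewrite Cmod_div by now apply caratheodory_p1.
    pose proof (proj1 (Cmod_gt_0 _) (caratheodory_p1 w Hw)) as P.
    apply Rmult_le_reg_r with (Cmod (caratheodory w + 1)%C); auto.
    unfold Rdiv. rewrite Rmult_assoc, Rinv_l, Rmult_1_r, Rmult_1_l by lra.
    apply Rsqr_incr_0_var; [|lra]. unfold Rsqr. rewrite !Cmod_sq.
    pose proof (caratheodory_Re w Hw). unfold Cminus.
    rewrite !re_plus, !im_plus, re_opp, im_opp, re_RtoC, im_RtoC. nra.
Qed.

Lemma schwarz_fun_neq1 z : inD z -> (1 - schwarz_fun z)%C <> RtoC 0.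
Proof.
  intros Hz E. pose proof (schwarz_fun_le z Hz) as H. unfold inD in Hz.
  replace (schwarz_fun z) with (RtoC 1) in H.
  - rewrite Cmod_1 in H. lra.
  - transitivity (1 - (1 - schwarz_fun z))%C; [rewrite E|]; ring.
Qed.

Lemma logd_schwarz z : inD z -> logd f z = (1 + 2 * mu * schwarz_fun z / (1 - schwarz_fun z))%C.
Proof.
  intros Hz. pose proof (schwarz_fun_neq1 z Hz) as N. pose proof (caratheodory_p1 z Hz) as N1.
  pose proof spiral_mu_neq0 as Nm.
  transitivity (1 + mu * (caratheodory z - 1))%C.
  { unfold caratheodory. field. auto. }
  assert (E : (1 - schwarz_fun z)%C = (2 / (caratheodory z + 1))%C) by (unfold schwarz_fun; field; auto).
  rewrite E. unfold schwarz_fun. field. auto.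
Qed.

Hypothesis Hm : m <= 1 / 2.
Hypothesis Hsin : sin alpha <> 0.

(** This is z (g' + t k')/k for g = J[f] and k = f/(1 - 2 mu), because z g' = f and z k' = P k. *)
Let B t z : C := (1 - 2 * mu + RtoC t * logd f z)%C.

(** The imaginary part is 2 m sin(alpha). For alpha = 0 and m = 1/2 the number itself would vanish
    at t = 0. *)
Lemma spiral_base_Im t : Im (1 - 2 * mu + RtoC t)%C <> 0.
Proof.
  pose proof spiral_m_pos.
  unfold mu, cexpi, Cminus, Cplus, Copp, Cmult, RtoC, Im; simpl. rewrite cos_neg, sin_neg.
  replace (0 + - (2 * (m * - sin alpha + 0 * cos alpha) + 0 * (m * cos alpha - 0 * - sin alpha)) + 0)
    with (2 * m * sin alpha) by ring.
  intros E. apply Rmult_integral in E. destruct E; [lra|auto].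
Qed.

(** The point at which the threshold m <= 1/2 enters. *)
Lemma Cmod_2mu : Cmod (2 * mu)%C <= 1.
Proof.
  pose proof spiral_m_pos. unfold mu. rewrite !Cmod_mult, !Cmod_Rpos by lra.
  replace (Cmod (cexpi (- alpha))) with 1; [lra|].
  unfold Cmod, cexpi; simpl. rewrite !Rmult_1_r.
  pose proof (sin2_cos2 (- alpha)) as S. unfold Rsqr in S. rewrite Rplus_comm, S. symmetry. apply sqrt_1.
Qed.

(* With [w] the Schwarz function and [T = 1 + t]: [B - T = 2 mu (T w - 1) / (1 - w)], and
   [|T w - 1| <= T |1 - w|] amounts to [(T - 1) (T + 1 - 2 T Re w) >= 0]. *)
Lemma spiral_disc t z : inD z -> 0 <= t -> 2 * (1 + t) * Cmod z < 2 + t ->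
  Cmod (B t z - RtoC (1 + t))%C <= 1 + t /\ B t z <> RtoC 0.
Proof.
  intros Hz Ht Hc. set (w := schwarz_fun z). pose proof (schwarz_fun_neq1 z Hz) as N.
  pose proof (schwarz_fun_le z Hz) as Sw. fold w in N, Sw.
  assert (E : (B t z - RtoC (1 + t))%C = (2 * mu * ((RtoC (1 + t) * w - 1) / (1 - w)))%C).
  { unfold B. rewrite logd_schwarz by auto. fold w. rewrite RtoC_plus. field. auto. }
  assert (Q : Cmod (RtoC (1 + t) * w - 1)%C * Cmod (RtoC (1 + t) * w - 1)%C =
     (1 + t) * (1 + t) * (Cmod (1 - w)%C * Cmod (1 - w)%C) - t * (2 + t - 2 * (1 + t) * Re w)).
  { rewrite !Cmod_sq. destruct w as [a b].
    unfold Re, Im, Cminus, Cplus, Copp, Cmult, RtoC; simpl. ring. }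
  pose proof (proj1 (Cmod_gt_0 _) N) as P.
  assert (Rw : Re w <= Cmod z). { pose proof (re_le_Cmod w). pose proof (Rle_abs (Re w)). lra. }
  pose proof (Cmod_ge_0 (RtoC (1 + t) * w - 1)%C) as P1.
  rewrite E, Cmod_mult, Cmod_div by auto. pose proof Cmod_2mu as M2. pose proof (Cmod_ge_0 (2 * mu)%C) as M0.
  set (X := Cmod (RtoC (1 + t) * w - 1)%C) in *. set (Y := Cmod (1 - w)%C) in *.
  assert (D : X / Y * Y = X) by (field; lra).
  assert (PX : 0 <= X / Y) by (apply Rmult_le_pos; auto; apply Rlt_le, Rinv_0_lt_compat; auto).
  (* At t = 0 the quotient X/Y is 1 and the estimate is not strict, so B <> 0 must come from the
     imaginary part. *)
  destruct (Req_dec t 0) as [->|Nt].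
  - split.
    + assert (X = Y). { apply Rsqr_inj; try lra. unfold Rsqr. rewrite Q. ring. }
      assert (X / Y = 1) by (rewrite H; field; lra). rewrite H0. lra.
    + intros Z. apply (spiral_base_Im 0). unfold B in Z. rewrite Cmult_0_l in Z.
      rewrite Z. reflexivity.
  - assert (L : X < (1 + t) * Y).
    { apply Rsqr_incrst_0; [|lra|nra]. unfold Rsqr. rewrite Q.
      assert (0 < t * (2 + t - 2 * (1 + t) * Re w)) by (apply Rmult_lt_0_compat; nra). lra. }
    assert (L2 : X / Y < 1 + t). { apply Rmult_lt_reg_r with Y; auto. lra. }
    assert (L3 : Cmod (2 * mu)%C * (X / Y) < 1 + t) by nra.
    split; [lra|]. intros Z.
    assert (E2 : Cmod (B t z - RtoC (1 + t))%C = Cmod (2 * mu)%C * (X / Y)).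
    { rewrite E, Cmod_mult, Cmod_div by auto. reflexivity. }
    rewrite Z in E2. replace (0 - RtoC (1 + t))%C with (- RtoC (1 + t))%C in E2 by ring.
    rewrite Cmod_opp, Cmod_Rpos in E2 by lra. lra.
Qed.

(** The circle passes through 0, so inversion maps the disc to a half-plane. *)
Lemma Re_inv_disc (b : C) T : 0 < T -> b <> RtoC 0 -> Cmod (b - RtoC T)%C <= T -> / (2 * T) <= Re (/ b)%C.
Proof.
  intros HT Nb H. pose proof (proj1 (Cmod_gt_0 _) Nb) as P.
  assert (Q : Cmod (b - RtoC T)%C * Cmod (b - RtoC T)%C <= T * T).
  { apply Rmult_le_compat; auto using Cmod_ge_0. }
  rewrite Cmod_sq in Q.
  assert (P2 : 0 < Cmod b * Cmod b) by now apply Rmult_lt_0_compat.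
  rewrite Cmod_sq in P2. destruct b as [x y].
  unfold Re, Im, Cinv, Cminus, Cplus, Copp, RtoC in *; simpl in *.
  rewrite !Rmult_1_r.
  apply Rmult_le_reg_r with (2 * T * (x * x + y * y)); [nra|].
  replace (/ (2 * T) * (2 * T * (x * x + y * y))) with (x * x + y * y) by (field; lra).
  replace (x / (x * x + y * y) * (2 * T * (x * x + y * y))) with (2 * T * x) by (field; lra).
  nra.
Qed.

(* Weighted AM-GM, [T^(1-b) <= (1-b) T + b]. *)
Lemma Rpower_weighted T b : 0 < T -> 0 <= b <= 1 -> T * Rpower T (- b) <= (1 - b) * T + b.
Proof.
  intros HT Hb. set (x := ln T). set (Y := exp ((1 - b) * x)).
  assert (ET : T = Y * exp (b * x)).
  { unfold Y. rewrite <- exp_plus. replace ((1 - b) * x + b * x) with x by ring. symmetry. now apply exp_ln. }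
  assert (E1 : 1 = Y * exp (- (1 - b) * x)).
  { unfold Y. rewrite <- exp_plus. replace ((1 - b) * x + - (1 - b) * x) with 0 by ring. now rewrite exp_0. }
  assert (EY : T * Rpower T (- b) = Y).
  { rewrite ET at 1. unfold Rpower. fold x. rewrite Rmult_assoc, <- exp_plus.
    replace (b * x + - b * x) with 0 by ring. rewrite exp_0. ring. }
  assert (PY : 0 < Y) by apply exp_pos.
  pose proof (exp_ineq1_le (b * x)) as I1. pose proof (exp_ineq1_le (- (1 - b) * x)) as I2.
  assert (J1 : Y * (1 + b * x) <= T) by (rewrite ET; apply Rmult_le_compat_l; lra).
  assert (J2 : Y * (1 + - (1 - b) * x) <= 1).
  { apply Rle_trans with (Y * exp (- (1 - b) * x)); [apply Rmult_le_compat_l; lra|lra]. }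
  rewrite EY.
  assert ((1 - b) * (Y * (1 + b * x)) <= (1 - b) * T) by (apply Rmult_le_compat_l; lra).
  assert (b * (Y * (1 + - (1 - b) * x)) <= b * 1) by (apply Rmult_le_compat_l; lra).
  lra.
Qed.

Theorem spiral_alexander_classS : classS (alexander f).
Proof.
  pose proof Hf as [HA _]. pose proof (classA_hol f HA) as [Hh [f0 fd]].
  apply alexander_classS; auto. intros r Hr x y Hx Hy.
  assert (N2 : (1 - 2 * mu)%C <> RtoC 0).
  { intros E. apply (spiral_base_Im 0). rewrite E, Cplus_0_r. reflexivity. }
  set (kap := (/ (1 - 2 * mu))%C).
  assert (Nk : kap <> RtoC 0).
  { intros E. apply C1_nz. transitivity ((1 - 2 * mu) * kap)%C; [unfold kap; field; auto|rewrite E; ring]. }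
  set (k := fun z => (kap * f z)%C).
  assert (Hk : hol k). { intros z Hz. eexists. apply der_scal. apply hol_der; eauto. }
  assert (k' : forall z, inD z -> C_derive k z = (kap * (quot0 f z * logd f z))%C).
  { intros z Hz. apply C_derive_eq. rewrite <- spiral_der by auto. apply der_scal. now apply hol_der. }
  assert (g' : forall z, inD z -> C_derive (alexander f) z = quot0 f z).
  { intros z Hz. apply C_derive_eq. now apply alexander_der. }
  (* Then b < 1/2, as the bound 1/(2 (1 + t)) of [Re_inv_disc] requires. With T = 1 + t the weighted
     inequality also gives 2 r ((1 - b) T + b) = T + 2 r - 1 < 2 + t, the condition of
     [spiral_disc]. *)
  set (b := 1 - / (2 * r)).
  assert (Ib : / (2 * r) * (2 * r) = 1) by (field; lra).
  assert (Pb : 0 < / (2 * r)) by (apply Rinv_0_lt_compat; lra).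
  assert (Hb : 0 < b < 1 / 2) by (unfold b; nra).
  pose proof (alexander_hol f HA) as Hg. pose proof (alexander_0 f) as g0.
  assert (k0 : k (RtoC 0) = RtoC 0) by (unfold k; rewrite f0; ring).
  apply (chain_injective (alexander f) k r b); auto; try lra.
  - rewrite k', quot0_0, logd_0 by apply inD_0. rewrite !Cmult_1_r. auto.
  - intros t Ht. rewrite k', g', quot0_0, logd_0 by apply inD_0.
    intros E. apply (spiral_base_Im t).
    replace (1 - 2 * mu + RtoC t)%C with ((1 - 2 * mu) * (1 + RtoC t * (kap * (1 * 1))))%C
      by (unfold kap; field; auto).
    rewrite E, Cmult_0_r. reflexivity.
  - intros z t Ht Nz Hz.
    pose proof (Rpower_neg_le1 t b Ht ltac:(lra)) as RP.
    assert (Dz : inD z). { unfold inD. nra. }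
    destruct (spiral_disc t z Dz Ht) as [S1 S2].
    { pose proof (Rpower_weighted (1 + t) b ltac:(lra) ltac:(lra)) as W.
      apply Rle_lt_trans with (2 * r * ((1 + t) * Rpower (1 + t) (- b))).
      - apply Rle_trans with (2 * (1 + t) * (r * Rpower (1 + t) (- b))); [|lra].
        apply Rmult_le_compat_l; lra.
      - apply Rle_lt_trans with (2 * r * ((1 - b) * (1 + t) + b)); [apply Rmult_le_compat_l; lra|].
        unfold b. nra. }
    rewrite k', g' by auto. pose proof (spiral_quot0_neq0 z Dz) as Nq.
    replace (k z / (z * (quot0 f z + RtoC t * (kap * (quot0 f z * logd f z)))))%C with (/ B t z)%C.
    + pose proof (Re_inv_disc _ (1 + t) ltac:(lra) S2 S1) as I.
      eapply Rlt_le_trans; [|apply I]. rewrite Rinv_mult.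
      apply Rmult_lt_compat_r; [apply Rinv_0_lt_compat; lra|lra].
    + unfold k. rewrite <- (quot0_mul f z f0).
      replace (quot0 f z + RtoC t * (kap * (quot0 f z * logd f z)))%C with (kap * (quot0 f z * B t z))%C.
      * field. auto.
      * unfold B, kap. field. auto.
Qed.
End Spirallike.

(** * The case alpha = 0 *)

Lemma der_one_sided (phi : R -> C) d K del : der RtoC phi 0 d -> 0 < del ->
  (forall s, 0 < s < del -> Re (phi s) <= Re (phi 0) + K * s) -> Re d <= K.
Proof.
  intros Hd Hdel H. apply le_epsilon. intros eps He.
  destruct (Hd eps He) as [d1 [Hd1 H1]].
  set (s := Rmin del d1 / 2). assert (0 < Rmin del d1) by now apply Rmin_glb_lt.
  pose proof (Rmin_l del d1). pose proof (Rmin_r del d1).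
  assert (Hs : 0 < s) by (unfold s; lra).
  specialize (H s ltac:(unfold s in *; lra)). specialize (H1 s).
  rewrite <- RtoC_minus, Rminus_0_r, Cmod_Rpos in H1 by lra. specialize (H1 ltac:(unfold s in *; lra)).
  pose proof (re_le_Cmod (phi s - phi 0 - d * RtoC s)%C) as Q.
  assert (E : Re (phi s - phi 0 - d * RtoC s)%C = Re (phi s) - Re (phi 0) - Re d * s).
  { unfold Cminus. rewrite !re_plus, !re_opp, re_scal_r. ring. }
  rewrite E in Q.
  pose proof (Rle_abs (- (Re (phi s) - Re (phi 0) - Re d * s))) as Q2. rewrite Rabs_Ropp in Q2.
  assert (Re d * s <= (K + eps) * s) by lra.
  apply Rmult_le_reg_r with s; auto.
Qed.

Lemma Cmod_ge_tends u l M : tends u l -> (forall n, M <= Cmod (u n)) -> M <= Cmod l.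
Proof.
  intros H HM. apply le_epsilon. intros eps He. destruct (H eps He) as [N HN].
  specialize (HN N (le_n N)). specialize (HM N).
  pose proof (Cmod_triangle_sub (u N) l). lra.
Qed.

Lemma Re_conj_le (x v : C) : Cmod v = 1 -> Re (x * Cconj v)%C <= Cmod x.
Proof.
  intros Hv. pose proof (re_le_Cmod (x * Cconj v)%C) as H. rewrite Cmod_mult, Cmod_conj, Hv in H.
  pose proof (Rle_abs (Re (x * Cconj v)%C)). lra.
Qed.

(* Jack's lemma: as [|v z| = 1], the last equation says [z v'(z) / v(z) = c]. *)
Lemma jack_lemma (v : C -> C) : hol v -> v (RtoC 0) = RtoC 0 -> (exists z, inD z /\ 1 <= Cmod (v z)) ->
  exists z c, inD z /\ Cmod (v z) = 1 /\ 1 <= c /\ (z * C_derive v z * Cconj (v z))%C = RtoC c.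
Proof.
  intros Hv v0 [z1 [Hz1 H1]].
  (* A point z of least modulus with |v| >= 1: thus |v| < 1 on the open disc of radius |z|, and
     Schwarz's lemma on that disc gives |v(t x)| <= t for |x| = |z|. *)
  destruct (min_attained (fun z => Cmod z <= Cmod z1 /\ 1 <= Cmod (v z)) Cmod (Cmod z1))
    as [z [[Hz Hvz] Hmin]].
  - exists z1. split; lra.
  - tauto.
  - intros u l Hu Hl. assert (Bl : Cmod l <= Cmod z1) by (eapply tends_bound; eauto; apply Hu).
    split; auto. apply (Cmod_ge_tends (fun n => v (u n))); [|apply Hu].
    apply tends_ctn; auto. apply hol_ctn; auto. unfold inD in *. lra.
  - intros; apply Cmod_ge_0.
  - intros w _. apply ctn_RCmod. apply ctn_id.
  - unfold inD in Hz1. assert (Dz : inD z) by (unfold inD; lra).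
    set (r := Cmod z) in *.
    assert (Pr : 0 < r).
    { unfold r. apply Cmod_gt_0. intros E. rewrite E, v0, Cmod_0 in Hvz. lra. }
    assert (Lt1 : forall w, Cmod w < r -> Cmod (v w) < 1).
    { intros w Hw. apply Rnot_le_lt. intros Q. assert (r <= Cmod w); [|lra]. apply Hmin. split; lra. }
    assert (Sch : forall w, inD w -> Cmod (v (RtoC r * w)%C) <= Cmod w).
    { assert (In : forall w, inD w -> Cmod (RtoC r * w)%C < r).
      { intros w Hw. rewrite Cmod_mult, Cmod_Rpos by lra. unfold inD in Hw. nra. }
      intros w Hw. apply (schwarz_lemma (fun w => v (RtoC r * w)%C)); auto.
      - intros x Hx. eexists. apply (der_comp idC v).
        + apply der_scal. apply der_id.
        + apply hol_der; auto. specialize (In x Hx). unfold inD. lra.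
      - rewrite Cmult_0_r. auto.
      - intros x Hx. apply Rlt_le, Lt1, In, Hx. }
    assert (Nr : RtoC r <> RtoC 0) by (intros E; apply RtoC_inj in E; lra).
    assert (Rad : forall x t, Cmod x = r -> 0 <= t < 1 -> Cmod (v (RtoC t * x)%C) <= t).
    { intros x t Hx Ht.
      assert (M : Cmod (RtoC t * (x / RtoC r))%C = t).
      { rewrite Cmod_mult, Cmod_div, !Cmod_Rpos, Hx by (auto; lra). field. lra. }
      replace (RtoC t * x)%C with (RtoC r * (RtoC t * (x / RtoC r)))%C by (field; auto).
      rewrite <- M at 2. apply Sch. unfold inD. lra. }
    assert (Cir : forall x, Cmod x = r -> Cmod (v x) <= 1).
    { intros x Hx. apply le_epsilon. intros eps He.
      assert (Dx : inD x) by (unfold inD; lra).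
      destruct (hol_ctn v x Hv Dx eps He) as [d [Hd H]]. unfold idC in H.
      set (t := 1 - Rmin (d / 2) (1 / 2)).
      assert (0 < Rmin (d / 2) (1 / 2)) by (apply Rmin_glb_lt; lra).
      pose proof (Rmin_l (d / 2) (1 / 2)). pose proof (Rmin_r (d / 2) (1 / 2)).
      assert (T : 0 <= t < 1) by (unfold t; lra).
      specialize (Rad x t Hx T). specialize (H (RtoC t * x)%C).
      pose proof (Cmod_triangle_sub (v x) (v (RtoC t * x)%C)) as Q. rewrite (Cmod_sub_sym (v x)) in Q.
      assert (Cmod (RtoC t * x - x)%C < d).
      { replace (RtoC t * x - x)%C with (- (RtoC (1 - t) * x))%C by (rewrite RtoC_minus; ring).
        rewrite Cmod_opp, Cmod_mult, Cmod_Rpos, Hx by lra. unfold t. nra. }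
      specialize (H H4). lra. }
    assert (Vz : Cmod (v z) = 1) by (specialize (Cir z eq_refl); lra).
    set (V := v z) in *. set (c := (z * C_derive v z * Cconj V)%C).
    assert (VV : (V * Cconj V)%C = RtoC 1).
    { rewrite <- Cmod2_conj, Vz. rewrite pow1. reflexivity. }
    (* Radial derivative, moving inwards from z: |v((1 - s) z)| <= 1 - s with equality at s = 0. *)
    assert (C1 : Re (- c)%C <= - 1).
    { apply (der_one_sided (fun s => v (z + RtoC s * (- z)) * Cconj V)%C _ _ 1); [| lra|].
      - eapply der_eq.
        + apply der_mult; [|apply der_const]. apply (der_comp RtoC v); [apply der_segment|].
          replace (z + 0 * - z)%C with z by ring. now apply hol_der.
        + unfold c. cbv beta. ring.
      - intros s Hs. replace (z + RtoC s * - z)%C with (RtoC (1 - s) * z)%C by (rewrite RtoC_minus; ring).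
        replace (z + 0 * - z)%C with z by ring. fold V. rewrite VV, re_RtoC.
        eapply Rle_trans; [now apply Re_conj_le|]. specialize (Rad z (1 - s) eq_refl ltac:(lra)). lra. }
    (* Tangential derivative: |v| <= 1 on the circle with equality at z. The signs 1 and -1 of [sg]
       together give Im c = 0. *)
    assert (Tan : forall sg : R, Re (RtoC sg * (Ci * c))%C <= 0).
    { intros sg.
      apply (der_one_sided (fun s => v (z * cexp (RtoC s * (RtoC sg * Ci))) * Cconj V)%C _ 0 1); [|lra|].
      - eapply der_eq.
        + apply der_mult; [|apply der_const].
          apply (der_comp RtoC v (fun s => z * cexp (RtoC s * (RtoC sg * Ci)))%C).
          * apply der_scal. apply der_cexp_comp. apply der_mult; [apply (der_e RtoC)|apply der_const].
          * rewrite Cmult_0_l, cexp_0, Cmult_1_r. now apply hol_der.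
        + cbv beta. rewrite !Cmult_0_l, cexp_0. unfold c. ring.
      - intros s _. rewrite Cmult_0_l, cexp_0, Cmult_1_r. fold V. rewrite VV, re_RtoC.
        eapply Rle_trans; [now apply Re_conj_le|].
        assert (E : Cmod (z * cexp (RtoC s * (RtoC sg * Ci)))%C = r).
        { rewrite Cmod_mult, Cmod_cexp. fold r.
          replace (Re (RtoC s * (RtoC sg * Ci))%C) with 0.
          - rewrite exp_0. ring.
          - rewrite !re_scal_l. unfold Ci, Re; simpl. ring. }
        specialize (Cir _ E). lra. }
    assert (Im0 : Im c = 0).
    { pose proof (Tan 1) as T1. pose proof (Tan (-1)) as T2.
      rewrite re_scal_l, Cmult_comm, re_mult_Ci in T1, T2. lra. }
    rewrite re_opp in C1.
    exists z, (Re c). repeat split; auto; [lra|].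
    fold V. fold c. destruct c as [a b]. simpl in *. unfold RtoC. now rewrite Im0.
Qed.

(** A minimum of 1/(1 + |h|) is a maximum of |h|, so [disc_min] applies. *)
Lemma disc_bounded (h : C -> C) rho : 0 <= rho ->
  (forall z, Cmod z <= rho -> ctn idC h z) -> exists M, 0 < M /\ forall z, Cmod z <= rho -> Cmod (h z) <= M.
Proof.
  intros Hr Hc.
  assert (Z : forall v : C, (v - 0)%C = v) by (intros; ring).
  destruct (disc_min (fun z => / (1 + Cmod (h z))) (RtoC 0) rho) as [z0 [Hz0 Hmin]]; auto.
  - intros z _. apply Rlt_le, Rinv_0_lt_compat. pose proof (Cmod_ge_0 (h z)). lra.
  - intros z Hz. rewrite Z in Hz.
    apply (ctn_ext _ (fun w => / (1 + RtoC (Cmod (h w))))%C _ _ 1); [lra| |].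
    + intros w _. rewrite <- RtoC_plus, RtoC_inv; auto. pose proof (Cmod_ge_0 (h w)). lra.
    + apply (ctn_comp idC Cinv (fun w => 1 + RtoC (Cmod (h w)))%C).
      * apply ctn_plus; [apply ctn_const|]. apply ctn_RCmod. auto.
      * apply ctn_Cinv. rewrite <- RtoC_plus. intros E. apply RtoC_inj in E.
        pose proof (Cmod_ge_0 (h z)). lra.
  - pose proof (Cmod_ge_0 (h z0)). exists (1 + Cmod (h z0)). split; [lra|]. intros z Hz.
    specialize (Hmin z). rewrite Z in Hmin. specialize (Hmin Hz). pose proof (Cmod_ge_0 (h z)).
    apply Rnot_lt_le. intros Q.
    assert (/ (1 + Cmod (h z)) < / (1 + Cmod (h z0))); [|lra].
    apply Rinv_lt_contravar; [apply Rmult_lt_0_compat; lra|lra].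
Qed.

Lemma disc_Re_lower (h : C -> C) rho : 0 <= rho ->
  (forall z, Cmod z <= rho -> ctn idC h z) -> (forall z, Cmod z <= rho -> 0 < Re (h z)) ->
  exists m, 0 < m /\ forall z, Cmod z <= rho -> m <= Re (h z).
Proof.
  intros Hr Hc Hp. assert (Z : forall v : C, (v - 0)%C = v) by (intros; ring).
  destruct (disc_min (fun z => Re (h z)) (RtoC 0) rho) as [z0 [Hz0 Hmin]]; auto.
  - intros z Hz. rewrite Z in Hz. apply Rlt_le. auto.
  - intros z Hz. rewrite Z in Hz. apply ctn_RRe. auto.
  - rewrite Z in Hz0. exists (Re (h z0)). split; auto. intros z Hz. apply Hmin. now rewrite Z.
Qed.

Lemma Re_inv_lower (w : C) m M : 0 < m -> m <= Re w -> Cmod w <= M -> m / (M * M) <= Re (/ w)%C.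
Proof.
  intros Hm H1 H2. pose proof (Cmod_ge_0 w).
  assert (Q : Cmod w * Cmod w <= M * M) by (apply Rmult_le_compat; auto).
  rewrite Cmod_sq in Q. destruct w as [x y]. unfold Re, Im, Cinv in *; simpl in *.
  rewrite !Rmult_1_r.
  assert (0 < x * x + y * y) by nra.
  apply Rmult_le_compat; try lra.
  - apply Rlt_le, Rinv_0_lt_compat. lra.
  - apply Rinv_le_contravar; lra.
Qed.

(* On the unit circle [Re (V / (1 - V)) = - 1/2]. *)
Lemma boundary_half_plane (Q V : C) c : - (1 / 2) < Re Q -> V <> RtoC 1 -> Cmod V = 1 -> 1 <= c ->
  (Q * (Cconj V - 1))%C <> RtoC c.
Proof.
  intros RQ N1 Mw Hc E. pose proof (Cmod_sq V) as S. rewrite Mw in S.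
  destruct Q as [x y]. destruct V as [a b].
  unfold Cconj, Cminus, Cplus, Copp, Cmult, RtoC, Re, Im in *; simpl in *.
  injection E as E1 E2.
  assert (Na : a < 1).
  { apply Rnot_le_lt. intros Qa. apply N1. assert (a = 1) by nra. subst a.
    assert (b = 0) by nra. now subst b. }
  assert (F : x * ((a - 1) * (a - 1) + b * b) = c * (a - 1)).
  { transitivity ((a - 1) * (x * (a + - (1)) - y * (- b + - 0)) - b * (x * (- b + - 0) + y * (a + - (1)))); [ring|].
    rewrite E1, E2. ring. }
  replace ((a - 1) * (a - 1) + b * b) with (2 * (1 - a)) in F by lra.
  assert (0 < (1 - a) * (2 * x + 1)) by (apply Rmult_lt_0_compat; lra).
  assert (0 <= (1 - a) * (c - 1)) by (apply Rmult_le_pos; lra).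
  lra.
Qed.

(** * Starlike functions of order lambda >= -1/2: cube root of g' and the chain *)

Section CloseToConvex.
Variables (lambda : R) (f : C -> C).
Hypothesis Hlam : -1/2 <= lambda < 1.
Hypothesis Hf : starlike_al 0 lambda f.
Let q := quot0 f.

Lemma ctc_cos0 : 0 < cos 0.
Proof. rewrite cos_0. lra. Qed.

Lemma ctc_hol_q : hol q.
Proof. apply hol_quot0. apply Hf. Qed.

Lemma ctc_q_neq0 z : inD z -> q z <> RtoC 0.
Proof. apply (spiral_quot0_neq0 0 lambda f Hf). Qed.

Lemma ctc_Re z : inD z -> lambda < Re (logd f z).
Proof.
  intros Hz. pose proof (spiral_Re 0 lambda f ltac:(lra) ctc_cos0 Hf z Hz) as H.
  unfold cexpi in H. rewrite cos_0, sin_0, Rmult_1_r in H.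
  change (1, 0) with (RtoC 1) in H. now rewrite Cmult_1_l in H.
Qed.

Let l' z := (C_derive q z / q z)%C.
Definition logq z := prim (fun z => C_derive (quot0 f) z / quot0 f z)%C z.

Lemma ctc_hol_l' : hol l'.
Proof.
  intros z Hz. eexists. apply der_div; [now apply ctc_q_neq0| |].
  - apply hol_der; auto. apply hol_C_derive, ctc_hol_q.
  - apply hol_der; auto. apply ctc_hol_q.
Qed.

Lemma ctc_der_logq z : inD z -> der idC logq z (l' z).
Proof. intros Hz. apply (prim_der l'); auto. apply ctc_hol_l'. Qed.

Lemma ctc_exp_logq z : inD z -> cexp (logq z) = q z.
Proof.
  intros Hz.
  assert (E : (q z * cexp (- logq z))%C = (q 0 * cexp (- logq 0))%C).
  { apply (hol_der_zero_const (fun z => q z * cexp (- logq z))%C); auto.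
    intros w Hw. eapply der_eq.
    - apply der_mult; [apply hol_der; auto; apply ctc_hol_q|].
      apply der_cexp_comp. apply der_opp. now apply ctc_der_logq.
    - cbv beta. unfold l'. field. now apply ctc_q_neq0. }
  unfold q at 2 in E. unfold logq at 2 in E.
  rewrite quot0_0, prim_0, Copp_0, cexp_0, Cmult_1_l, cexp_opp in E.
  transitivity (cexp (logq z) * (q z * / cexp (logq z)))%C; [rewrite E; ring|].
  field. apply cexp_neq0.
Qed.

Definition cbrt z := cexp (logq z / 3)%C.

Lemma ctc_der_cbrt z : inD z -> der idC cbrt z (cbrt z * (l' z / 3))%C.
Proof.
  intros Hz. unfold cbrt. apply (der_cexp_comp idC (fun z => logq z / 3)%C). unfold Cdiv.
  eapply der_eq; [apply der_mult; [now apply ctc_der_logq|apply der_const]|]. cbv beta. ring.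
Qed.

Lemma ctc_cube z : inD z -> (cbrt z * cbrt z * cbrt z)%C = q z.
Proof.
  intros Hz. rewrite <- ctc_exp_logq by auto. unfold cbrt. rewrite <- !cexp_plus. f_equal. field.
Qed.

Lemma ctc_cbrt_neq0 z : cbrt z <> RtoC 0.
Proof. apply cexp_neq0. Qed.

Lemma ctc_cbrt_0 : cbrt (RtoC 0) = RtoC 1.
Proof.
  unfold cbrt, logq. rewrite prim_0. replace (0 / 3)%C with (RtoC 0) by field. apply cexp_0.
Qed.

(* [Re cbrt > 1/2], the Marx-Strohhaecker inequality for the convex function with derivative [cbrt^2]. *)
Lemma ctc_jack z : inD z -> Cmod (1 - / cbrt z)%C < 1.
Proof.
  set (v := fun z => (1 - / cbrt z)%C). intros Hz.
  assert (Dv : forall z, inD z -> der idC v z (l' z / 3 * (1 - v z))%C).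
  { intros w Hw. unfold v. eapply der_eq.
    - apply der_minus; [apply der_const|].
      apply (der_comp idC Cinv); [now apply ctc_der_cbrt|]. apply der_Cinv, ctc_cbrt_neq0.
    - cbv beta. pose proof (ctc_cbrt_neq0 w). field. auto. }
  apply Rnot_le_lt. intros Q.
  destruct (jack_lemma v) as [w [c [Hw [Mw [Hc E]]]]].
  - intros w Hw. eauto.
  - unfold v. rewrite ctc_cbrt_0. field.
  - exists z. auto.
  - rewrite (C_derive_eq _ _ _ (Dv w Hw)) in E.
    (* Jack's equation becomes Q (1 - v) conj(v) = c with Q = (P - 1)/3, and (1 - v) conj(v) =
       conj(v) - 1 where |v| = 1. The bound Re P > -1/2 is exactly Re Q > -1/2, which
       [boundary_half_plane] excludes. *)
    set (Qv := ((logd f w - 1) / 3)%C).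
    assert (EQ : (w * (l' w / 3 * (1 - v w)) * Cconj (v w))%C = (Qv * ((1 - v w) * Cconj (v w)))%C).
    { unfold Qv, logd, l'. fold q. field. now apply ctc_q_neq0. }
    rewrite EQ in E.
    assert (RQ : - (1 / 2) < Re Qv).
    { pose proof (ctc_Re w Hw). replace Qv with (RtoC (/ 3) * (logd f w - 1))%C.
      - rewrite re_scal_l. unfold Cminus. rewrite re_plus, re_opp, re_RtoC. lra.
      - unfold Qv. rewrite RtoC_inv by lra. field. }
    assert (N1 : v w <> RtoC 1).
    { intros E1. apply C1_nz. transitivity (/ cbrt w * cbrt w)%C; [field; apply ctc_cbrt_neq0|].
      replace (/ cbrt w)%C with (1 - v w)%C by (unfold v; ring). rewrite E1. ring. }
    replace ((1 - v w) * Cconj (v w))%C with (Cconj (v w) - v w * Cconj (v w))%C in E by ring.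
    rewrite <- Cmod2_conj, Mw, pow1 in E.
    exact (boundary_half_plane Qv (v w) c RQ N1 Mw Hc E).
Qed.

Lemma ctc_cbrt_Re z : inD z -> 0 < Re (cbrt z).
Proof.
  intros Hz. pose proof (ctc_jack z Hz) as H. pose proof (ctc_cbrt_neq0 z) as N.
  set (w := (/ cbrt z)%C) in *.
  assert (Nw : w <> RtoC 0).
  { intros E. apply C1_nz. transitivity (cbrt z * w)%C; [unfold w; field; auto|rewrite E; ring]. }
  replace (cbrt z) with (/ w)%C by (unfold w; field; auto).
  assert (P : / (2 * 1) <= Re (/ w)%C).
  { apply Re_inv_disc; auto; [lra|]. rewrite Cmod_sub_sym. lra. }
  lra.
Qed.

Theorem ctc_alexander_classS : classS (alexander f).
Proof.
  pose proof Hf as [HA _]. pose proof (classA_hol f HA) as [Hh [f0 fd]].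
  apply alexander_classS; auto. intros r Hr x y Hx Hy.
  (* This is z k'/k = (1 + 2 P)/3. *)
  set (B := fun z => (1 + z * (2 / 3 * l' z))%C).
  set (k := fun z => (z * (cbrt z * cbrt z))%C).
  assert (Dk : forall z, inD z -> der idC k z (cbrt z * cbrt z * B z)%C).
  { intros z Hz. unfold k. eapply der_eq.
    - apply der_mult; [apply der_id|]. apply der_mult; now apply ctc_der_cbrt.
    - cbv beta. unfold B. field. }
  assert (Hk : hol k) by (intros z Hz; eauto).
  assert (k' : forall z, inD z -> C_derive k z = (cbrt z * cbrt z * B z)%C).
  { intros z Hz. apply C_derive_eq. auto. }
  assert (g' : forall z, inD z -> C_derive (alexander f) z = (cbrt z * cbrt z * cbrt z)%C).
  { intros z Hz. apply C_derive_eq. rewrite ctc_cube by auto. now apply alexander_der. }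
  assert (In : forall z, Cmod z <= r -> inD z) by (intros z Hz; unfold inD; lra).
  assert (Cc : forall z, Cmod z <= r -> ctn idC cbrt z).
  { intros z Hz. eapply der_ctn, ctc_der_cbrt. auto. }
  assert (CB : forall z, Cmod z <= r -> ctn idC B z).
  { intros z Hz. unfold B. apply ctn_plus; [apply ctn_const|]. apply ctn_mult; [apply ctn_id|].
    apply ctn_mult; [apply ctn_const|]. apply hol_ctn; auto. apply ctc_hol_l'. }
  assert (PB : forall z, Cmod z <= r -> 0 < Re (B z)).
  { intros z Hz. pose proof (ctc_Re z (In z Hz)) as R1.
    replace (B z) with (RtoC (2 / 3) * logd f z + RtoC (1 / 3))%C.
    - rewrite re_plus, re_scal_l, re_RtoC. lra.
    - unfold B, logd, l'. fold q. rewrite !RtoC_div by lra. field. apply ctc_q_neq0; auto. }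
  destruct (disc_bounded cbrt r ltac:(lra) Cc) as [M1 [PM1 HM1]].
  destruct (disc_bounded B r ltac:(lra) CB) as [M2 [PM2 HM2]].
  destruct (disc_Re_lower cbrt r ltac:(lra) Cc) as [m1 [Pm1 Hm1]].
  { intros z Hz. apply ctc_cbrt_Re. auto. }
  destruct (disc_Re_lower B r ltac:(lra) CB PB) as [m2 [Pm2 Hm2]].
  set (m := Rmin m1 m2). set (M := Rmax M1 M2).
  assert (Pm : 0 < m) by now apply Rmin_glb_lt.
  assert (PM : 0 < M) by (eapply Rlt_le_trans; [apply PM1|apply Rmax_l]).
  assert (La : m <= m1 /\ m <= m2 /\ M1 <= M /\ M2 <= M).
  { unfold m, M. repeat split; auto using Rmin_l, Rmin_r, Rmax_l, Rmax_r. }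
  assert (PMM : 0 < M * M) by now apply Rmult_lt_0_compat.
  (* Here z (g' + t k')/k = cbrt + t B has real part at least m (1 + t) and modulus at most M (1 +
     t), so its inverse has real part at least m/(M^2 (1 + t)). Halving makes the decay strict; any
     positive exponent, depending on r, is enough. *)
  set (b := m / (M * M) / 2).
  assert (Pb : 0 < m / (M * M)) by now apply Rdiv_lt_0_compat.
  pose proof (alexander_hol f HA) as Hg. pose proof (alexander_0 f) as g0.
  assert (k0 : k (RtoC 0) = RtoC 0) by (unfold k; ring).
  assert (B0 : B (RtoC 0) = RtoC 1) by (unfold B; ring).
  apply (chain_injective (alexander f) k r b); auto; try lra.
  - unfold b. lra.
  - rewrite k' by apply inD_0. rewrite ctc_cbrt_0, B0, !Cmult_1_r. apply C1_nz.
  - intros t Ht. rewrite k', g' by apply inD_0. rewrite ctc_cbrt_0, B0, !Cmult_1_r, <- RtoC_plus.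
    intros E. apply RtoC_inj in E. lra.
  - intros z t Ht Nz Hz.
    pose proof (Rpower_neg_le1 t b Ht ltac:(unfold b; lra)) as RP.
    assert (Hzr : Cmod z <= r) by nra. rewrite k', g' by auto.
    set (w := (cbrt z + RtoC t * B z)%C).
    assert (Rw : m * (1 + t) <= Re w).
    { unfold w. rewrite re_plus, re_scal_l. specialize (Hm1 z Hzr). specialize (Hm2 z Hzr). nra. }
    assert (Mw : Cmod w <= M * (1 + t)).
    { unfold w. eapply Rle_trans; [apply Cmod_triangle|]. rewrite Cmod_mult, Cmod_Rpos by auto.
      specialize (HM1 z Hzr). specialize (HM2 z Hzr). nra. }
    assert (Nw : w <> RtoC 0).
    { intros E. rewrite E, re_RtoC in Rw. nra. }
    replace (k z / (z * (cbrt z * cbrt z * cbrt z + RtoC t * (cbrt z * cbrt z * B z))))%C with (/ w)%C.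
    + pose proof (Re_inv_lower w (m * (1 + t)) (M * (1 + t)) ltac:(nra) Rw Mw) as I.
      eapply Rlt_le_trans; [|apply I].
      replace (m * (1 + t) / (M * (1 + t) * (M * (1 + t)))) with (m / (M * M) / (1 + t)) by (field; lra).
      unfold b. apply Rmult_lt_compat_r; [apply Rinv_0_lt_compat; lra|lra].
    + pose proof (ctc_cbrt_neq0 z). unfold k.
      replace (cbrt z * cbrt z * cbrt z + RtoC t * (cbrt z * cbrt z * B z))%C with (cbrt z * cbrt z * w)%C
        by (unfold w; ring). field. auto.
Qed.
End CloseToConvex.

(** * Non-univalent examples *)

Lemma one_minus_neq0 z : inD z -> (1 - z)%C <> RtoC 0.
Proof.
  intros Hz E. unfold inD in Hz. replace z with (RtoC 1) in Hz.
  - rewrite Cmod_1 in Hz. lra.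
  - transitivity (1 - (1 - z))%C; [rewrite E|]; ring.
Qed.

(* The branch of [- log (1 - z)] vanishing at [0]. *)
Definition mlog (z : C) : C := prim (fun z => / (1 - z))%C z.

Lemma der_mlog z : inD z -> der idC mlog z (/ (1 - z))%C.
Proof.
  intros Hz. apply (prim_der (fun z => / (1 - z))%C); auto.
  intros w Hw. eexists. apply (der_comp idC Cinv).
  - apply der_minus; [apply der_const|apply der_id].
  - apply der_Cinv. now apply one_minus_neq0.
Qed.

Lemma mlog_0 : mlog (RtoC 0) = RtoC 0.
Proof. apply prim_0. Qed.

Lemma exp_mlog z : inD z -> ((1 - z) * cexp (mlog z))%C = RtoC 1.
Proof.
  intros Hz.
  assert (E : ((1 - z) * cexp (mlog z))%C = ((1 - 0) * cexp (mlog 0))%C).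
  { apply (hol_der_zero_const (fun z => (1 - z) * cexp (mlog z))%C); auto.
    intros w Hw. eapply der_eq.
    - apply der_mult; [apply der_minus; [apply der_const|apply der_id]|].
      apply der_cexp_comp. now apply der_mlog.
    - cbv beta. field. now apply one_minus_neq0. }
  rewrite E, mlog_0, cexp_0. ring.
Qed.

(** The derivative of mlog(1 - e^x) + x is 0, so the choice of branch persists along any segment
    that x -> 1 - e^x keeps inside the disc. *)
Lemma mlog_segment p d : (forall t, 0 <= t <= 1 -> inD (1 - cexp (p + RtoC t * d))%C) ->
  mlog (1 - cexp p)%C = (- p)%C -> mlog (1 - cexp (p + d))%C = (- (p + d))%C.
Proof.
  intros HD Hp.
  assert (E : CInt (fun _ => RtoC 0) 0 1 =
    ((mlog (1 - cexp (p + RtoC 1 * d)) + (p + RtoC 1 * d)) -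
     (mlog (1 - cexp (p + RtoC 0 * d)) + (p + RtoC 0 * d)))%C).
  { apply (CInt_FTC (fun t => mlog (1 - cexp (p + RtoC t * d)) + (p + RtoC t * d))%C); [lra| |apply cont_on_const].
    intros t Ht. eapply der_eq.
    - apply der_plus; [|apply der_segment].
      apply (der_comp RtoC mlog (fun t => 1 - cexp (p + RtoC t * d))%C).
      + apply der_minus; [apply der_const|]. apply der_cexp_comp. apply der_segment.
      + apply der_mlog. auto.
    - pose proof (cexp_neq0 (p + RtoC t * d)%C).
      replace (1 - (1 - cexp (p + RtoC t * d)))%C with (cexp (p + RtoC t * d)) by ring. field. auto. }
  rewrite CInt_const in E by lra.
  replace (p + 1 * d)%C with (p + d)%C in E by ring. replace (p + 0 * d)%C with p in E by ring.
  rewrite Hp in E. apply Ceq_minus.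
  transitivity (RtoC (1 - 0) * 0)%C; [rewrite E|]; ring.
Qed.

(** For x = u + iv, |1 - e^x|^2 = 1 - e^u (2 cos v - e^u). *)
Lemma one_minus_cexp_inD (x : C) : exp (Re x) < 2 * cos (Im x) -> inD (1 - cexp x)%C.
Proof.
  intros H. unfold inD. pose proof (exp_pos (Re x)) as P.
  apply Rsqr_incrst_0; [|apply Cmod_ge_0|lra]. unfold Rsqr. rewrite Cmod_sq.
  unfold cexp. destruct x as [u v]. unfold Re, Im, Cminus, Cplus, Copp, RtoC in *; simpl in *.
  pose proof (sin2_cos2 v) as S. unfold Rsqr in S.
  replace ((1 + - (exp u * cos v)) * (1 + - (exp u * cos v)) + (0 + - (exp u * sin v)) * (0 + - (exp u * sin v)))
    with (1 - 2 * exp u * cos v + exp u * exp u * (sin v * sin v + cos v * cos v)) by ring.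
  rewrite S. nra.
Qed.

Lemma cos_scale_le t v : 0 <= t <= 1 -> Rabs v < PI / 2 -> cos v <= cos (t * v).
Proof.
  intros Ht Hv. pose proof PI_RGT_0.
  assert (E : forall x, cos x = cos (Rabs x)).
  { intros x. unfold Rabs. destruct (Rcase_abs x); auto. now rewrite cos_neg. }
  rewrite (E v), (E (t * v)), Rabs_mult, (Rabs_pos_eq t) by lra.
  pose proof (Rabs_pos v). apply cos_decr_1; nra.
Qed.

(* [- mlog] inverts [x |-> 1 - e^x] on the half-strip: go from [0] to [u] along the real axis, then up to [u + iv]. *)
Lemma mlog_one_minus_cexp (u v : R) : u <= 0 -> Rabs v < PI / 2 -> exp u < 2 * cos v ->
  inD (1 - cexp (u, v))%C /\ mlog (1 - cexp (u, v))%C = (- (u, v))%C.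
Proof.
  intros Hu Hv H. split; [now apply one_minus_cexp_inD|].
  replace (u, v) with (RtoC u + Ci * RtoC v)%C.
  2:{ unfold Ci, RtoC, Cplus, Cmult; simpl. apply injective_projections; simpl; ring. }
  apply mlog_segment.
  - intros t Ht. apply one_minus_cexp_inD.
    unfold Ci, RtoC, Cplus, Cmult, Re, Im; simpl.
    replace (u + (t * (0 * v - 1 * 0) - 0 * (0 * 0 + 1 * v))) with u by ring.
    replace (0 + (t * (0 * 0 + 1 * v) + 0 * (0 * v - 1 * 0))) with (t * v) by ring.
    pose proof (cos_scale_le t v Ht Hv). lra.
  - replace (RtoC u) with (0 + RtoC u)%C by ring. apply mlog_segment.
    + intros t Ht. apply one_minus_cexp_inD.
      unfold RtoC, Cplus, Cmult, Re, Im; simpl.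
      replace (0 + (t * u - 0 * 0)) with (t * u) by ring.
      replace (0 + (t * 0 + 0 * u)) with 0 by ring. rewrite cos_0.
      assert (exp (t * u) <= exp 0) by (apply exp_le; nra). rewrite exp_0 in H0. lra.
    + rewrite cexp_0. replace (1 - 1)%C with (RtoC 0) by ring. rewrite mlog_0. ring.
Qed.

Section Extremal.
Variables (nu : C).

(** That is z (1 - z)^(-nu); the Koebe function is nu = 2. *)
Definition spiral_koebe (z : C) : C := (z * cexp (nu * mlog z))%C.

Lemma der_cpow z : inD z -> der idC (fun z => cexp (nu * mlog z))%C z (cexp (nu * mlog z) * (nu * / (1 - z)))%C.
Proof. intros Hz. apply (der_cexp_comp idC (fun z => nu * mlog z)%C). apply der_scal. now apply der_mlog. Qed.

Lemma der_spiral_koebe z : inD z ->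
  der idC spiral_koebe z (cexp (nu * mlog z) * (1 + nu * (z / (1 - z))))%C.
Proof.
  intros Hz. unfold spiral_koebe. eapply der_eq.
  - apply der_mult; [apply der_id|now apply der_cpow].
  - cbv beta. field. now apply one_minus_neq0.
Qed.

Lemma spiral_koebe_classA : classA spiral_koebe.
Proof.
  split; [|split].
  - apply hol_analytic. intros z Hz. eexists. now apply der_spiral_koebe.
  - unfold spiral_koebe. ring.
  - apply is_derive_der. eapply der_eq; [apply der_spiral_koebe, inD_0|].
    rewrite mlog_0, Cmult_0_r, cexp_0. field.
Qed.

Lemma quot0_spiral_koebe z : quot0 spiral_koebe z = cexp (nu * mlog z)%C.
Proof.
  unfold quot0. destruct (Ceq_dec z (RtoC 0)) as [->|N].
  - rewrite mlog_0, Cmult_0_r, cexp_0. reflexivity.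
  - unfold spiral_koebe. field. auto.
Qed.

(** J[f] = (1 - (1 - z)^(1 - nu))/(1 - nu), written without the division; both sides agree at 0 and
    the left side has derivative 0. *)
Lemma spiral_koebe_alexander z : inD z ->
  ((1 - nu) * alexander spiral_koebe z + cexp (- (1 - nu) * mlog z))%C = RtoC 1.
Proof.
  intros Hz.
  assert (E : ((1 - nu) * alexander spiral_koebe z + cexp (- (1 - nu) * mlog z))%C =
    ((1 - nu) * alexander spiral_koebe 0 + cexp (- (1 - nu) * mlog 0))%C).
  { apply (hol_der_zero_const (fun z => (1 - nu) * alexander spiral_koebe z + cexp (- (1 - nu) * mlog z))%C); auto.
    intros w Hw. pose proof (one_minus_neq0 w Hw) as N. eapply der_eq.
    - apply der_plus.
      + apply der_scal. apply alexander_der; auto. apply spiral_koebe_classA.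
      + apply der_cexp_comp. apply der_scal. now apply der_mlog.
    - rewrite quot0_spiral_koebe. cbv beta.
      replace (- (1 - nu) * mlog w)%C with (nu * mlog w + - mlog w)%C by ring.
      rewrite cexp_plus, cexp_opp.
      replace (/ cexp (mlog w))%C with (1 - w)%C.
      + field. auto.
      + pose proof (exp_mlog w Hw) as Q. pose proof (cexp_neq0 (mlog w)).
        transitivity ((1 - w) * cexp (mlog w) * / cexp (mlog w))%C; [field; auto|rewrite Q; ring]. }
  rewrite E, alexander_0, mlog_0, !Cmult_0_r, cexp_0. ring.
Qed.

(** Here P = 1 + nu (1/(1 - z) - 1) and Re (1/(1 - z)) >= 1/2, so Re (e^(i alpha) P) >= cos(alpha) -
    R/2, which exceeds lambda cos(alpha) as R < 2 m. *)
Lemma spiral_koebe_starlike alpha lambda R :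
  (cexpi alpha * nu)%C = RtoC R -> 0 < R < 2 * ((1 - lambda) * cos alpha) ->
  starlike_al alpha lambda spiral_koebe.
Proof.
  intros Hnu HR. split; [apply spiral_koebe_classA|]. split.
  - intros z Hz N. unfold spiral_koebe. apply Cmult_neq_0; auto. apply cexp_neq0.
  - intros z d Hz N Hd. apply is_derive_der in Hd.
    pose proof (der_unique _ _ _ _ Hd (der_spiral_koebe z Hz)) as ->.
    pose proof (one_minus_neq0 z Hz) as N1. pose proof (cexp_neq0 (nu * mlog z)%C) as N2.
    replace (cexpi alpha * (z * (cexp (nu * mlog z) * (1 + nu * (z / (1 - z)))) / spiral_koebe z))%C
      with (cexpi alpha + (cexpi alpha * nu) * (/ (1 - z) - 1))%C.
    2:{ unfold spiral_koebe. field. auto. }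
    rewrite Hnu, re_plus, re_scal_l. replace (Re (/ (1 - z) - 1)%C) with (Re (/ (1 - z))%C - 1) by (unfold Cminus at 2; rewrite re_plus, re_opp, re_RtoC; ring).
    change (Re (cexpi alpha)) with (cos alpha).
    assert (H : / (2 * 1) <= Re (/ (1 - z))%C).
    { apply Re_inv_disc; auto; [lra|]. replace (1 - z - 1)%C with (- z)%C by ring.
      rewrite Cmod_opp. unfold inD in Hz. lra. }
    assert (R * / 2 <= R * Re (/ (1 - z))%C) by (apply Rmult_le_compat_l; lra).
    lra.
Qed.

(* [(1-z)^(1-nu)] takes the same value at two points [1 - e^x] whose [x] differ by [2 pi i / (1 - nu)]. *)
Lemma spiral_koebe_not_univalent : (1 - nu)%C <> RtoC 0 ->
  Rabs (Im (tpi / (1 - nu))%C) < PI -> ~ classS (alexander spiral_koebe).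
Proof.
  intros Ns HD [_ HS]. set (D := (tpi / (1 - nu))%C) in *.
  assert (ED : D = (Re D, Im D)) by (destruct D; reflexivity).
  set (a := Re D) in *. set (b := Im D) in *.
  assert (Hv : Rabs (b / 2) < PI / 2).
  { unfold Rdiv at 1. rewrite Rabs_mult, (Rabs_pos_eq (/ 2)) by lra. lra. }
  assert (Hc : 0 < cos (b / 2)).
  { apply Rabs_def2 in Hv. apply cos_gt_0; lra. }
  set (c := cos (b / 2)) in *. pose proof (Rinv_0_lt_compat c Hc) as Ic.
  (* Far enough to the left that both points U + a/2 + i b/2 and U - a/2 - i b/2 lie in the region
     of [mlog_one_minus_cexp]: there u <= - 1/c, and e^(-1/c) <= c. *)
  set (U := - Rabs (a / 2) - / c).
  assert (Eu : forall u, u <= - / c -> exp u < 2 * c).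
  { intros u Hu. apply Rle_lt_trans with (exp (- / c)); [now apply exp_le|].
    rewrite exp_Ropp. pose proof (exp_ineq1_le (/ c)).
    apply Rle_lt_trans with (/ / c); [apply Rinv_le_contravar; lra|].
    rewrite Rinv_inv. lra. }
  pose proof (Rle_abs (a / 2)) as A1. pose proof (Rle_abs (- (a / 2))) as A2. rewrite Rabs_Ropp in A2.
  destruct (mlog_one_minus_cexp (U + a / 2) (b / 2)) as [I1 L1]; auto.
  { unfold U; lra. } { apply Eu. unfold U; lra. }
  destruct (mlog_one_minus_cexp (U - a / 2) (- (b / 2))) as [I2 L2].
  { unfold U; lra. } { now rewrite Rabs_Ropp. } { rewrite cos_neg. apply Eu. unfold U; lra. }
  set (x1 := (U + a / 2, b / 2)) in *. set (x2 := (U - a / 2, - (b / 2))) in *.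
  assert (Ex : x1 = (x2 + D)%C).
  { rewrite ED. unfold x1, x2, Cplus; simpl. apply injective_projections; simpl; field. }
  assert (EE : cexp (- (1 - nu) * mlog (1 - cexp x1)) = cexp (- (1 - nu) * mlog (1 - cexp x2))).
  { rewrite L1, L2, Ex.
    replace (- (1 - nu) * - (x2 + D))%C with (- (1 - nu) * - x2 + tpi)%C by (unfold D; field; auto).
    rewrite cexp_plus, cexp_tpi. ring. }
  pose proof (spiral_koebe_alexander _ I1) as J1. pose proof (spiral_koebe_alexander _ I2) as J2.
  rewrite EE in J1.
  assert (EZ : (1 - cexp x1)%C = (1 - cexp x2)%C).
  { apply HS; auto.
    set (X := alexander spiral_koebe (1 - cexp x1)) in *. set (Y := alexander spiral_koebe (1 - cexp x2)) in *.
    set (W := cexp (- (1 - nu) * mlog (1 - cexp x2))) in *.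
    transitivity (((1 - nu) * X + W - W) / (1 - nu))%C; [field; auto|].
    transitivity (((1 - nu) * Y + W - W) / (1 - nu))%C; [now rewrite J1, J2|field; auto]. }
  (* Univalence would make D a period of the exponential; |Im D| < pi then leaves only D = 0,
     whereas D (1 - nu) = 2 pi i. *)
  assert (E1 : cexp D = RtoC 1).
  { assert (Q : cexp x1 = cexp x2).
    { transitivity (1 - (1 - cexp x1))%C; [ring|]. rewrite EZ. ring. }
    rewrite Ex, cexp_plus in Q. pose proof (cexp_neq0 x2).
    transitivity (/ cexp x2 * (cexp x2 * cexp D))%C; [field; auto|]. rewrite Q. field. auto. }
  assert (Pa : exp a = 1).
  { unfold a. rewrite <- Cmod_cexp, E1. apply Cmod_1. }
  assert (a0 : a = 0) by (apply exp_inv; now rewrite exp_0).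
  assert (Sb : sin b = 0).
  { apply (f_equal Im) in E1. unfold cexp in E1. fold a b in E1. rewrite Pa in E1.
    unfold RtoC, Im in E1; simpl in E1. lra. }
  assert (b0 : b = 0).
  { apply Rabs_def2 in HD. destruct (Rtotal_order b 0) as [L|[L|L]]; auto; exfalso.
    - pose proof (sin_gt_0 (- b) ltac:(lra) ltac:(lra)) as Q. rewrite sin_neg in Q. lra.
    - pose proof (sin_gt_0 b ltac:(lra) ltac:(lra)). lra. }
  apply tpi_neq0. transitivity (D * (1 - nu))%C; [unfold D; field; auto|].
  rewrite ED, a0, b0. change (0, 0) with (RtoC 0). ring.
Qed.
End Extremal.

(** * Choice of the counterexample and conclusion *)

Lemma exists_nonunivalent_alexander lambda alpha : lambda < 1 -> 0 < cos alpha -> sin alpha <> 0 ->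
  1 / 2 < (1 - lambda) * cos alpha ->
  exists f, starlike_al alpha lambda f /\ ~ classS (alexander f).
Proof.
  intros Hl Hc Hs Hm. set (m := (1 - lambda) * cos alpha) in *.
  pose proof (sin2_cos2 alpha) as SC. unfold Rsqr in SC.
  assert (Ps : 0 < sin alpha * sin alpha) by nra.
  assert (C1 : cos alpha < 1) by nra.
  (* The first bound gives R < 2 m. The second, with R > 1, gives R cos(alpha) <= 2 - R < 1, so the
     imaginary part below is positive. Both bounds exceed 1, the second because sin(alpha) <> 0
     forces cos(alpha) < 1. *)
  set (R := Rmin ((1 + 2 * m) / 2) (2 / (1 + cos alpha))).
  assert (Q : 2 / (1 + cos alpha) * (1 + cos alpha) = 2) by (field; lra).
  assert (R1 : 1 < R).
  { apply Rmin_glb_lt; [lra|]. apply Rmult_lt_reg_r with (1 + cos alpha); lra. }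
  assert (R2 : R < 2 * m) by (eapply Rle_lt_trans; [apply Rmin_l|lra]).
  assert (R3 : R * (1 + cos alpha) <= 2).
  { rewrite <- Q. apply Rmult_le_compat_r; [lra|apply Rmin_r]. }
  set (nu := (RtoC R * cexpi (- alpha))%C).
  exists (spiral_koebe nu). split.
  - apply (spiral_koebe_starlike nu alpha lambda R); [|unfold m in *; lra].
    unfold nu, cexpi, Cmult, RtoC; simpl. rewrite cos_neg, sin_neg.
    apply injective_projections; simpl; [|ring].
    transitivity (R * (sin alpha * sin alpha + cos alpha * cos alpha)); [ring|rewrite SC; ring].
  - assert (En : (1 - nu)%C = (1 - R * cos alpha, R * sin alpha)).
    { unfold nu, cexpi, Cminus, Cplus, Copp, Cmult, RtoC; simpl. rewrite cos_neg, sin_neg.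
      apply injective_projections; simpl; ring. }
    assert (P2 : 0 < (1 - R * cos alpha) * (1 - R * cos alpha) + R * sin alpha * (R * sin alpha)) by nra.
    assert (Ns : (1 - nu)%C <> RtoC 0).
    { rewrite En. intros E. injection E as E1 E2. nra. }
    apply spiral_koebe_not_univalent; auto.
    set (N := (1 - R * cos alpha) * (1 - R * cos alpha) + R * sin alpha * (R * sin alpha)) in *.
    (* As N = 1 - 2 R cos(alpha) + R^2, the factor of pi is below 1 exactly when R > 1. *)
    replace (Im (tpi / (1 - nu))%C) with (PI * (2 * (1 - R * cos alpha) / N)).
    2:{ rewrite En. unfold tpi, Cdiv, Cinv, Cmult, Im; simpl. fold N. rewrite !Rmult_1_r. fold N. field. lra. }
    pose proof PI_RGT_0.
    assert (S1 : 0 < 1 - R * cos alpha) by lra.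
    assert (EN : N = 1 - 2 * (R * cos alpha) + R * R).
    { unfold N. transitivity (1 - 2 * (R * cos alpha) + R * R * (sin alpha * sin alpha + cos alpha * cos alpha));
        [ring|rewrite SC; ring]. }
    assert (B : 0 <= 2 * (1 - R * cos alpha) / N < 1).
    { split; [apply Rmult_le_pos; [lra|apply Rlt_le, Rinv_0_lt_compat; lra]|].
      apply Rmult_lt_reg_r with N; auto. unfold Rdiv. rewrite Rmult_assoc, Rinv_l by lra.
      rewrite EN at 1. nra. }
    rewrite Rabs_pos_eq by (apply Rmult_le_pos; lra). nra.
Qed.

Theorem theorem2p5 :
  (forall lambda alpha : R,
     lambda < 1 -> - (PI / 2) < alpha < PI / 2 -> alpha <> 0 ->
     ((forall f : C -> C, starlike_al alpha lambda f -> classS (alexander f))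
      <-> cos alpha <= 1 / (2 * (1 - lambda))))
  /\
  (forall lambda : R,
     -1/2 <= lambda < 1 ->
     forall f : C -> C, starlike_al 0 lambda f -> classS (alexander f)).
Proof.
  split.
  - intros lambda alpha Hl Ha Na.
    assert (Hc : 0 < cos alpha) by (apply cos_gt_0; lra).
    assert (Hs : sin alpha <> 0).
    { destruct (Rtotal_order alpha 0) as [L|[L|L]]; [| contradiction |].
      - pose proof (sin_gt_0 (- alpha) ltac:(lra) ltac:(lra)) as Q. rewrite sin_neg in Q. lra.
      - pose proof (sin_gt_0 alpha ltac:(lra) ltac:(lra)). lra. }
    assert (E : cos alpha <= 1 / (2 * (1 - lambda)) <-> (1 - lambda) * cos alpha <= 1 / 2).
    { assert (Q : 1 / (2 * (1 - lambda)) * (1 - lambda) = 1 / 2) by (field; lra).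
      split; intros H.
      - apply Rmult_le_compat_r with (r := 1 - lambda) in H; lra.
      - apply Rmult_le_reg_r with (1 - lambda); lra. }
    rewrite E. split.
    + intros H. apply Rnot_lt_le. intros Q.
      destruct (exists_nonunivalent_alexander lambda alpha Hl Hc Hs Q) as [f [Hf Nf]]. apply Nf. auto.
    + intros H f Hf. apply (spiral_alexander_classS alpha lambda f); auto.
  - intros lambda Hl f Hf. now apply (ctc_alexander_classS lambda).
Qed.
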